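(* Let $E$ be a solid TIBF of bounded type on $\mathbb{R}^d$ and let $\mathcal{W}=(w_n)_{n\in\mathbb{N}}$ be a weight function system on $\mathbb{R}^d$ satisfying $(\mathrm{wM})$: for every $n\in\mathbb{N}$ there exist $m\ge n$ and $C>0$ such that $w_n(x+y)\le C w_m(x)$ for all $x\in\mathbb{R}^d$ and $|y|\le1$. Let $\phi\in\mathcal{D}$ with $\int_{\mathbb{R}^d}\phi\ne0$. Suppose $E$ is a closed subspace of $E_{\mathrm{mc}}$. Then for any $f\in\mathcal{D}'$: $f\in E^\infty_{\mathcal{W}}$ if and only if $\{f*\phi_j: j\in\mathbb{N}\}$ is bounded in $E^\infty_{\mathcal{W}}$.
   Context: $\mathbb{N}=\{0,1,2,\dots\}$; $\mathcal{D}$ is the space of compactly supported smooth functions on $\mathbb{R}^d$, $\mathcal{D}'$ the space of distributions; $T_xf(t)=f(t-x)$; $1_K$ is the indicator function of $K$. $\phi_j:=2^{jd}\phi(2^j\,\cdot\,)$ for $j\in\mathbb{N}$. Solid TIBF of bounded type: a Banach space $(E,\|\cdot\|_E)$ is a translation-invariant Banach function space (TIBF) of bounded type on $\mathbb{R}^d$ if $E$ is non-trivial, $E\subseteq L^1_{\mathrm{loc}}(\mathbb{R}^d)$ continuously, and: (A.1) $T_xE\subseteq E$ for all $x\in\mathbb{R}^d$; (A.2) there is $C_0>0$ with $\|T_xf\|_E\le C_0\|f\|_E$ for all $x\in\mathbb{R}^d$, $f\in E$; (A.3) $E$ is a Banach module over $L^1(\mathbb{R}^d)$ under convolution ($\|f*\varphi\|_E\le\|f\|_E\|\varphi\|_{L^1}$).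 It is solid if $f\in E$, $g\in L^1_{\mathrm{loc}}(\mathbb{R}^d)$ and $|g|\le|f|$ a.e. imply $g\in E$ and $\|g\|_E\le\|f\|_E$. Multiplicative module completion: $E_{\mathrm{mc}}:=\{f\in L^1_{\mathrm{loc}}(\mathbb{R}^d): 1_Kf\in E\text{ for all compact }K\subset\mathbb{R}^d\text{ and }\|f\|_{E_{\mathrm{mc}}}:=\sup_K\|1_Kf\|_E<\infty\}$ (supremum over compact $K$), a Banach space with norm $\|\cdot\|_{E_{\mathrm{mc}}}$; one always has $E\subseteq E_{\mathrm{mc}}$ continuously. A weight function is a locally bounded measurable function $\mathbb{R}^d\to[1,\infty)$; a weight function system is a sequence of weight functions $(w_n)_{n\in\mathbb{N}}$ with $w_n\le w_{n+1}$ for all $n$. For a weight function $\omega$ and $n\in\mathbb{N}$, $E^n_\omega:=\{f\in\mathcal{D}': f^{(\alpha)}\omega\in E\text{ for all }|\alpha|\le n\}$ (the distributional derivatives $f^{(\alpha)}$ being in $L^1_{\mathrm{loc}}$), with norm $\max_{|\alpha|\le n}\|f^{(\alpha)}\omega\|_E$; $E^\infty_{\mathcal{W}}:=\bigcap_nE^n_{w_n}$ with its projective limit Fréchet topology (bounded means bounded in each of these norms). *)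

(* Defs.v *)
From HB Require Import structures.
From mathcomp Require Import all_boot all_order all_algebra.
From mathcomp Require Import all_classical all_reals all_analysis.
From mathcomp Require Import complex.

Set Implicit Arguments.
Unset Strict Implicit.
Unset Printing Implicit Defensive.

Import Order.TTheory GRing.Theory Num.Theory.
Import numFieldNormedType.Exports.

Local Open Scope classical_set_scope.
Local Open Scope ring_scope.

Definition rV_display : measure_display -> measure_display.
Proof. exact. Qed.

Section rV_measurable.
Variables (R : realType) (n : nat).

Let coors : 'I_n -> 'rV[R]_n -> measurableTypeR R := fun i x => x 0 i.

Let rV_set0 : g_sigma_preimage coors set0.
Proof. exact: sigma_algebra0. Qed.

Let rV_setC A : g_sigma_preimage coors A -> g_sigma_preimage coors (~` A).
Proof. exact: sigma_algebraC. Qed.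

Let rV_bigcup (F : (set 'rV[R]_n)^nat) :
  (forall i, g_sigma_preimage coors (F i)) ->
  g_sigma_preimage coors (\bigcup_i (F i)).
Proof. exact: sigma_algebra_bigcup. Qed.

(* The sigma-algebra generated by the coordinates; it coincides with the Borel
   sigma-algebra of the product topology of 'rV[R]_n. *)
HB.instance Definition _ := @isMeasurable.Build (rV_display default_measure_display)
  'rV[R]_n (g_sigma_preimage coors) rV_set0 rV_setC rV_bigcup.

End rV_measurable.

Lemma measurable_rV_coord (R : realType) (n : nat) (i : 'I_n) :
  measurable_fun [set: 'rV[R]_n] (fun x => x 0 i : measurableTypeR R).
Proof.
move=> _ Y mY; rewrite setTI; apply: sub_sigma_algebra => /=.
rewrite -bigcup_seq/=; exists i => /=; first by rewrite mem_index_enum.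
by exists Y => //; rewrite setTI.
Qed.

Lemma measurable_fun_rVP d (T : measurableType d) (R : realType) (n : nat)
    (f : T -> 'rV[R]_n) :
  (forall i, measurable_fun setT (fun t => f t 0 i : measurableTypeR R)) ->
  measurable_fun setT f.
Proof.
move=> mf _ A mA; rewrite setTI.
suff : g_sigma_preimage (fun i t => f t 0 i : measurableTypeR R) (f @^-1` A).
  apply: smallest_sub; first exact: sigma_algebra_measurable.
  move=> B; rewrite -bigcup_seq/= => -[i _ [C mC <-]].
  exact: mf.
have := g_sigma_preimage_comp (fun i (x : 'rV[R]_n) => x 0 i : measurableTypeR R) f.
rewrite /comp => ->.
by exists A => //; rewrite setTI.
Qed.

Section lebesgue_rV.
Variable R : realType.

Definition rV_cons (n : nat) (xv : measurableTypeR R * 'rV[R]_n) : 'rV[R]_n.+1 :=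
  \row_i if unlift ord0 i is Some j then xv.2 0 j else xv.1.

Lemma measurable_rV_cons (n : nat) : measurable_fun setT (@rV_cons n).
Proof.
apply: measurable_fun_rVP => i.
have [j ij|i0] := unliftP ord0 i.
- apply: (eq_measurable_fun (fun xv : measurableTypeR R * 'rV[R]_n =>
    xv.2 0 j : measurableTypeR R)) => [xv _|].
    by rewrite /rV_cons mxE ij liftK.
  exact: (measurableT_comp (@measurable_rV_coord R n j)).
- apply: (eq_measurable_fun fst) => // xv _.
  by rewrite /rV_cons mxE i0 unlift_none.
Qed.

Section step.
Variables (n : nat) (mu : {sigma_finite_measure set 'rV[R]_n -> \bar R}).

Definition lebesgue_rV_step : set 'rV[R]_n.+1 -> \bar R :=
  pushforward (@lebesgue_measure R \x mu)%E (@rV_cons n).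

Let mpre A : measurable A -> measurable (@rV_cons n @^-1` A).
Proof.
by move=> mA; rewrite -[X in measurable X]setTI; exact: measurable_rV_cons.
Qed.

Let step0 : lebesgue_rV_step set0 = 0%E.
Proof. by rewrite /lebesgue_rV_step /pushforward preimage_set0 measure0. Qed.

Let step_ge0 A : (0 <= lebesgue_rV_step A)%E.
Proof. by rewrite /lebesgue_rV_step /pushforward. Qed.

Let step_sigma_additive : semi_sigma_additive lebesgue_rV_step.
Proof.
move=> F mF tF mUF; rewrite /lebesgue_rV_step /pushforward preimage_bigcup.
apply: measure_semi_sigma_additive => [k||]; first exact: mpre.
- apply/trivIsetP => /= i j _ _ ij; rewrite -preimage_setI.
  by move/trivIsetP : tF => /(_ _ _ _ _ ij) ->//; rewrite preimage_set0.
- by rewrite -preimage_bigcup; exact: mpre.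
Qed.

HB.instance Definition _ := isMeasure.Build _ _ _
  lebesgue_rV_step step0 step_ge0 step_sigma_additive.

Let step_sigma_finite : sigma_finite setT lebesgue_rV_step.
Proof.
have [F FT Foo] : sigma_finite setT (@lebesgue_measure R \x mu)%E.
  have /sigma_finiteP[F [TF ndF Foo]] := sigma_finiteT (@lebesgue_measure R).
  have /sigma_finiteP[G [TG ndG Goo]] := sigma_finiteT mu.
  exists (fun k => F k `*` G k).
    rewrite -setXTT TF TG predeqE => -[x y]; split.
      move=> [/= [k _ Fkx] [l _ Gly]]; exists (maxn k l) => //; split.
      - by move: x Fkx; exact/subsetPset/ndF/leq_maxl.
      - by move: y Gly; exact/subsetPset/ndG/leq_maxr.
    by move=> [k _ []/= ? ?]; split; exists k.
  move=> k; have [? ?] := Foo k; have [? ?] := Goo k.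
  split; first exact: measurableX.
  by rewrite product_measure1E// lte_mul_pinfty// ge0_fin_numE.
pose g (v : 'rV[R]_n.+1) : measurableTypeR R * 'rV[R]_n :=
  (v 0 ord0, \row_j v 0 (lift ord0 j)).
have mg : measurable_fun setT g.
  apply/measurable_fun_pair; first exact: measurable_rV_coord.
  apply: measurable_fun_rVP => j.
  apply: (eq_measurable_fun (fun v : 'rV[R]_n.+1 => v 0 (lift ord0 j))).
    by move=> v _; rewrite mxE.
  exact: measurable_rV_coord.
have consK : cancel (@rV_cons n) g.
  case=> x v; rewrite /g /rV_cons/= mxE unlift_none; congr pair.
  by apply/rowP => j; rewrite !mxE liftK.
exists (fun k => g @^-1` F k).
  by rewrite -preimage_bigcup -FT preimage_setT.
move=> k; have [mF Fk] := Foo k; split.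
  by rewrite -[X in measurable X]setTI; exact: mg.
rewrite /lebesgue_rV_step /pushforward -comp_preimage.
rewrite (_ : g \o _ = id) ?preimage_id//.
by apply/funext => x /=; rewrite consK.
Qed.

HB.instance Definition _ :=
  Measure_isSigmaFinite.Build _ _ _ lebesgue_rV_step step_sigma_finite.

End step.

Fixpoint lebesgue_rV (n : nat) :
    {sigma_finite_measure set 'rV[R]_n -> \bar R} :=
  match n return {sigma_finite_measure set 'rV[R]_n -> \bar R} with
  | 0 => [the {sigma_finite_measure set 'rV[R]_0 -> \bar R} of \d_(0 : 'rV[R]_0)]
  | n'.+1 => [the {sigma_finite_measure set 'rV[R]_n'.+1 -> \bar R} of
      lebesgue_rV_step (lebesgue_rV n')]
  end.

Lemma lebesgue_rV_box (n : nat) (A : 'I_n -> set (measurableTypeR R)) :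
  (forall i, measurable (A i)) ->
  lebesgue_rV n [set v | forall i, A i (v 0 i)] =
  (\prod_(i < n) lebesgue_measure (A i))%E.
Proof.
elim: n A => [|n IHn] A mA.
  by rewrite big_ord0 /= diracE mem_set// => -[].
pose B := [set v : 'rV[R]_n | forall i, A (lift ord0 i) (v 0 i)].
have mB : measurable B.
  rewrite (_ : B = \bigcap_(i in [set: 'I_n])
      ((fun v : 'rV[R]_n => v 0 i : measurableTypeR R) @^-1` A (lift ord0 i))).
    apply: fin_bigcap_measurable => [|i _]; first exact: finite_finset.
    by rewrite -[X in measurable X]setTI; exact: measurable_rV_coord.
  by apply/seteqP; split => v /= Bv i; [move=> _; exact: Bv|exact: Bv].
rewrite big_ord_recl -IHn// -/B /= /lebesgue_rV_step /pushforward.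
rewrite -product_measure1E//; congr ((_ \x _)%E _).
apply/seteqP; split => -[x v] /=; rewrite /rV_cons.
  move=> Av; split => [|i] /=.
    by have := Av ord0; rewrite mxE unlift_none.
  by have := Av (lift ord0 i); rewrite mxE liftK.
move=> [Ax Bv] i; rewrite mxE.
by case: unliftP => [j ->|->]; [exact: Bv|].
Qed.

End lebesgue_rV.

Section functions.
Variables (R : realType) (d : nat).

Local Notation Rd := 'rV[R]_d.
Local Notation C := R[i].
Local Notation mu := (lebesgue_rV R d).

Definition enorm (x : Rd) : R := Num.sqrt (\sum_(i < d) x 0 i ^+ 2).

Definition modulus (f : Rd -> C) : Rd -> R := fun x => Normc.normc (f x).

Definition ae_equal (T : Type) (f g : Rd -> T) : Prop :=
  {ae mu, forall x, f x = g x}.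

(* Lebesgue (as opposed to Borel) measurability: equality almost everywhere
   with a Borel function. *)
Definition lebesgue_measurable (f : Rd -> R) : Prop :=
  exists2 g : Rd -> R, measurable_fun setT g & ae_equal f g.

Definition clebesgue_measurable (f : Rd -> C) : Prop :=
  lebesgue_measurable (fun x => complex.Re (f x)) /\
  lebesgue_measurable (fun x => complex.Im (f x)).

Definition integrable_on (A : set Rd) (f : Rd -> C) : Prop :=
  clebesgue_measurable f /\ (\int[mu]_(x in A) (modulus f x)%:E < +oo)%E.

Definition L1 (f : Rd -> C) : Prop := integrable_on setT f.

Definition L1loc (f : Rd -> C) : Prop :=
  forall K : set Rd, compact K -> integrable_on K f.

Definition L1norm_on (A : set Rd) (f : Rd -> C) : R :=
  (\int[mu]_(x in A) modulus f x)%R.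

Definition cintegral (f : Rd -> C) : C :=
  ((\int[mu]_x complex.Re (f x))%R +i* (\int[mu]_x complex.Im (f x))%R)%C.

Definition translate (x : Rd) (f : Rd -> C) : Rd -> C := fun t => f (t - x).

Definition convolution (f g : Rd -> C) : Rd -> C :=
  fun x => cintegral (fun y => f (x - y) * g y).

Definition restrict_to (K : set Rd) (f : Rd -> C) : Rd -> C :=
  fun x => (\1_K x)%:C%C * f x.

Definition weighted (f : Rd -> C) (w : Rd -> R) : Rd -> C :=
  fun x => f x * (w x)%:C%C.

(* A space of (classes of) functions is given by the set [E] of all
   representatives of its elements together with its norm [N], which is only
   meaningful on [E].  [nE] is a norm modulo equality almost everywhere. *)
Record banach_function_space (E : set (Rd -> C)) (N : (Rd -> C) -> R) : Prop :=
  BanachFunctionSpace {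
  bfs_L1loc : forall f, E f -> L1loc f ;
  bfs_ae : forall f g, E f -> ae_equal f g -> E g /\ N g = N f ;
  bfs_zero : E (fun=> 0) ;
  bfs_add : forall f g, E f -> E g ->
    E (fun x => f x + g x) /\ N (fun x => f x + g x) <= N f + N g ;
  bfs_scale : forall (a : C) f, E f ->
    E (fun x => a * f x) /\ N (fun x => a * f x) = Normc.normc a * N f ;
  bfs_definite : forall f, E f -> N f = 0 -> ae_equal f (fun=> 0) ;
  bfs_complete : forall u : nat -> Rd -> C, (forall k, E (u k)) ->
    (forall e : R, 0 < e -> exists k0 : nat, forall k l : nat,
      (k0 <= k)%N -> (k0 <= l)%N -> N (fun x => u k x - u l x) < e) ->
    exists2 f, E f & N (fun x => u k x - f x) @[k --> \oo] --> (0 : R) ;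
  bfs_continuous : forall K : set Rd, compact K ->
    exists c : R, forall f, E f -> L1norm_on K f <= c * N f ;
  bfs_nontrivial : exists2 f, E f & ~ ae_equal f (fun=> 0) }.

Record TIBF_bounded_type (E : set (Rd -> C)) (N : (Rd -> C) -> R) : Prop :=
  TIBFBoundedType {
  tibf_banach : banach_function_space E N ;
  tibf_translate : forall x f, E f -> E (translate x f) ;
  tibf_translate_bounded : exists2 C0 : R, 0 < C0 &
    forall x f, E f -> N (translate x f) <= C0 * N f ;
  (* The first clause says that the integral defining f * g converges
     absolutely at almost every point. *)
  tibf_convolution : forall f g, E f -> L1 g ->
    [/\ {ae mu, forall x, L1 (fun y => f (x - y) * g y)},
        E (convolution f g) &
        N (convolution f g) <= N f * L1norm_on setT g] }.

Definition solid (E : set (Rd -> C)) (N : (Rd -> C) -> R) : Prop :=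
  forall f g, E f -> L1loc g ->
    {ae mu, forall x, modulus g x <= modulus f x} -> E g /\ N g <= N f.

Section mc.
Variables (E : set (Rd -> C)) (N : (Rd -> C) -> R).

Definition mc_values (f : Rd -> C) : set R :=
  [set N (restrict_to K f) | K in [set K : set Rd | compact K]].

Definition mc_norm (f : Rd -> C) : R := sup (mc_values f).

Definition mc : set (Rd -> C) :=
  [set f | [/\ L1loc f,
    (forall K : set Rd, compact K -> E (restrict_to K f)) &
    has_ubound (mc_values f)]].

Definition closed_subspace_of_mc : Prop :=
  E `<=` mc /\
  forall f, mc f ->
    (forall e : R, 0 < e -> exists2 g, E g & mc_norm (fun x => f x - g x) < e) ->
    E f.

End mc.

Definition partial (i : 'I_d) (f : Rd -> C) : Rd -> C := fun x =>
  ('D_(delta_mx 0 i) (fun y => complex.Re (f y)) x +i*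
   'D_(delta_mx 0 i) (fun y => complex.Im (f y)) x)%C.

Definition smooth (f : Rd -> C) : Prop :=
  forall s : seq 'I_d, let g := foldr partial f s in
    [/\ continuous (fun y => complex.Re (g y)),
        continuous (fun y => complex.Im (g y)) &
        forall x i,
          derivable (fun y => complex.Re (g y)) x (delta_mx 0 i) /\
          derivable (fun y => complex.Im (g y)) x (delta_mx 0 i)].

Definition multi_index := 'I_d -> nat.

Definition mi_order (a : multi_index) : nat := (\sum_(i < d) a i)%N.

Definition partials (a : multi_index) (f : Rd -> C) : Rd -> C :=
  foldr (fun i g => iter (a i) (partial i) g) f (enum 'I_d).

Definition vanishes_off (K : set Rd) (f : Rd -> C) : Prop :=
  forall x, ~ K x -> f x = 0.

Definition test_function (f : Rd -> C) : Prop :=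
  smooth f /\ exists2 K : set Rd, compact K & vanishes_off K f.

(* Only the values on test functions are meaningful: two functionals that agree
   on them are the same distribution. *)
Definition functional := (Rd -> C) -> C.

(* In the continuity clause, [M] ranges over the upper bounds of the seminorm
   max_(|a| <= m) sup_x |(partials a f) x|. *)
Record is_distribution (u : functional) : Prop := Distribution {
  distribution_linear : forall (c : C) f g,
    test_function f -> test_function g ->
    u (fun x => c * f x + g x) = c * u f + u g ;
  distribution_continuous : forall K : set Rd, compact K ->
    exists (c : R) (m : nat), forall f (M : R),
      test_function f -> vanishes_off K f ->
      (forall a x, (mi_order a <= m)%N -> modulus (partials a f) x <= M) ->
      Normc.normc (u f) <= c * M }.

Definition dderiv (a : multi_index) (u : functional) : functional :=
  fun f => (-1) ^+ mi_order a * u (partials a f).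

Definition dist_of (g : Rd -> C) : functional :=
  fun f => cintegral (fun x => g x * f x).

Definition represents (g : Rd -> C) (u : functional) : Prop :=
  L1loc g /\ forall f, test_function f -> u f = dist_of g f.

(* A locally integrable function representing [u], when there is one; it is
   then unique up to equality almost everywhere. *)
Definition density (u : functional) : Rd -> C :=
  xget (fun=> 0) [set g | represents g u].

Definition dist_convolution (u : functional) (phi : Rd -> C) : Rd -> C :=
  fun x => u (fun y => phi (x - y)).

Definition dilation (phi : Rd -> C) (j : nat) : Rd -> C :=
  fun x => (2 ^+ (j * d))%:C%C * phi (2 ^+ j *: x).

Definition weight_function (w : Rd -> R) : Prop :=
  [/\ lebesgue_measurable w,
      (forall x, 1 <= w x) &
      forall K : set Rd, compact K -> exists M : R, forall x, K x -> w x <= M].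

Definition weight_function_system (w : nat -> Rd -> R) : Prop :=
  (forall n, weight_function (w n)) /\ (forall n x, w n x <= w n.+1 x).

Definition wM (w : nat -> Rd -> R) : Prop :=
  forall n : nat, exists (m : nat) (c : R),
    [/\ (n <= m)%N, 0 < c &
        forall x y, enorm y <= 1 -> w n (x + y) <= c * w m x].

Section weighted_spaces.
Variables (E : set (Rd -> C)) (N : (Rd -> C) -> R).

Definition En (n : nat) (w : Rd -> R) : set functional :=
  [set u | is_distribution u /\
    forall a : multi_index, (mi_order a <= n)%N ->
      (exists g, represents g (dderiv a u)) /\
      E (weighted (density (dderiv a u)) w)].

Definition En_norm (n : nat) (w : Rd -> R) (u : functional) : R :=
  \big[Num.max/0]_(a : {ffun 'I_d -> 'I_n.+1} | (mi_order (fun i => a i) <= n)%N)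
    N (weighted (density (dderiv (fun i => a i) u)) w).

Definition EW (w : nat -> Rd -> R) : set functional :=
  [set u | forall n, En n (w n) u].

Definition EW_bounded (w : nat -> Rd -> R) (B : set functional) : Prop :=
  B `<=` EW w /\
  forall n, exists M : R, forall u, B u -> En_norm n (w n) u <= M.

End weighted_spaces.

End functions.

(* Main.v *)
(** Write c for the integral of phi and F_k := f * phi_k. The function
    phi - phi_1 has zero mean and is explicitly a divergence
    sum_i d_i eta_i of test functions, so that
      F_k * (phi_j - phi_(j+1)) = 2^-j sum_i (d_i F_k) * eta_(i,j).
    If f lies in the weighted space, or if the F_k are bounded there, then
    (wM), solidity and the L1-module structure of E bound convolutions with
    test functions: the norm of g * chi in E_(w_n) is at most a constant
    times the norm of g in E_(w_m) and the L1 norm of chi, uniformly over chi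
    supported in a fixed ball. This gives the direct implication at once. For
    the converse, together with F_k * phi_j = F_j * phi_k, it shows that
    G_j := F_j * phi_j and its derivatives are Cauchy in the weighted spaces;
    since G_j tends to c^2 f in the sense of distributions, the limits divided
    by c^2 are the derivatives of f. *)

Require Import Defs.
From mathcomp Require Import all_boot all_order all_algebra.
From mathcomp Require Import all_classical all_reals all_analysis.
From mathcomp Require Import measurable_realfun complex ring lra.

Set Implicit Arguments.
Unset Strict Implicit.
Unset Printing Implicit Defensive.

Import Order.TTheory GRing.Theory Num.Theory.
Import numFieldNormedType.Exports.

Local Open Scope classical_set_scope.
Local Open Scope ring_scope.

Local Notation Re := complex.Re.
Local Notation Im := complex.Im.
Local Notation cn := Normc.normc.

(** * Complex-valued integrals *)

(** The hypothesis controls only the functions F_k, whereas F_j - F_(j+1) is a sum of derivatives of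
    f * eta_(i,j), about which it says nothing. This is why a second mollification is made: in F_k *
    (phi_j - phi_(j+1)) the kernels eta_(i,j) meet only derivatives of the controlled F_k. In G_j -
    G_(j+1) = (F_j * phi_j - F_j * phi_(j+1)) + (F_(j+1) * phi_j - F_(j+1) * phi_(j+1)) the two
    middle terms cancel by symmetry, and each bracket is of order 2^-j. The price is one derivative
    of F_k, paid by passing to a later index of the projective limit. Elements of E are known only
    up to null sets and [En] refers to a density chosen by [xget], so explicit representatives are
    matched with it by the lemma of du Bois-Reymond, for which phi itself serves as mollifier.
    Smoothness of convolutions, of dilations and of the eta_i is obtained from one statement about
    integrals over families of coordinatewise affine maps. *)

Section complex_scalars.
Variable R : realType.
Implicit Types z w : R[i].

Lemma cReD z w : Re (z + w) = Re z + Re w. Proof. by case: z; case: w. Qed.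
Lemma cImD z w : Im (z + w) = Im z + Im w. Proof. by case: z; case: w. Qed.
Lemma cReN z : Re (- z) = - Re z. Proof. by case: z. Qed.
Lemma cImN z : Im (- z) = - Im z. Proof. by case: z. Qed.
Lemma cReM z w : Re (z * w) = Re z * Re w - Im z * Im w.
Proof. by case: z; case: w. Qed.
Lemma cImM z w : Im (z * w) = Re z * Im w + Im z * Re w.
Proof. by case: z; case: w. Qed.

Lemma complex_ext z w : Re z = Re w -> Im z = Im w -> z = w.
Proof. by case: z => a b; case: w => c e /= -> ->. Qed.

Lemma cn_ge0 z : 0 <= cn z.
Proof. by case: z => a b; rewrite /= sqrtr_ge0. Qed.

Lemma cn_eq0 z : cn z = 0 -> z = 0. Proof. exact: Normc.eq0_normc. Qed.

Lemma cn0 : cn (0 : R[i]) = 0. Proof. exact: Normc.normc0. Qed.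

Lemma cn_real (a : R) : cn a%:C%C = `|a|.
Proof. by rewrite /= expr0n addr0 sqrtr_sqr. Qed.

Lemma cnM z w : cn (z * w) = cn z * cn w. Proof. exact: Normc.normcM. Qed.

Lemma cnD z w : cn (z + w) <= cn z + cn w. Proof. exact: le_normcD. Qed.

Lemma cnN z : cn (- z) = cn z. Proof. exact: normcN. Qed.

Lemma cnB z w : cn (z - w) <= cn z + cn w.
Proof. by rewrite -(cnN w) cnD. Qed.

Lemma cnC z w : cn (z - w) = cn (w - z). Proof. by rewrite -cnN opprB. Qed.

Lemma cn_Re z : `|Re z| <= cn z.
Proof.
by case: z => a b /=; rewrite -sqrtr_sqr ler_wsqrtr// lerDl sqr_ge0.
Qed.

Lemma cn_Im z : `|Im z| <= cn z.
Proof.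
by case: z => a b /=; rewrite -sqrtr_sqr ler_wsqrtr// lerDr sqr_ge0.
Qed.

Lemma cn_le z : cn z <= `|Re z| + `|Im z|.
Proof.
case: z => a b /=; rewrite -[leRHS]ger0_norm ?addr_ge0// -sqrtr_sqr.
rewrite ler_wsqrtr// sqrrD !real_normK ?num_real// -addrA lerD2l lerDr.
by rewrite mulrn_wge0// mulr_ge0.
Qed.

Lemma cn_sqr z : cn z ^+ 2 = Re z ^+ 2 + Im z ^+ 2.
Proof. by case: z => a b /=; rewrite sqr_sqrtr// addr_ge0 ?sqr_ge0. Qed.

Lemma cn_exp z n : cn (z ^+ n) = cn z ^+ n.
Proof. by elim: n => [|n IH]; rewrite ?expr0 ?Normc.normc1// !exprS cnM IH. Qed.

Lemma cn_sign n : cn ((-1) ^+ n : R[i]) = 1.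
Proof. by rewrite cn_exp cnN Normc.normc1 expr1n. Qed.

Lemma cn_le_all z : (forall e : R, 0 < e -> cn z <= e) -> z = 0.
Proof.
move=> h; apply: cn_eq0; apply/eqP; rewrite eq_le cn_ge0 andbT.
by apply/ler_addgt0Pl => e e0; rewrite addr0 h.
Qed.

End complex_scalars.

Section complex_integral.
Context dT (T : measurableType dT) (R : realType).
Variable mu : {measure set T -> \bar R}.
Implicit Types f g : T -> R[i].

Definition cmeasurable f :=
  measurable_fun setT (fun x => Re (f x)) /\
  measurable_fun setT (fun x => Im (f x)).

Definition cintegrable f :=
  cmeasurable f /\ mu.-integrable setT (fun x => (cn (f x))%:E).

(** The measure is kept arbitrary: Lebesgue measure on row vectors, where this is [cintegral], a
    Dirac mass and Lebesgue measure on the line all occur. *)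
Definition cint f : R[i] :=
  ((\int[mu]_x Re (f x))%R +i* (\int[mu]_x Im (f x))%R)%C.

Lemma cmeasurable_cst (c : R[i]) : cmeasurable (fun=> c).
Proof. by split; exact: measurable_cst. Qed.

Lemma cmeasurableD f g : cmeasurable f -> cmeasurable g ->
  cmeasurable (fun x => f x + g x).
Proof.
move=> [f1 f2] [g1 g2]; split.
  by under eq_fun do rewrite cReD; exact: measurable_funD.
by under eq_fun do rewrite cImD; exact: measurable_funD.
Qed.

Lemma cmeasurableN f : cmeasurable f -> cmeasurable (fun x => - f x).
Proof.
move=> [f1 f2]; split.
  by under eq_fun do rewrite cReN; exact: measurable_funN.
by under eq_fun do rewrite cImN; exact: measurable_funN.
Qed.

Lemma cmeasurableB f g : cmeasurable f -> cmeasurable g ->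
  cmeasurable (fun x => f x - g x).
Proof. by move=> mf mg; apply: cmeasurableD => //; exact: cmeasurableN. Qed.

Lemma cmeasurableM f g : cmeasurable f -> cmeasurable g ->
  cmeasurable (fun x => f x * g x).
Proof.
move=> [f1 f2] [g1 g2]; split.
  under eq_fun do rewrite cReM.
  by apply: measurable_funB; apply: measurable_funM.
under eq_fun do rewrite cImM.
by apply: measurable_funD; apply: measurable_funM.
Qed.

Lemma cmeasurable_real (h : T -> R) : measurable_fun setT h ->
  cmeasurable (fun x => (h x)%:C%C).
Proof. by move=> mh; split => //=; exact: measurable_cst. Qed.

Lemma cmeasurable_cn f : cmeasurable f -> measurable_fun setT (fun x => cn (f x)).
Proof.
move=> [f1 f2]; apply: (eq_measurable_fun (fun x =>
    Num.sqrt (Re (f x) ^+ 2 + Im (f x) ^+ 2))) => [x _|].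
  by case: (f x).
apply: (measurableT_comp (continuous_measurable_fun (@sqrt_continuous R))).
by apply: measurable_funD; apply: measurable_funX.
Qed.

Lemma cintegrable_Re f : cintegrable f ->
  mu.-integrable setT (EFin \o (fun x => Re (f x))).
Proof.
move=> [[f1 f2] fi]; apply: le_integrable fi => //.
  exact/measurable_EFinP.
by move=> x _; rewrite lee_fin; exact: le_trans (cn_Re _) (ler_norm _).
Qed.

Lemma cintegrable_Im f : cintegrable f ->
  mu.-integrable setT (EFin \o (fun x => Im (f x))).
Proof.
move=> [[f1 f2] fi]; apply: le_integrable fi => //.
  exact/measurable_EFinP.
by move=> x _; rewrite lee_fin; exact: le_trans (cn_Im _) (ler_norm _).
Qed.

Lemma cintegrable_le f (h : T -> R) : cmeasurable f ->
  mu.-integrable setT (EFin \o h) -> (forall x, cn (f x) <= h x) ->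
  cintegrable f.
Proof.
move=> mf ih fh; split => //; apply: le_integrable ih => //.
  exact/measurable_EFinP/cmeasurable_cn.
move=> x _; rewrite lee_fin ger0_norm ?cn_ge0//.
by rewrite (le_trans (fh x))// ler_norm.
Qed.

Lemma cintegrableP f : cmeasurable f ->
  (\int[mu]_x (cn (f x))%:E < +oo)%E -> cintegrable f.
Proof.
move=> mf h; split=> //; apply/integrableP; split.
  exact/measurable_EFinP/cmeasurable_cn.
by under eq_integral do rewrite gee0_abs ?lee_fin ?cn_ge0//.
Qed.

Lemma cintegrableZ f (c : R[i]) : cintegrable f ->
  cintegrable (fun x => c * f x).
Proof.
move=> [mf fi]; apply: (@cintegrable_le _ (fun x => cn c * cn (f x))).
- by apply: cmeasurableM => //; exact: cmeasurable_cst.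
- exact: (@integrableZl _ _ _ mu _ measurableT (cn c) _ fi).
- by move=> x; rewrite cnM.
Qed.

(** The bound on [g] is asked only where [f] is nonzero, which admits factors that are unbounded
    elsewhere. *)
Lemma cintegrableM_bounded f g (M : R) : cintegrable f -> cmeasurable g ->
  (forall x, f x != 0 -> cn (g x) <= M) -> cintegrable (fun x => f x * g x).
Proof.
move=> [mf fi] mg gM; apply: (@cintegrable_le _ (fun x => M * cn (f x))).
- exact: cmeasurableM.
- exact: (@integrableZl _ _ _ mu _ measurableT M _ fi).
- move=> x; rewrite cnM mulrC; have [->|/gM h] := eqVneq (f x) 0.
    by rewrite cn0 !mulr0.
  by rewrite ler_wpM2r ?cn_ge0.
Qed.

Lemma cintegrableD f g : cintegrable f -> cintegrable g ->
  cintegrable (fun x => f x + g x).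
Proof.
move=> [mf fi] [mg gi].
apply: (@cintegrable_le _ (fun x => cn (f x) + cn (g x))).
- exact: cmeasurableD.
- exact: (integrableD measurableT fi gi).
- by move=> x; exact: cnD.
Qed.

Lemma cintegrableN f : cintegrable f -> cintegrable (fun x => - f x).
Proof.
move=> [mf fi]; apply: (@cintegrable_le _ (fun x => cn (f x))) => //.
- exact: cmeasurableN.
- by move=> x; rewrite cnN.
Qed.

Lemma cintegrableB f g : cintegrable f -> cintegrable g ->
  cintegrable (fun x => f x - g x).
Proof. by move=> fi gi; apply: cintegrableD => //; exact: cintegrableN. Qed.

Lemma Re_cint f : Re (cint f) = (\int[mu]_x Re (f x))%R. Proof. by []. Qed.
Lemma Im_cint f : Im (cint f) = (\int[mu]_x Im (f x))%R. Proof. by []. Qed.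

Lemma cintD f g : cintegrable f -> cintegrable g ->
  cint (fun x => f x + g x) = cint f + cint g.
Proof.
move=> fi gi; apply: complex_ext; rewrite ?cReD ?cImD /=.
  under eq_Rintegral do rewrite cReD.
  by rewrite RintegralD//; exact: cintegrable_Re.
under eq_Rintegral do rewrite cImD.
by rewrite RintegralD//; exact: cintegrable_Im.
Qed.

Lemma cintZ f (c : R[i]) : cintegrable f ->
  cint (fun x => c * f x) = c * cint f.
Proof.
move=> fi; have f1 := cintegrable_Re fi; have f2 := cintegrable_Im fi.
have h (a : R) (h : T -> R) : mu.-integrable setT (EFin \o h) ->
    mu.-integrable setT (EFin \o (fun x => a * h x)).
  by move=> ih; exact: (@integrableZl _ _ _ mu _ measurableT a _ ih).
apply: complex_ext; rewrite ?cReM ?cImM /=.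
  under eq_Rintegral do rewrite cReM.
  by rewrite RintegralB ?RintegralZl//; exact: h.
under eq_Rintegral do rewrite cImM.
by rewrite RintegralD ?RintegralZl//; exact: h.
Qed.

Lemma cint0 : cint (fun=> 0) = 0.
Proof. by apply: complex_ext; rewrite /= /Rintegral integral0. Qed.

Lemma cintN f : cintegrable f -> cint (fun x => - f x) = - cint f.
Proof.
move=> fi; rewrite -mulN1r -cintZ//.
by congr cint; apply/funext => x; rewrite mulN1r.
Qed.

Lemma cintB f g : cintegrable f -> cintegrable g ->
  cint (fun x => f x - g x) = cint f - cint g.
Proof. by move=> fi gi; rewrite cintD ?cintN//; exact: cintegrableN. Qed.

(* [cint f] is rotated onto the nonnegative real axis by multiplying with its
   conjugate. *)
Lemma le_cn_cint f : cintegrable f ->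
  cn (cint f) <= (\int[mu]_x cn (f x))%R.
Proof.
move=> fi; have [z0|z0] := eqVneq (cn (cint f)) 0.
  by rewrite z0 Rintegral_ge0// => x _; exact: cn_ge0.
have zp : 0 < cn (cint f) by rewrite lt_neqAle eq_sym z0 cn_ge0.
rewrite -(ler_pM2l zp) -expr2.
pose w := (cint f)^*%C.
have nw : cn w = cn (cint f) by rewrite /w /= sqrrN.
have -> : cn (cint f) ^+ 2 = Re (cint (fun x => w * f x)).
  rewrite cintZ// cReM cn_sqr /w /=; ring.
rewrite Re_cint -RintegralZl//; last by case: fi.
have wi := cintegrableZ w fi.
apply: le_Rintegral => //.
- exact: cintegrable_Re.
- by case: fi => _ h; exact: (@integrableZl _ _ _ mu _ measurableT (cn (cint f)) _ h).
- move=> x _; rewrite -nw -cnM; exact: le_trans (ler_norm _) (cn_Re _).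
Qed.

Lemma le_cn_cint_bound f (h : T -> R) : cmeasurable f ->
  mu.-integrable setT (EFin \o h) -> (forall x, cn (f x) <= h x) ->
  cn (cint f) <= (\int[mu]_x h x)%R.
Proof.
move=> mf ih fh; have fi := cintegrable_le mf ih fh.
apply: le_trans (le_cn_cint fi) _; apply: le_Rintegral => //.
by case: fi.
Qed.

End complex_integral.
Arguments cint {dT T R} mu f.
Arguments cintegrable {dT T R} mu f.

(** * Integrals of functions known almost everywhere *)

Section ae_integral.
Context dT (T : measurableType dT) (R : realType).
Variable mu : {measure set T -> \bar R}.
Import HBNNSimple.

(* The integral of a nonnegative function is a supremum over simple functions
   below it, and those may be set to 0 on a null set; hence no measurability is
   needed. *)
Lemma ge0_ae_le_integral_nomeas (f g : T -> \bar R) :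
  (forall x, 0 <= f x)%E -> (forall x, 0 <= g x)%E ->
  {ae mu, forall x, (f x <= g x)%E} ->
  (\int[mu]_x f x <= \int[mu]_x g x)%E.
Proof.
move=> f0 g0 [A [mA A0 fgA]].
rewrite [leLHS]ge0_integralTE// [leRHS]ge0_integralTE//.
apply: ge_ereal_sup => /= _ [h hf <-].
have mAC : measurable (~` A) by exact: measurableC.
pose h' : {nnsfun T >-> R} := proj_nnsfun h mAC.
have -> : sintegral mu h = sintegral mu h'.
  rewrite -!integralT_nnsfun; apply: ge0_ae_eq_integral => //=.
  - exact/measurable_EFinP/measurable_funP.
  - by apply/measurable_EFinP; exact: (measurable_funP h').
  - by move=> x _; rewrite lee_fin fun_ge0.
  - by move=> x _; rewrite lee_fin mulr_ge0 ?fun_ge0.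
  - exists A; split => // x /= hx; apply: contrapT => xA; apply: hx => _.
    by rewrite mindicE mem_set//= mulr1.
apply: ereal_sup_ubound; exists h' => // x /=.
rewrite mindicE; have [xA|xA] := boolP (x \in ~` A); last by rewrite mulr0 g0.
rewrite mulr1; apply: le_trans (hf x) _.
move: xA; rewrite inE => xA; apply: contrapT => fg; apply: xA.
by apply: fgA => /=.
Qed.

Lemma ge0_ae_eq_integral_nomeas (f g : T -> \bar R) :
  (forall x, 0 <= f x)%E -> (forall x, 0 <= g x)%E ->
  {ae mu, forall x, f x = g x} -> (\int[mu]_x f x = \int[mu]_x g x)%E.
Proof.
move=> f0 g0 fg; apply/eqP; rewrite eq_le; apply/andP; split;
  by apply: ge0_ae_le_integral_nomeas => //; apply: filterS fg => x ->.
Qed.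

Lemma ae_eq_integral_nomeas (f g : T -> \bar R) :
  {ae mu, forall x, f x = g x} -> (\int[mu]_x f x = \int[mu]_x g x)%E.
Proof.
move=> fg; rewrite [LHS]integralE [RHS]integralE; congr (_ - _)%E.
  apply: ge0_ae_eq_integral_nomeas => //.
  by apply: filterS fg => x h; rewrite !funeposE h.
apply: ge0_ae_eq_integral_nomeas => //.
by apply: filterS fg => x h; rewrite !funenegE h.
Qed.

Lemma ae_eq_cint (f g : T -> R[i]) :
  {ae mu, forall x, f x = g x} -> cint mu f = cint mu g.
Proof.
move=> fg; rewrite /cint /Rintegral; congr (fine _ +i* fine _)%C;
  by apply: ae_eq_integral_nomeas; apply: filterS fg => x ->.
Qed.

Lemma ae_eq_integral_nomeas_on (D : set T) (f g : T -> \bar R) :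
  {ae mu, forall x, f x = g x} ->
  (\int[mu]_(x in D) f x = \int[mu]_(x in D) g x)%E.
Proof.
move=> fg; rewrite integral_mkcond [RHS]integral_mkcond.
apply: ae_eq_integral_nomeas; apply: filterS fg => x h.
by rewrite /patch; case: ifP.
Qed.

End ae_integral.

(** * Lebesgue measure on row vectors *)

Section rV_norm.
Variables (R : realType) (d : nat).
Implicit Types x y : 'rV[R]_d.

Lemma coord_le_norm x i : `|x 0 i| <= `|x|.
Proof.
rewrite [leRHS]/Num.norm /= mx_normrE; apply/bigmax_geP; right => /=.
by exists (0, i).
Qed.

Lemma rV_norm_le x (e : R) : 0 <= e -> (forall i, `|x 0 i| <= e) -> `|x| <= e.
Proof.
move=> e0 h; rewrite [leLHS]/Num.norm /= mx_normrE; apply/bigmax_leP => /=.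
by split => // -[i j] _ /=; rewrite ord1.
Qed.

Lemma rV_norm_lt x (e : R) : 0 < e -> (forall i, `|x 0 i| < e) -> `|x| < e.
Proof.
move=> e0 h; rewrite [ltLHS]/Num.norm /= mx_normrE; apply/bigmax_ltP => /=.
by split => // -[i j] _ /=; rewrite ord1.
Qed.

Lemma rV_ballE x (e : R) y : ball x e y <-> `|x - y| < e.
Proof. by rewrite -ball_normE. Qed.

Lemma norm_delta_le (i : 'I_d) : `|delta_mx 0 i : 'rV[R]_d| <= 1.
Proof.
apply: rV_norm_le => // j; rewrite mxE eqxx /=.
by case: eqP => _; rewrite ?normr1 ?normr0.
Qed.

End rV_norm.

Section rV_borel.
Variables (R : realType) (d : nat).
Local Notation Rd := 'rV[R]_d.

Lemma measurable_rV_box (X : 'I_d -> set (measurableTypeR R)) :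
  (forall i, measurable (X i)) -> measurable [set v : Rd | forall i, X i (v 0 i)].
Proof.
move=> mX; rewrite (_ : mkset _ = \bigcap_(i in [set: 'I_d])
    ((fun v : Rd => v 0 i : measurableTypeR R) @^-1` X i)).
  apply: fin_bigcap_measurable => [|i _]; first exact: finite_finset.
  by rewrite -[X in measurable X]setTI; exact: measurable_rV_coord.
by apply/seteqP; split => v /= Bv i; [move=> _; exact: Bv|exact: Bv].
Qed.

(** The sigma-algebra is generated by the coordinates, so [U] is exhausted by the countably many
    open cubes with rational centre and radius 1 / (k + 1) that it contains; the cubes not contained
    in [U] are replaced by the empty set. *)
Lemma open_rV_measurable (U : set Rd) : open U -> measurable U.
Proof.
move=> oU; pose F (p : 'rV[rat]_d * nat) : set Rd :=
  let B := [set v : Rd | forall i, ball (ratr (p.1 0 i) : R) (p.2.+1%:R^-1) (v 0 i)] in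
  if `[< B `<=` U >] then B else set0.
have mF p : measurable (F p).
  rewrite /F; case: ifP => // _.
  apply: (measurable_rV_box (X := fun i => ball (ratr (p.1 0 i) : R) (p.2.+1%:R^-1))).
  by move=> i; exact: measurable_ball.
suff -> : U = \bigcup_p F p by apply: countable_bigcupT_measurable.
apply/seteqP; split => [x Ux|x [p _]]; last first.
  by rewrite /F; case: ifPn => // /asboolP; apply.
have /nbhs_ballP[e /= e0 xU] : nbhs x U by move: oU; rewrite openE; apply.
have [k ke] : exists k : nat, k.+1%:R^-1 < e / 2.
  have [k _ /(_ k (leqnn k)) h] := near_infty_natSinv_lt (PosNum (divr_gt0 e0 (ltr0Sn R 1))).
  by exists k.
have /choice[q qx] : forall i, exists q : rat, ball (ratr q : R) (k.+1%:R^-1) (x 0 i).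
  move=> i; have k0 : (0 : R) < k.+1%:R^-1 by rewrite invr_gt0.
  have /rat_in_itvoo[q] : x 0 i - k.+1%:R^-1 < x 0 i + k.+1%:R^-1.
    by rewrite ltrD2l (lt_trans _ k0)// oppr_lt0.
  rewrite in_itv /= => /andP[q1 q2]; exists q.
  by rewrite -ball_normE /= ltr_distl q1 q2.
exists (\row_i q i, k) => //; rewrite /F /=; case: ifPn => [_ /= i|/negP].
  by rewrite mxE.
case; apply/asboolP => v /= hv; apply: xU; apply/rV_ballE; apply: rV_norm_lt => // i.
have := hv i; have := qx i; rewrite mxE -!ball_normE /= => h1 h2.
rewrite !mxE -(subrK (ratr (q i)) (x 0 i)) -addrA.
apply: le_lt_trans (ler_normD _ _) _; rewrite [`|x 0 i - _|]distrC.
have -> : e = e / 2 + e / 2 by lra.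
by apply: ltrD; apply: lt_trans ke.
Qed.

Lemma closed_rV_measurable (K : set Rd) : closed K -> measurable K.
Proof.
by move=> /closed_openC /open_rV_measurable /measurableC; rewrite setCK.
Qed.

Lemma compact_rV_measurable (K : set Rd) : compact K -> measurable K.
Proof.
move=> cK; apply: closed_rV_measurable; exact: compact_closed.
Qed.

Lemma continuous_rV_measurable (g : Rd -> R) :
  continuous g -> measurable_fun setT g.
Proof.
move=> /continuousP cg; apply: (measurability _ (RGenOpens.measurableE R)).
move=> _ [_ [a [b ->] <-]]; rewrite setTI; apply: open_rV_measurable.
exact/cg/interval_open.
Qed.

(** Open sets are stable under intersection; this is the pi-system on which the Dynkin induction of
    [ae_eq0_open] rests. *)
Lemma measurable_rV_open : measurable = <<s [set U : set Rd | open U] >>.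
Proof.
apply/seteqP; split; last first.
  by apply: smallest_sub; [exact: sigma_algebra_measurable|exact: open_rV_measurable].
apply: smallest_sub; first exact: smallest_sigma_algebra.
move=> B; rewrite -bigcup_seq/= => -[i _ [C mC <-]]; rewrite setTI.
pose co : g_sigma_algebraType [set U : set Rd | open U] -> R := fun v => v 0 i.
have mco : measurable_fun setT co.
  apply: (measurability _ (RGenOpens.measurableE R)).
  move=> _ [_ [a [b ->] <-]]; rewrite setTI; apply: sub_sigma_algebra => /=.
  have /continuousP := @coord_continuous R 1 d 0 i; apply; exact: interval_open.
by have := mco measurableT C mC; rewrite setTI.
Qed.

Lemma compact_norm_le (r : R) : compact [set x : Rd | `|x| <= r].
Proof.
apply: bounded_closed_compact.
  by exists r; split; [exact: num_real|move=> M rM x /= /le_trans; apply; exact: ltW].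
have -> : [set x : Rd | `|x| <= r] = (fun x : Rd => `|x|) @^-1` [set t | t <= r] by [].
apply: closed_comp; last exact: closed_le.
by move=> x _; exact: norm_continuous.
Qed.

Lemma compact_norm_bound (K : set Rd) : compact K ->
  exists2 r : R, 0 < r & forall x, K x -> `|x| <= r.
Proof.
move=> /compact_bounded [M [_ KM]]; exists (Num.max (M + 1) 1).
  by rewrite lt_max ltr01 orbT.
by move=> x Kx; apply: KM => //; rewrite lt_max ltrDl ltr01.
Qed.

Lemma rV_box_finite (a : R) : (lebesgue_rV R d [set x : Rd | (`|x| <= a)%R] < +oo)%E.
Proof.
have mB : measurable [set v : Rd | forall i : 'I_d, `[- a, a]%classic (v 0 i)].
  exact: (measurable_rV_box (X := fun=> `[- a, a]%classic)).
apply: (@le_lt_trans _ _ (lebesgue_rV R d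
    [set v : Rd | forall i : 'I_d, `[- a, a]%classic (v 0 i)])).
  apply: le_measure; rewrite ?inE//.
    by apply: compact_rV_measurable; exact: compact_norm_le.
  move=> v /= va i; rewrite in_itv /= -ler_norml.
  exact: le_trans (coord_le_norm _ _) va.
rewrite (lebesgue_rV_box (A := fun=> `[(- a)%R, a]%classic))//.
suff /andP[] : (0 <= \prod_(i < d) lebesgue_measure `[(- a)%R, a]%classic < +oo)%E.
  by [].
elim/big_ind : _ => [|x y /andP[x0 xo] /andP[y0 yo]|i _].
- by rewrite lee01 ltry.
- by rewrite mule_ge0//= lte_mul_pinfty// ge0_fin_numE.
- rewrite measure_ge0 lebesgue_measure_itv /=.
  by case: ifP => // _; rewrite -EFinB ltry.
Qed.

Lemma compact_rV_finite (K : set Rd) : compact K -> (lebesgue_rV R d K < +oo)%E.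
Proof.
move=> cK; have [r _ Kr] := compact_norm_bound cK.
apply: le_lt_trans (rV_box_finite r).
apply: le_measure; rewrite ?inE; [exact: compact_rV_measurable| |exact: Kr].
by apply: compact_rV_measurable; exact: compact_norm_le.
Qed.

End rV_borel.

(** * Coordinatewise affine changes of variables *)

Section diag_affine.
Variables (R : realType) (d : nat).
Local Notation Rd := 'rV[R]_d.
Local Notation mu := (lebesgue_rV R d).

(** Translations, reflections, dilations and the doubling of single coordinates are all of this
    form, and preimages of boxes remain boxes. *)
Definition diag_affine (a b : 'I_d -> R) (x : Rd) : Rd :=
  \row_i (a i * x 0 i + b i).

Lemma measurable_diag_affine a b : measurable_fun setT (diag_affine a b).
Proof.
apply: measurable_fun_rVP => i; rewrite /diag_affine.
under eq_fun do rewrite mxE.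
apply: measurable_funD => //; apply: measurable_funM => //.
exact: measurable_rV_coord.
Qed.

(** By uniqueness of Lebesgue measure it suffices to test half-open intervals. For [a < 0] the
    preimage is closed on the left and open on the right, hence the two cases. *)
Lemma lebesgue_affine (a b : R) (A : set (measurableTypeR R)) : a != 0 ->
  measurable A ->
  lebesgue_measure ((fun x => a * x + b) @^-1` A) = (`|a|^-1%:E * lebesgue_measure A)%E.
Proof.
move=> a0 mA; pose f (x : measurableTypeR R) : measurableTypeR R := a * x + b.
have mf : measurable_fun setT f.
  by apply: measurable_funD => //; apply: measurable_funM.
pose na := NngNum (normr_ge0 a).
pose m : {measure set (measurableTypeR R) -> \bar R} :=
  mscale na (pushforward (@lebesgue_measure R) f).
have -> : lebesgue_measure A = m mf A.
  apply: lebesgue_measure_unique => // _ [[s t]] _ <-.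
  transitivity (`|a|%:E * lebesgue_measure (f @^-1` `]s, t]%classic))%E; last by [].
  rewrite lebesgue_measure_itv /=.
  have [a0'|a0'|/eqP] := ltgtP a 0; last by rewrite (negbTE a0).
    rewrite (_ : _ @^-1` _ = `[(t - b) / a, (s - b) / a[%classic); last first.
      apply/seteqP; split=> x; rewrite /f /= !in_itv /= ler_ndivrMr// ltr_ndivlMr//.
        by move=> /andP[h1 h2]; apply/andP; split; lra.
      by move=> /andP[h1 h2]; apply/andP; split; lra.
    rewrite lebesgue_measure_itv /= !lte_fin ltr_ndivrMr// mulrVK ?unitfE//.
    rewrite ltrD2r; case: ifP => st; last by rewrite mule0.
    rewrite -EFinB -EFinM; congr EFin; rewrite ltr0_norm//; field.
    exact: a0.
  rewrite (_ : _ @^-1` _ = `](s - b) / a, (t - b) / a]%classic); last first.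
    apply/seteqP; split=> x; rewrite /f /= !in_itv /= ltr_pdivrMr// ler_pdivlMr//.
      by move=> /andP[h1 h2]; apply/andP; split; lra.
    by move=> /andP[h1 h2]; apply/andP; split; lra.
  rewrite lebesgue_measure_itv /= !lte_fin ltr_pdivrMr// mulrVK ?unitfE//.
  rewrite ltrD2r; case: ifP => st; last by rewrite mule0.
  rewrite -EFinB -EFinM; congr EFin; rewrite gtr0_norm//; field.
  exact: a0.
by rewrite /m /= /mscale /= muleA -EFinM mulVf ?mul1e// normr_eq0.
Qed.

(** The rescaled image measure agrees with [mu] on boxes, coordinate by coordinate. Boxes form a
    generating pi-system, and the cubes [-k, k]^d exhaust the space with finite measure. *)
Lemma lebesgue_diag_affine (a b : 'I_d -> R) (A : set Rd) :
  (forall i, a i != 0) -> measurable A ->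
  mu (diag_affine a b @^-1` A) = ((\prod_i `|a i|^-1)%:E * mu A)%E.
Proof.
move=> a0 mA.
have p0 : \prod_i `|a i| != 0.
  by apply/prodf_neq0 => i _; rewrite normr_eq0.
have p0' : 0 <= \prod_i `|a i| by apply: prodr_ge0.
pose m : {measure set Rd -> \bar R} :=
  mscale (NngNum p0') (pushforward mu (diag_affine a b)).
have mf := measurable_diag_affine a b.
suff -> : mu A = m mf A.
  rewrite /m /= /mscale /= muleA -EFinM -big_split /= big1 ?mul1e// => i _.
  by rewrite mulVf// normr_eq0.
pose G := [set B : set Rd | exists2 X : 'I_d -> set (measurableTypeR R),
  (forall i, measurable (X i)) & B = [set v | forall i, X i (v 0 i)]].
have mG B : G B -> measurable B.
  by move=> [X mX ->]; exact: measurable_rV_box.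
pose g (k : nat) := [set v : Rd | forall i, `[- k%:R, k%:R]%classic (v 0 i)].
apply: (measure_unique G g) => //.
- apply/seteqP; split; last first.
    by apply: smallest_sub; [exact: sigma_algebra_measurable|exact: mG].
  apply: smallest_sub; first exact: smallest_sigma_algebra.
  move=> B; rewrite -bigcup_seq/= => -[i _ [C mC <-]]; rewrite setTI.
  apply: sub_sigma_algebra; exists (fun j => if j == i then C else setT).
    by move=> j; case: ifP.
  apply/seteqP; split => v /= h; first by move=> j; case: eqP => // ->.
  by have := h i; rewrite eqxx.
- move=> _ _ [X mX ->] [Y mY ->]; exists (fun i => X i `&` Y i).
    by move=> i; exact: measurableI.
  apply/seteqP; split => v /=; first by move=> [h1 h2] i; split.
  by move=> h; split => i; have [] := h i.
- by move=> k; exists (fun=> `[- k%:R, k%:R]%classic).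
- rewrite -subTset => v _; pose k := Num.truncn `|v|.
  exists k.+1 => // i; rewrite /= in_itv /= -ler_norml.
  apply: le_trans (coord_le_norm _ _) _; apply/ltW.
  exact: truncnS_gt.
- move=> _ [X mX ->].
  transitivity ((\prod_i `|a i|)%:E *
    mu (diag_affine a b @^-1` [set v | forall i, X i (v 0%R i)]))%E; last by [].
  rewrite (_ : _ @^-1` _ =
      [set v : Rd | forall i, ((fun x => a i * x + b i) @^-1` X i) (v 0 i)]); last first.
    by apply/seteqP; split => v /= h i; have := h i; rewrite mxE.
  have mY i : measurable ((fun x : measurableTypeR R =>
      (a i * x + b i : measurableTypeR R)) @^-1` X i).
    rewrite -[Y in measurable Y]setTI.
    suff : measurable_fun setT (fun x : measurableTypeR R =>
      (a i * x + b i : measurableTypeR R)) by apply.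
    by apply: measurable_funD => //; apply: measurable_funM.
  rewrite [LHS](lebesgue_rV_box mX) (lebesgue_rV_box mY).
  rewrite -prodEFin -big_split /=; apply: eq_bigr => i _.
  by rewrite lebesgue_affine// muleA -EFinM mulfV ?mul1e// normr_eq0.
- move=> k; apply: le_lt_trans (rV_box_finite d k%:R).
  apply: le_measure; rewrite ?inE.
  + by apply: mG; exists (fun=> `[- k%:R, k%:R]%classic).
  + by apply: compact_rV_measurable; exact: compact_norm_le.
  + move=> v /= h; apply: rV_norm_le => // i; rewrite ler_norml.
    by have := h i; rewrite /= in_itv.
Qed.

End diag_affine.

Section change_of_variables.
Variables (R : realType) (d : nat).
Local Notation Rd := 'rV[R]_d.
Local Notation mu := (lebesgue_rV R d).
Variables (a b : 'I_d -> R).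
Hypothesis a0 : forall i, a i != 0.

Lemma ae_diag_affine (P : Rd -> Prop) : {ae mu, forall x, P x} ->
  {ae mu, forall x, P (diag_affine a b x)}.
Proof.
move=> [A [mA A0 PA]]; exists (diag_affine a b @^-1` A); split.
- by rewrite -[X in measurable X]setTI; exact: measurable_diag_affine.
- by rewrite lebesgue_diag_affine// A0 mule0.
- by move=> x /= Px; apply: PA.
Qed.

Lemma ge0_integral_diag_affine (f : Rd -> \bar R) :
  measurable_fun setT f -> (forall x, 0 <= f x)%E ->
  (\int[mu]_x f (diag_affine a b x) =
   (\prod_i `|a i|^-1)%:E * \int[mu]_x f x)%E.
Proof.
move=> mf f0; have mA := measurable_diag_affine a b.
have c0 : 0 <= \prod_i `|a i|^-1 by apply: prodr_ge0 => i _; rewrite invr_ge0.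
have := @ge0_integral_pushforward _ _ _ _ R _ mA mu setT f measurableT mf
  (fun x _ => f0 x).
rewrite preimage_setT => /= <-.
rewrite -(ge0_integral_mscale mu measurableT (NngNum c0) mf (fun x _ => f0 x)).
apply: eq_measure_integral => A mA' _.
exact: lebesgue_diag_affine.
Qed.

Lemma cintegrable_diag_affine (f : Rd -> R[i]) : cintegrable mu f ->
  cintegrable mu (fun x => f (diag_affine a b x)).
Proof.
move=> [[f1 f2] fi].
have mA := measurable_diag_affine a b.
have mf' : cmeasurable (fun x => f (diag_affine a b x)).
  by split; [exact: (measurableT_comp f1 mA)|exact: (measurableT_comp f2 mA)].
apply: cintegrableP => //.
rewrite (@ge0_integral_diag_affine (fun x => (cn (f x))%:E)).
- apply: lte_mul_pinfty => //; first by rewrite lee_fin prodr_ge0// => i _; rewrite invr_ge0.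
  move/integrableP : fi => [_]; apply: le_lt_trans.
  by under [leRHS]eq_integral do rewrite gee0_abs ?lee_fin ?cn_ge0//.
- exact/measurable_EFinP/cmeasurable_cn.
- by move=> x; rewrite lee_fin cn_ge0.
Qed.

Lemma Rintegral_diag_affine (f : Rd -> R) : mu.-integrable setT (EFin \o f) ->
  (\int[mu]_x f (diag_affine a b x) =
   (\prod_i `|a i|^-1) * \int[mu]_x f x)%R.
Proof.
move=> fi; have mf := measurable_int _ fi.
rewrite /Rintegral [in LHS]integralE [in RHS]integralE.
have e1 := @ge0_integral_diag_affine (EFin \o f)^\+%E
  (measurable_funepos mf) (fun=> funepos_ge0 _ _).
have e2 := @ge0_integral_diag_affine (EFin \o f)^\-%E
  (measurable_funeneg mf) (fun=> funeneg_ge0 _ _).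
have h1 : (\int[mu]_x (EFin \o f)^\+%E x)%E \is a fin_num.
  by apply: integrable_fin_num => //; exact: integrable_funepos.
have h2 : (\int[mu]_x (EFin \o f)^\-%E x)%E \is a fin_num.
  by apply: integrable_fin_num => //; exact: integrable_funeneg.
transitivity (fine (\int[mu]_x (EFin \o f)^\+%E (diag_affine a b x) -
    \int[mu]_x (EFin \o f)^\-%E (diag_affine a b x))%E).
  congr (fine (_ - _)); apply: eq_integral => x _; by rewrite ?funeposE ?funenegE.
by rewrite e1 e2 -(fineK h1) -(fineK h2) -!EFinM -!EFinB /= mulrBr.
Qed.

Lemma cint_diag_affine (f : Rd -> R[i]) : cintegrable mu f ->
  cint mu (fun x => f (diag_affine a b x)) =
  (\prod_i `|a i|^-1)%:C%C * cint mu f.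
Proof.
move=> fi; apply: complex_ext; rewrite ?cReM ?cImM /= mul0r ?subr0 ?addr0.
  exact: (Rintegral_diag_affine (cintegrable_Re fi)).
exact: (Rintegral_diag_affine (cintegrable_Im fi)).
Qed.

End change_of_variables.

Section translations.
Variables (R : realType) (d : nat).
Local Notation Rd := 'rV[R]_d.
Local Notation mu := (lebesgue_rV R d).

Lemma addl_diag_affine (x y : Rd) : x + y = diag_affine (fun=> 1) (fun i => x 0 i) y.
Proof. by apply/rowP => i; rewrite !mxE mul1r addrC. Qed.

Lemma subl_diag_affine (x y : Rd) : x - y = diag_affine (fun=> -1) (fun i => x 0 i) y.
Proof. by apply/rowP => i; rewrite !mxE mulN1r addrC. Qed.

Lemma scale_diag_affine (c : R) (y : Rd) : c *: y = diag_affine (fun=> c) (fun=> 0) y.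
Proof. by apply/rowP => i; rewrite !mxE addr0. Qed.

Lemma cint_sub (f : Rd -> R[i]) (x : Rd) : cintegrable mu f ->
  cint mu (fun y => f (x - y)) = cint mu f.
Proof.
move=> fi; under eq_fun do rewrite subl_diag_affine.
rewrite cint_diag_affine//.
rewrite big1 => [|i _]; last by rewrite normrN1 invr1.
by rewrite (rmorph1 (real_complex R)) mul1r.
Qed.

Lemma cintegrable_sub (f : Rd -> R[i]) (x : Rd) : cintegrable mu f ->
  cintegrable mu (fun y => f (x - y)).
Proof.
move=> fi; under eq_fun do rewrite subl_diag_affine.
by apply: cintegrable_diag_affine => // i; rewrite oppr_eq0 oner_eq0.
Qed.

Lemma cint_add (f : Rd -> R[i]) (x : Rd) : cintegrable mu f ->
  cint mu (fun y => f (x + y)) = cint mu f.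
Proof.
move=> fi; under eq_fun do rewrite addl_diag_affine.
rewrite cint_diag_affine//.
rewrite big1 => [|i _]; last by rewrite normr1 invr1.
by rewrite (rmorph1 (real_complex R)) mul1r.
Qed.

Lemma ae_sub (P : Rd -> Prop) (x : Rd) : {ae mu, forall y, P y} ->
  {ae mu, forall y, P (x - y)}.
Proof.
move=> /(@ae_diag_affine _ _ (fun=> -1) (fun i => x 0 i)) h.
have /h : forall i : 'I_d, (-1 : R) != 0 by move=> i; rewrite oppr_eq0 oner_eq0.
by apply: filterS => y; rewrite subl_diag_affine.
Qed.

Lemma measurable_sub (x : Rd) : measurable_fun setT (fun y : Rd => x - y).
Proof.
by under eq_fun do rewrite subl_diag_affine; exact: measurable_diag_affine.
Qed.

Lemma cmeasurable_sub (f : Rd -> R[i]) (x : Rd) : cmeasurable f ->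
  cmeasurable (fun y : Rd => f (x - y)).
Proof.
have mx := measurable_sub x.
by move=> [f1 f2]; split; [exact: (measurableT_comp f1 mx)|exact: (measurableT_comp f2 mx)].
Qed.

Lemma prod_2expV (j : nat) :
  2 ^+ (j * d) * (\prod_(i < d) `|2 ^+ j|^-1) = 1 :> R.
Proof.
have h : `|2 ^+ j : R| = 2 ^+ j by rewrite ger0_norm// exprn_ge0.
by rewrite h big_const_ord iter_mulr_1 exprVn exprM mulfV// !expf_neq0.
Qed.

Lemma cint_dilation (f : Rd -> R[i]) (j : nat) : cintegrable mu f ->
  cint mu (dilation f j) = cint mu f.
Proof.
move=> fi; have nz i : (fun=> 2 ^+ j : R) (i : 'I_d) != 0.
  by rewrite expf_neq0// pnatr_eq0.
have fj : cintegrable mu (fun x => f (2 ^+ j *: x)).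
  under eq_fun do rewrite scale_diag_affine.
  exact: cintegrable_diag_affine.
rewrite /dilation cintZ//; under eq_fun do rewrite scale_diag_affine.
rewrite cint_diag_affine// mulrA.
by rewrite -(rmorphM (real_complex R)) prod_2expV (rmorph1 (real_complex R)) mul1r.
Qed.

(** [cint_dilation] applied to |f|. This invariance makes the convolution bounds uniform in [j]. *)
Lemma L1norm_dilation (f : Rd -> R[i]) (j : nat) : cintegrable mu f ->
  L1norm_on setT (dilation f j) = L1norm_on setT f.
Proof.
move=> fi; rewrite /L1norm_on.
pose g x : R[i] := (cn (f x))%:C%C.
have gi : cintegrable mu g.
  apply: (@cintegrable_le _ _ _ _ _ (fun x => cn (f x))).
  - by apply: cmeasurable_real; apply: cmeasurable_cn; case: fi.
  - by case: fi.
  - by move=> x; rewrite cn_real ger0_norm ?cn_ge0.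
have := cint_dilation j gi => /(congr1 (@complex.Re R)); rewrite !Re_cint.
move=> <-; apply: eq_Rintegral => x _; rewrite /modulus /dilation cnM cn_real cReM /=.
by rewrite mul0r subr0 ger0_norm// exprn_ge0.
Qed.

End translations.

(** * Locally integrable functions *)

Section locally_integrable.
Variables (R : realType) (d : nat).
Local Notation Rd := 'rV[R]_d.
Local Notation mu := (lebesgue_rV R d).
Implicit Types f g : Rd -> R[i].

Lemma ae_equal_sym T (f g : Rd -> T) : ae_equal f g -> ae_equal g f.
Proof. by apply: filterS => x ->. Qed.

Lemma ae_equal_trans T (f g h : Rd -> T) : ae_equal f g -> ae_equal g h -> ae_equal f h.
Proof. by move=> fg; apply: filterS2 fg => x -> ->. Qed.

Lemma clebesgue_measurableP f : clebesgue_measurable f ->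
  exists2 g, cmeasurable g & ae_equal f g.
Proof.
move=> [[h1 mh1 f1] [h2 mh2 f2]]; exists (fun x => (h1 x +i* h2 x)%C) => //.
by apply: filterS2 f1 f2 => x <- <-; case: (f x).
Qed.

Lemma cmeasurable_clebesgue f g : cmeasurable g -> ae_equal f g ->
  clebesgue_measurable f.
Proof.
move=> [m1 m2] fg; split.
  by exists (fun x => Re (g x)) => //; apply: filterS fg => x ->.
by exists (fun x => Im (g x)) => //; apply: filterS fg => x ->.
Qed.

Lemma integrable_on_ae (K : set Rd) f g : ae_equal f g -> integrable_on K g ->
  integrable_on K f.
Proof.
move=> fg [/clebesgue_measurableP[h mh gh] gK]; split.
  by apply: cmeasurable_clebesgue mh _; exact: ae_equal_trans gh.
rewrite (@ae_eq_integral_nomeas_on _ _ _ mu K _ (fun x => (modulus g x)%:E))//.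
by apply: filterS fg => x; rewrite /modulus => ->.
Qed.

Lemma L1loc_ae f g : ae_equal f g -> L1loc g -> L1loc f.
Proof. by move=> fg gl K cK; exact: integrable_on_ae (gl K cK). Qed.

(** The calculus of [cint] is set up for Borel functions; a locally integrable function enters it
    through such a representative, the integrals being unchanged by [ae_eq_cint]. *)
Lemma L1loc_borel g : L1loc g ->
  exists g0, [/\ cmeasurable g0, ae_equal g g0 & L1loc g0].
Proof.
move=> gl; have [/clebesgue_measurableP[g0 mg0 gg0] _] := gl _ compact0.
exists g0; split => //; exact: L1loc_ae (ae_equal_sym gg0) gl.
Qed.

Lemma cintegrable_mul_L1loc g k (K : set Rd) (M : R) :
  cmeasurable g -> L1loc g -> cmeasurable k -> compact K -> vanishes_off K k ->
  (forall x, cn (k x) <= M) -> cintegrable mu (fun x => g x * k x).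
Proof.
move=> mg gl mk cK kK kM; apply: cintegrableP; first exact: cmeasurableM.
have [_ gK] := gl K cK; have mK := compact_rV_measurable cK.
have M0 : 0 <= M by apply: le_trans (kM 0); exact: cn_ge0.
have mcg : measurable_fun setT (fun x => (cn (g x))%:E).
  exact/measurable_EFinP/cmeasurable_cn.
apply: (@le_lt_trans _ _ (\int[mu]_(x in K) (M%:E * (modulus g x)%:E))%E).
  rewrite [leRHS]integral_mkcond; apply: ge0_le_integral => //.
  - by move=> x _; rewrite lee_fin cn_ge0.
  - exact/measurable_EFinP/cmeasurable_cn/cmeasurableM.
  - apply/(measurable_restrictT _ mK); apply: measurable_funeM; exact: measurable_funS mcg.
  - move=> x _; rewrite /patch; case: ifPn => [_|xK].
      by rewrite -EFinM lee_fin cnM mulrC ler_wpM2r ?cn_ge0.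
    by rewrite kK ?mulr0 ?cn0// => Kx; move: xK; rewrite mem_set.
rewrite ge0_integralZl//.
- by rewrite lte_mul_pinfty// lee_fin.
- exact: measurable_funS mcg.
- by move=> x _; rewrite lee_fin cn_ge0.
Qed.

Lemma cintegrable_bounded_compact k (K : set Rd) (M : R) :
  cmeasurable k -> compact K -> vanishes_off K k -> (forall x, cn (k x) <= M) ->
  cintegrable mu k.
Proof.
move=> mk cK kK kM.
rewrite (_ : k = fun x => 1 * k x); last by apply/funext => x; rewrite mul1r.
apply: (@cintegrable_mul_L1loc (fun=> 1) k K M) => //.
move=> L cL; split; first exact: cmeasurable_clebesgue (cmeasurable_cst _ 1) (aeW _ (fun=> erefl)).
under eq_integral do rewrite /modulus Normc.normc1.
rewrite integral_cst ?mul1e; first exact: compact_rV_finite.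
exact: compact_rV_measurable.
Qed.

Lemma integrable_on_cmeasurable (K : set Rd) g : cmeasurable g -> compact K ->
  integrable_on K g -> cintegrable mu (fun x => (\1_K x)%:C%C * g x).
Proof.
move=> mg cK [_ gK]; have mK := compact_rV_measurable cK.
apply: cintegrableP.
  by apply: cmeasurableM => //; apply: cmeasurable_real; exact: measurable_indic.
apply: le_lt_trans gK; rewrite [leRHS]integral_mkcond.
apply: ge0_ae_le_integral_nomeas.
- by move=> x; rewrite lee_fin cn_ge0.
- by move=> x; rewrite /patch; case: ifP => // _; rewrite lee_fin cn_ge0.
- apply: aeW => x; rewrite /patch cnM cn_real indicE; case: (x \in K) => /=.
    by rewrite normr1 mul1r.
  by rewrite normr0 mul0r.
Qed.

End locally_integrable.

(** * Smooth functions *)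

Section line_calculus.
Variables (R : realType) (V : normedModType R).
Implicit Types (g : V -> R) (x v : V).

Lemma is_derive_line g x v (t : R) : derivable g (x + t *: v) v ->
  is_derive t 1 (fun s => g (x + s *: v)) ('D_v g (x + t *: v)).
Proof.
have e : (fun h => h^-1 *: (((fun s => g (x + s *: v)) \o shift t) (h *: 1) - g (x + t *: v)))
   = (fun h => h^-1 *: ((g \o shift (x + t *: v)) (h *: v) - g (x + t *: v))).
  apply/funext => h /=; congr (_ *: (g _ - _)).
  by rewrite [h *: 1]mulr1 scalerDl addrCA.
by move=> dg; split; rewrite ?/derivable ?/derive e.
Qed.

(** Of the position of the intermediate point only [|s| <= |h|] is retained, so that both signs of
    [h] are covered by one statement. *)
Lemma line_MVT g x v (h : R) : (forall t, derivable g (x + t *: v) v) ->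
  exists2 s, `|s| <= `|h| & g (x + h *: v) - g x = h * 'D_v g (x + s *: v).
Proof.
move=> dg; pose G (s : R) := g (x + s *: v).
have dG (s : R) : is_derive s 1 G ('D_v g (x + s *: v)) by exact: is_derive_line.
have cG : continuous G.
  by move=> s; apply/differentiable_continuous/derivable1_diffP; case: (dG s).
have cGw A : {within A, continuous G} by exact: continuous_subspaceT.
have [h0|h0] := leP 0 h.
  have [s + e] := MVT_segment h0 (fun s _ => dG s) (cGw _).
  rewrite in_itv /= => /andP[s0 sh]; exists s; first by rewrite !ger0_norm.
  by move: e; rewrite /G scale0r addr0 subr0 mulrC.
have [s + e] := MVT_segment (ltW h0) (fun s _ => dG s) (cGw _).
rewrite in_itv /= => /andP[s0 sh]; exists s.
  by rewrite !ler0_norm ?lerN2// ltW.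
move: e; rewrite /G scale0r addr0 sub0r mulrN => /eqP.
by rewrite -eqr_oppLR opprB => /eqP ->; rewrite mulrC.
Qed.

(* Both iterated derivatives are values near x of the second difference
   quotient of g. *)
Lemma schwarz g v w :
  (forall x, derivable g x v) -> (forall x, derivable g x w) ->
  (forall x, derivable ('D_v g) x w) -> (forall x, derivable ('D_w g) x v) ->
  continuous ('D_w ('D_v g)) -> continuous ('D_v ('D_w g)) ->
  forall x, 'D_w ('D_v g) x = 'D_v ('D_w g) x.
Proof.
(* The mean value theorem along [u1] for the increment [p] of [f] in direction [u2], then along [u2]
   for the [u1]-derivative of [f], produces the factor [h] twice. *)
have key u1 u2 f x (h : R) : (forall y, derivable f y u1) ->
    (forall y, derivable ('D_u1 f) y u2) -> exists s t, [/\ `|s| <= `|h|, `|t| <= `|h| &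
    f (x + h *: u1 + h *: u2) - f (x + h *: u1) - (f (x + h *: u2) - f x) =
    h * (h * 'D_u2 ('D_u1 f) (x + s *: u1 + t *: u2))].
  move=> d1 d2; pose p y := f (y + h *: u2) - f y.
  have dp y : is_derive y u1 p ('D_u1 f (y + h *: u2) - 'D_u1 f y).
    have e1 : is_derive y u1 (fun y => f (y + h *: u2)) ('D_u1 f (y + h *: u2)).
      have e : (fun k => k^-1 *: (((fun y => f (y + h *: u2)) \o shift y) (k *: u1) -
          f (y + h *: u2)))
        = (fun k => k^-1 *: ((f \o shift (y + h *: u2)) (k *: u1) - f (y + h *: u2))).
        by apply/funext => k /=; rewrite addrA.
      by split; rewrite ?/derivable ?/derive e; [exact: d1|].
    by apply: is_deriveB => //; exact/derivableP.
  have [s sh e1] := @line_MVT p x u1 h (fun t => @ex_derive _ _ _ _ _ _ _ (dp _)).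
  have [t th e2] := @line_MVT ('D_u1 f) (x + s *: u1) u2 h (fun t => d2 _).
  exists s, t; split => //; rewrite -e2.
  have [_ <-] := dp (x + s *: u1); rewrite -e1 /p.
  by congr (_ - _).
move=> gv gw gvw gwv cvw cwv x; apply/eqP; rewrite -subr_eq0 -normr_le0.
apply/ler_addgt0Pl => e e0; rewrite addr0.
pose M := `|v| + `|w| + 1.
have M0 : 0 < M by rewrite /M ltr_wpDl// addr_ge0.
have close (F : V -> R) : {for x, continuous F} -> exists2 r : R, 0 < r &
    forall y, `|y| < r -> `|F x - F (x + y)| <= e / 2.
  move=> /cvgrPdist_le /(_ (e / 2)) /(_ (divr_gt0 e0 (ltr0Sn _ 1))).
  move=> /nbhs_normP[r /= r0 hr]; exists r => // y yr; apply: hr => /=.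
  by rewrite opprD addNKr normrN.
have [r1 r10 h1] := close _ (cvw x).
have [r2 r20 h2] := close _ (cwv x).
pose r := Num.min r1 r2.
have r0 : 0 < r by rewrite lt_min r10.
(* [M] exceeds |v| + |w|, so that both intermediate points lie within [h * M = r / 2] of [x]. *)
pose h := r / (2 * M).
have h0 : 0 < h by rewrite divr_gt0// mulr_gt0.
have small (a b : R) (u1 u2 : V) : `|u1| + `|u2| <= M -> `|a| <= `|h| -> `|b| <= `|h| ->
    `|a *: u1 + b *: u2| < r.
  move=> uM ah bh; apply: le_lt_trans (ler_normD _ _) _; rewrite !normrZ.
  apply: (@le_lt_trans _ _ (h * M)).
    rewrite -(ger0_norm (ltW h0)); apply: le_trans (ler_wpM2l _ uM) => //.
    by rewrite mulrDr lerD// ler_wpM2r.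
  rewrite /h invfM mulrA mulfVK ?gt_eqF// ltr_pdivrMr//; lra.
clearbody h.
have uM1 : `|v| + `|w| <= M by rewrite /M lerDl.
have uM2 : `|w| + `|v| <= M by rewrite addrC.
have [s [t [sh th e1]]] := key v w g x h gv gvw.
have [s' [t' [sh' th' e2]]] := key w v g x h gw gwv.
have e3 : 'D_w ('D_v g) (x + (s *: v + t *: w)) = 'D_v ('D_w g) (x + (s' *: w + t' *: v)).
  have hn : h != 0 by rewrite gt_eqF.
  rewrite !addrA; set A := 'D_w _ _ in e1 *; set B := 'D_v _ _ in e2 *.
  have : h * (h * A) = h * (h * B).
    have ac : x + h *: w + h *: v = x + h *: v + h *: w by exact: addrAC.
    apply: etrans (esym e1) (etrans _ e2); rewrite ac.
    by move: (g _) (g _) (g _) (g _) => a1 a2 a3 a4; ring.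
  by clear -hn; move=> /(mulfI hn) /(mulfI hn).
have := h1 (s *: v + t *: w); have := h2 (s' *: w + t' *: v).
have s1 := small s t v w uM1 sh th; have s2 := small s' t' w v uM2 sh' th'.
move=> /(_ (lt_le_trans s2 _)) b2 /(_ (lt_le_trans s1 _)) b1.
have {}b1 : `|'D_w ('D_v g) x - 'D_w ('D_v g) (x + (s *: v + t *: w))| <= e / 2.
  by apply: b1; rewrite ge_min lexx.
have {}b2 : `|'D_v ('D_w g) x - 'D_v ('D_w g) (x + (s' *: w + t' *: v))| <= e / 2.
  by apply: b2; rewrite ge_min lexx orbT.
rewrite -(subrKA ('D_w ('D_v g) (x + (s *: v + t *: w)))) {2}e3.
apply: le_trans (ler_normD _ _) _; rewrite [leRHS]splitr.
by apply: lerD; [exact: b1|rewrite distrC; exact: b2].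
Qed.

End line_calculus.

(** * Multi-indices and iterated partial derivatives *)

Section multi_indices.
Variable d : nat.
Implicit Types (a b : multi_index d) (s t : seq 'I_d).

(** Iterated derivatives are handled as lists of directions, which suit induction. Adding
    multi-indices becomes concatenation up to permutation. *)
Definition mi_seq a : seq 'I_d := flatten [seq nseq (a i) i | i <- enum 'I_d].

Definition mi_add a b : multi_index d := fun i => (a i + b i)%N.

Definition mi_unit (i : 'I_d) : multi_index d := fun j => (j == i) : nat.

Lemma count_mi_seq a (P : pred 'I_d) :
  count P (mi_seq a) = (\sum_(i < d) P i * a i)%N.
Proof.
rewrite /mi_seq count_flatten sumnE !big_map [index_enum _]unlock /=.
by apply: eq_bigr => i _; rewrite count_nseq.
Qed.

Lemma size_mi_seq a : size (mi_seq a) = mi_order a.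
Proof.
by rewrite -count_predT count_mi_seq; apply: eq_bigr => i _; rewrite mul1n.
Qed.

Lemma perm_mi_add a b : perm_eq (mi_seq a ++ mi_seq b) (mi_seq (mi_add a b)).
Proof.
apply/permP => P; rewrite count_cat !count_mi_seq -big_split /=.
by apply: eq_bigr => i _; rewrite mulnDr.
Qed.

Lemma perm_mi_unit i : perm_eq [:: i] (mi_seq (mi_unit i)).
Proof.
apply/permP => P; rewrite /= addn0 count_mi_seq (bigD1 i)//= /mi_unit eqxx muln1.
by rewrite big1 ?addn0// => j /negbTE ->; rewrite muln0.
Qed.

Lemma mi_order_add a b : mi_order (mi_add a b) = (mi_order a + mi_order b)%N.
Proof. by rewrite /mi_order big_split. Qed.

Lemma mi_order_unit i : mi_order (mi_unit i) = 1%N.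
Proof. by rewrite -size_mi_seq -(perm_size (perm_mi_unit i)). Qed.

End multi_indices.

Section smooth_functions.
Variables (R : realType) (d : nat).
Local Notation Rd := 'rV[R]_d.
Implicit Types (f g : Rd -> R[i]) (s t : seq 'I_d) (x y : Rd).

Local Notation "'e_ i" := (@delta_mx R 1 d 0 i) (at level 8, i at level 2).

Definition diffs s f : Rd -> R[i] := foldr (@partial R d) f s.

Lemma partialsE (a : multi_index d) f : partials a f = diffs (mi_seq a) f.
Proof.
rewrite /partials /mi_seq; elim: (enum 'I_d) => //= i s ->.
rewrite /diffs foldr_cat; elim: (a i) => //= n ->//.
Qed.

Lemma diffs_cat s t f : diffs (s ++ t) f = diffs s (diffs t f).
Proof. exact: foldr_cat. Qed.

Lemma smooth_diffs s f : smooth f -> smooth (diffs s f).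
Proof. by move=> sf t; have := sf (t ++ s); rewrite foldr_cat. Qed.

Lemma partial_comm i j f : smooth f ->
  partial i (partial j f) = partial j (partial i f).
Proof.
move=> sf; have [_ _ d0] := sf [::]; have [_ _ di] := sf [:: i].
have [_ _ dj] := sf [:: j].
have [cr ci _] := sf [:: i; j]; have [cr' ci' _] := sf [:: j; i].
have eR := @schwarz R Rd (fun y => Re (f y)) 'e_j 'e_i
  (fun y => (d0 y j).1) (fun y => (d0 y i).1)
  (fun y => (dj y i).1) (fun y => (di y j).1) cr cr'.
have eI := @schwarz R Rd (fun y => Im (f y)) 'e_j 'e_i
  (fun y => (d0 y j).2) (fun y => (d0 y i).2)
  (fun y => (dj y i).2) (fun y => (di y j).2) ci ci'.
by apply/funext => x; apply: complex_ext; [exact: eR|exact: eI].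
Qed.

Lemma diffs_partial s i f : smooth f ->
  diffs s (partial i f) = partial i (diffs s f).
Proof.
move=> sf; elim: s => //= j s ->.
exact: partial_comm (smooth_diffs s sf).
Qed.

(** Partial derivatives of a smooth function commute, so the first direction of [s] can be pulled to
    the front of [t]. *)
Lemma perm_diffs s t f : smooth f -> perm_eq s t -> diffs s f = diffs t f.
Proof.
move=> sf; elim: s t => [|i s IH] t; first by rewrite perm_sym => /perm_nilP ->.
move=> st; have it : i \in t by rewrite -(perm_mem st) mem_head.
case/path.splitPr: it st => t1 t2 st.
have {}st : perm_eq s (t1 ++ t2).
  by rewrite -(perm_cons i) (perm_trans st)// perm_catC /= perm_cons perm_catC.
transitivity (partial i (diffs (t1 ++ t2) f)); first by rewrite -(IH _ st).
rewrite !diffs_cat; apply/esym.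
exact: diffs_partial (smooth_diffs t2 sf).
Qed.

Lemma partials_add (a b : multi_index d) f : smooth f ->
  partials a (partials b f) = partials (mi_add a b) f.
Proof.
by move=> sf; rewrite !partialsE -diffs_cat; apply: perm_diffs => //; exact: perm_mi_add.
Qed.

Lemma partials_unit i f : smooth f -> partials (mi_unit i) f = partial i f.
Proof.
move=> sf; rewrite partialsE -(perm_diffs sf (perm_mi_unit i))//.
Qed.

Lemma partial_vanishes (K : set Rd) i f : compact K -> vanishes_off K f ->
  vanishes_off K (partial i f).
Proof.
move=> cK fK x Kx; have nx : \forall y \near x, f y = 0.
  have oK : open (~` K) by apply: closed_openC; exact: compact_closed.
  by move: oK; rewrite openE => /(_ x Kx); apply: filterS => y /fK.
apply: complex_ext => /=.
  rewrite (@near_eq_derive _ _ _ _ (cst 0)) ?derive_cst//.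
  by apply: filterS nx => y ->.
rewrite (@near_eq_derive _ _ _ _ (cst 0)) ?derive_cst//.
by apply: filterS nx => y ->.
Qed.

Lemma diffs_vanishes (K : set Rd) s f : compact K -> vanishes_off K f ->
  vanishes_off K (diffs s f).
Proof. by move=> cK fK; elim: s => //= i s IH; exact: partial_vanishes. Qed.

Lemma test_function_diffs s f : test_function f -> test_function (diffs s f).
Proof.
move=> [sf [K cK fK]]; split; first exact: smooth_diffs.
by exists K => //; exact: diffs_vanishes.
Qed.

Lemma test_function_partial i f : test_function f -> test_function (partial i f).
Proof. exact: (@test_function_diffs [:: i]). Qed.

Lemma test_function_partials a f : test_function f -> test_function (partials a f).
Proof. by rewrite partialsE; exact: test_function_diffs. Qed.

Definition ccontinuous f :=
  continuous (fun y => Re (f y)) /\ continuous (fun y => Im (f y)).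

Lemma smooth_ccontinuous f : smooth f -> ccontinuous f.
Proof. by move=> /(_ [::])[]. Qed.

Lemma test_ccontinuous f : test_function f -> ccontinuous f.
Proof. by move=> [/smooth_ccontinuous]. Qed.

Lemma ccontinuous_cmeasurable f : ccontinuous f -> cmeasurable f.
Proof. by move=> [? ?]; split; exact: continuous_rV_measurable. Qed.

Lemma ccontinuous_eps f : (forall x (e : R), 0 < e -> exists2 r : R, 0 < r &
    forall y, `|y| < r -> cn (f (x + y) - f x) <= e) -> ccontinuous f.
Proof.
move=> h.
have key (g : Rd -> R) : (forall x (e : R), 0 < e -> exists2 r : R, 0 < r &
    forall y, `|y| < r -> `|g (x + y) - g x| <= e) -> continuous g.
  move=> hg x; apply: (iffRL (@cvgrPdist_le _ _ _ _ (nbhs_filter x) _ _)) => e e0.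
  have [r r0 hr] := hg x e e0; apply/nbhs_ballP; exists r => //= y /rV_ballE xy.
  by rewrite distrC -[y](subrKC x); apply: hr; rewrite distrC.
split; apply: key => x e e0; have [r r0 hr] := h x e e0; exists r => // y /hr;
  apply: le_trans.
  by apply: le_trans (cn_Re _); rewrite cReD cReN.
by apply: le_trans (cn_Im _); rewrite cImD cImN.
Qed.

Lemma continuous_compact_bound f (K : set Rd) : compact K -> ccontinuous f ->
  exists2 M : R, 0 < M & forall x, K x -> cn (f x) <= M.
Proof.
move=> cK [c1 c2].
have bd (g : Rd -> R) : continuous g -> exists M : R, forall x, K x -> `|g x| <= M.
  move=> cg; have : compact (g @` K).
    by apply: continuous_compact => //; exact: continuous_subspaceT.
  move=> /compact_bounded [M [_ hM]]; exists (M + 1) => x Kx.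
  by apply: hM; [rewrite ltrDl|exists x].
have [M1 h1] := bd _ c1; have [M2 h2] := bd _ c2.
exists (Num.max (M1 + M2) 1); first by rewrite lt_max ltr01 orbT.
move=> x Kx; rewrite le_max; apply/orP; left.
by apply: le_trans (cn_le _) _; apply: lerD; [exact: h1|exact: h2].
Qed.

Lemma test_bound f : test_function f ->
  exists2 M : R, 0 < M & forall x, cn (f x) <= M.
Proof.
move=> tf; have [sf [K cK fK]] := tf.
have [M M0 h] := continuous_compact_bound cK (test_ccontinuous tf).
exists M => // x; have [/h//|/fK ->] := pselect (K x).
by rewrite cn0 ltW.
Qed.

Lemma test_radius f : test_function f ->
  exists2 r : R, 0 < r & forall x, r < `|x| -> f x = 0.
Proof.
move=> [_ [K cK fK]]; have [r r0 hr] := compact_norm_bound cK.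
by exists r => // x rx; apply: fK => /hr; rewrite leNgt rx.
Qed.

Lemma test_of_radius f (r : R) : smooth f -> (forall x, r < `|x| -> f x = 0) ->
  test_function f.
Proof.
move=> sf fr; split => //; exists [set x | `|x| <= r]; first exact: compact_norm_le.
by move=> x /= /negP; rewrite -ltNge => /fr.
Qed.

(** Compactness yields a radius valid for [|x| <= rho + 1]. The margin 1, together with [|y| < 1],
    keeps both [x] and [x + y] outside the support in the remaining case. *)
Lemma test_uniform_continuous f (e : R) : test_function f -> 0 < e ->
  exists2 r : R, 0 < r & forall x y, `|y| < r -> cn (f (x + y) - f x) <= e.
Proof.
move=> tf e0; have [c1 c2] := test_ccontinuous tf.
have [rho rho0 frho] := test_radius tf.
have /compact_near_coveringP nK := @compact_norm_le R d (rho + 1).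
have uc (g : Rd -> R) : continuous g -> (forall x, rho < `|x| -> g x = 0) ->
  exists2 r : R, 0 < r & forall x y, `|y| < r -> `|g (x + y) - g x| <= e / 2.
  move=> cg gr.
  have cov x : \forall x' \near x & y \near nbhs (0 : Rd), `|g (x' + y) - g x'| <= e / 2.
    have /cvgrPdist_le /(_ (e / 2 / 2)) := cg x.
    move=> /(_ (divr_gt0 (divr_gt0 e0 (ltr0Sn _ 1)) (ltr0Sn _ 1))).
    move=> /nbhs_normP[r /= r0 hr].
    have r20 : 0 < r / 2 by rewrite divr_gt0.
    exists ([set x' | `|x - x'| < r / 2], [set y | `|0 - y| < r / 2]) => /=.
      by split; apply/nbhs_ballP; exists (r / 2) => //= y /rV_ballE.
    move=> -[x' y] /= [h1 h2]; rewrite (splitr (e / 2)) -(subrKA (g x)) addrC.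
    rewrite sub0r normrN in h2.
    apply: le_trans (ler_normD _ _) _; apply: lerD.
      by apply: hr => /=; apply: lt_trans h1 _; rewrite ltr_pdivrMr// ltr_pMr// ltr1n.
    rewrite distrC; apply: hr => /=; rewrite opprD addrA (splitr r).
    by apply: le_lt_trans (ler_normB _ _) _; rewrite ltrD.
  have /nbhs_ballP[r /= r0 hr] := nK _ (nbhs (0 : Rd))
    (fun y x => `|g (x + y) - g x| <= e / 2) (nbhs_filter _) (fun x _ => cov x).
  exists (Num.min r 1); first by rewrite lt_min r0 ltr01.
  move=> x y; rewrite lt_min => /andP[yr y1].
  have [xK|xK] := leP `|x| (rho + 1).
    by apply: hr => //=; apply/rV_ballE; rewrite sub0r normrN.
  rewrite !gr ?subrr ?normr0 ?divr_ge0 ?ltW//.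
    by apply: lt_trans xK; rewrite ltrDl.
  have := ler_normB (x + y) y; rewrite addrK => h; move: y1 xK h; lra.
have [r1 r10 h1] := uc _ c1 (fun x hx => congr1 (@complex.Re R) (frho x hx)).
have [r2 r20 h2] := uc _ c2 (fun x hx => congr1 (@complex.Im R) (frho x hx)).
exists (Num.min r1 r2); first by rewrite lt_min r10.
move=> x y; rewrite lt_min => /andP[y1 y2]; apply: le_trans (cn_le _) _.
rewrite (splitr e) cReD cImD cReN cImN; apply: lerD; [exact: h1|exact: h2].
Qed.

(** By the mean value theorem the error is [h] times a difference of values of [partial i f], which
    is uniformly continuous. Uniformity in [x] is what differentiation under the integral sign
    uses. *)
Lemma test_uniform_derivative f i (e : R) : test_function f -> 0 < e ->
  exists2 r : R, 0 < r & forall x (h : R), `|h| < r ->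
    cn (f (x + h *: 'e_i) - f x - h%:C%C * partial i f x) <= e * `|h|.
Proof.
move=> tf e0; have [r r0 hr] := test_uniform_continuous (test_function_partial i tf)
  (divr_gt0 e0 (ltr0Sn R 1)).
have [_ _ df] := (tf.1 [::]).
have near_e (s h : R) : `|s| <= `|h| -> `|h| < r -> `|s *: 'e_i : Rd| < r.
  move=> sh hr'; rewrite normrZ; apply: le_lt_trans hr'; apply: le_trans sh.
  by rewrite ler_piMr//; exact: norm_delta_le.
exists r => // x h hr'; apply: le_trans (cn_le _) _.
rewrite !cReD !cImD !cReN !cImN !cReM !cImM /= !mul0r subr0 addr0.
have [s sh es] := @line_MVT _ _ (fun y => Re (f y)) x 'e_i h (fun t : R => (df _ i).1).
have [t th et] := @line_MVT _ _ (fun y => Im (f y)) x 'e_i h (fun t : R => (df _ i).2).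
rewrite es et -!mulrBr !normrM (splitr e) mulrDl ![_ * `|h|]mulrC.
apply: lerD; apply: ler_wpM2l => //.
  apply: le_trans (hr x (s *: 'e_i) (near_e _ _ sh hr')).
  by apply: le_trans (cn_Re _); rewrite cReD cReN.
apply: le_trans (hr x (t *: 'e_i) (near_e _ _ th hr')).
by apply: le_trans (cn_Im _); rewrite cImD cImN.
Qed.

Lemma partial_eps f x i (L : R[i]) : (forall e : R, 0 < e -> exists2 r : R, 0 < r &
    forall h : R, `|h| < r -> cn (f (x + h *: 'e_i) - f x - h%:C%C * L) <= e * `|h|) ->
  [/\ derivable (fun y => Re (f y)) x 'e_i, derivable (fun y => Im (f y)) x 'e_i &
      partial i f x = L].
Proof.
move=> H.
have key (g : Rd -> R) (l : R) : (forall e : R, 0 < e -> exists2 r : R, 0 < r &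
    forall h : R, `|h| < r -> `|g (x + h *: 'e_i) - g x - h * l| <= e * `|h|) ->
    derivable g x 'e_i /\ 'D_('e_i) g x = l.
  move=> hg.
  suff cv : (fun h => h^-1 *: ((g \o shift x) (h *: 'e_i) - g x)) @ 0^' --> l.
    by split; [apply/cvg_ex; exists l|exact/cvg_lim].
  apply/cvgrPdist_le => e e0; have [r r0 hr] := hg e e0.
  near=> h; have h0 : h != 0 by near: h; exact: nbhs_dnbhs_neq.
  have hr' : `|h| < r by near: h; exact: dnbhs0_lt.
  rewrite /= [h *: _ + x]addrC -(ler_pM2r (x := `|h|)) ?normr_gt0//.
  rewrite -normrM mulrBl distrC [_ *: _]mulrC divfK// [l * h]mulrC.
  exact: hr.
have [r1 r2] : (forall e : R, 0 < e -> exists2 r : R, 0 < r &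
    forall h : R, `|h| < r -> `|Re (f (x + h *: 'e_i)) - Re (f x) - h * Re L| <= e * `|h|) /\
    (forall e : R, 0 < e -> exists2 r : R, 0 < r &
    forall h : R, `|h| < r -> `|Im (f (x + h *: 'e_i)) - Im (f x) - h * Im L| <= e * `|h|).
  split=> e e0; have [r r0 hr] := H e e0; exists r => // h hh;
    apply: le_trans (hr h hh).
    apply: le_trans (cn_Re _).
    by rewrite !cReD !cReN cReM /= mul0r subr0.
  apply: le_trans (cn_Im _).
  by rewrite !cImD !cImN cImM /= mul0r addr0.
have [d1 e1] := key (fun y => Re (f y)) _ r1.
have [d2 e2] := key (fun y => Im (f y)) _ r2.
by split => //; apply: complex_ext.
Unshelve. all: by end_near. Qed.

End smooth_functions.

Section smooth_operations.
Variables (R : realType) (d : nat).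
Local Notation Rd := 'rV[R]_d.
Implicit Types (f g : Rd -> R[i]) (s t : seq 'I_d) (x y : Rd).

Local Notation "'e_ i" := (@delta_mx R 1 d 0 i) (at level 8, i at level 2).

Definition cderivable f x i :=
  derivable (fun y => Re (f y)) x 'e_i /\ derivable (fun y => Im (f y)) x 'e_i.

Lemma is_derive_ext (F G : Rd -> R) x v (l : R) :
  is_derive x v F l -> F =1 G -> is_derive x v G l.
Proof. by move=> dF /funext <-. Qed.

Lemma partial_lin (c : R[i]) f g x i : cderivable f x i -> cderivable g x i ->
  cderivable (fun y => c * f y + g y) x i /\
  partial i (fun y => c * f y + g y) x = c * partial i f x + partial i g x.
Proof.
move=> [/derivableP f1 /derivableP f2] [/derivableP g1 /derivableP g2].
have dR := is_deriveD (is_deriveB (is_deriveZ (Re c) f1) (is_deriveZ (Im c) f2)) g1.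
have dI := is_deriveD (is_deriveD (is_deriveZ (Re c) f2) (is_deriveZ (Im c) f1)) g2.
have edR y : (Re c \*: (fun y => Re (f y)) - Im c \*: (fun y => Im (f y)) + (fun y => Re (g y))) y =
    (fun y => Re (c * f y + g y)) y.
  by rewrite cReD cReM.
have edI y : (Re c \*: (fun y => Im (f y)) + Im c \*: (fun y => Re (f y)) + (fun y => Im (g y))) y =
    (fun y => Im (c * f y + g y)) y.
  by rewrite cImD cImM.
have {}dR := is_derive_ext dR edR; have {}dI := is_derive_ext dI edI.
split; first by split; [case: dR|case: dI].
apply: complex_ext; first by rewrite cReD cReM /=; have [_ ->] := dR.
by rewrite cImD cImM /=; have [_ ->] := dI.
Qed.

Lemma ccontinuous_lin (c : R[i]) f g : ccontinuous f -> ccontinuous g ->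
  ccontinuous (fun y => c * f y + g y).
Proof.
move=> [f1 f2] [g1 g2].
have key (a b : R) (h1 h2 h3 : Rd -> R) : continuous h1 -> continuous h2 ->
    continuous h3 -> continuous (fun y => a * h1 y + b * h2 y + h3 y).
  move=> c1 c2 c3 y.
  exact: (cvgD (cvgD (cvgM (cvg_cst a) (c1 y)) (cvgM (cvg_cst b) (c2 y))) (c3 y)).
split.
  under eq_fun do rewrite cReD cReM -mulNr.
  exact: key.
under eq_fun do rewrite cImD cImM.
exact: key.
Qed.

Lemma smoothP f : smooth f <-> forall s, ccontinuous (diffs s f) /\
  forall x i, cderivable (diffs s f) x i.
Proof.
split=> h s; first by have [] := h s.
by have [[]] := h s.
Qed.

Lemma diffs_lin s (c : R[i]) f g : smooth f -> smooth g ->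
  diffs s (fun y => c * f y + g y) = (fun y => c * diffs s f y + diffs s g y).
Proof.
move=> /smoothP sf /smoothP sg; elim: s => //= i s ->; apply/funext => x.
by apply: (partial_lin c _ _).2; [exact: (sf s).2|exact: (sg s).2].
Qed.

Lemma smooth_lin (c : R[i]) f g : smooth f -> smooth g ->
  smooth (fun y => c * f y + g y).
Proof.
move=> sf sg; apply/smoothP => s; rewrite diffs_lin//.
move: sf sg => /smoothP/(_ s)[f1 f2] /smoothP/(_ s)[g1 g2]; split.
  exact: ccontinuous_lin.
by move=> x i; have [] := partial_lin c (f2 x i) (g2 x i).
Qed.

Lemma smooth0 : smooth ((fun=> 0) : Rd -> R[i]).
Proof.
have e s : diffs s ((fun=> 0) : Rd -> R[i]) = (fun=> 0).
  elim: s => //= i s ->; apply/funext => x.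
  by apply: complex_ext => /=; exact: derive_cst.
apply/smoothP => s; rewrite e; split; first by split; exact: cst_continuous.
by move=> x i; split; exact: derivable_cst.
Qed.

Lemma test_function_lin (c : R[i]) f g : test_function f -> test_function g ->
  test_function (fun y => c * f y + g y).
Proof.
move=> tf tg; have [r1 _ h1] := test_radius tf; have [r2 _ h2] := test_radius tg.
apply: (@test_of_radius _ _ _ (Num.max r1 r2)).
  by apply: smooth_lin; [case: tf|case: tg].
by move=> x; rewrite gt_max => /andP[/h1 -> /h2 ->]; rewrite mulr0 addr0.
Qed.

Lemma test_function0 : test_function ((fun=> 0) : Rd -> R[i]).
Proof. by apply: (@test_of_radius _ _ _ 0) => //; exact: smooth0. Qed.

Lemma test_functionZ (c : R[i]) f : test_function f -> test_function (fun y => c * f y).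
Proof.
move=> /(test_function_lin c)/(_ test_function0).
by under eq_fun do rewrite addr0.
Qed.

Lemma test_functionD f g : test_function f -> test_function g ->
  test_function (fun y => f y + g y).
Proof.
move=> tf /(test_function_lin 1 tf).
by under eq_fun do rewrite mul1r.
Qed.

Lemma test_functionB f g : test_function f -> test_function g ->
  test_function (fun y => f y - g y).
Proof.
move=> tf /(test_functionZ (-1)) /(test_functionD tf).
by under eq_fun do rewrite mulN1r.
Qed.

Lemma diffsZ s (c : R[i]) f : smooth f ->
  diffs s (fun y => c * f y) = (fun y => c * diffs s f y).
Proof.
move=> sf; have := diffs_lin s c sf smooth0.
have e : diffs s ((fun=> 0) : Rd -> R[i]) = (fun=> 0).
  elim: s => //= i s ->; apply/funext => x.
  by apply: complex_ext => /=; exact: derive_cst.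
by rewrite e; under eq_fun do rewrite addr0; move=> ->; under eq_fun do rewrite addr0.
Qed.

Lemma diffsB s f g : smooth f -> smooth g ->
  diffs s (fun y => f y - g y) = (fun y => diffs s f y - diffs s g y).
Proof.
move=> sf sg; have := diffs_lin s (-1) sg sf.
rewrite (_ : (fun y => _) = (fun y => f y - g y)); last first.
  by apply/funext => y; rewrite mulN1r addrC.
by move=> ->; apply/funext => y; rewrite mulN1r addrC.
Qed.

Definition coord_mul (i : 'I_d) f : Rd -> R[i] := fun x => (x 0 i)%:C%C * f x.

Lemma partial_coord_mul i j f x : cderivable f x j ->
  cderivable (coord_mul i f) x j /\
  partial j (coord_mul i f) x = (j == i)%:R * f x + (x 0 i)%:C%C * partial j f x.
Proof.
move=> [/derivableP f1 /derivableP f2].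
have dc : is_derive x 'e_j (fun y : Rd => y 0 i) (j == i)%:R.
  have e : (fun h : R => h^-1 *: (((fun y : Rd => y 0 i) \o shift x) (h *: 'e_j) - x 0 i))
      @ 0^' --> ((j == i)%:R : R).
    apply/cvgrPdist_le => e e0; near=> h.
    have h0 : h != 0 by near: h; exact: nbhs_dnbhs_neq.
    rewrite /= !mxE eqxx /= addrK [_ *: _]mulrC mulrAC mulfV// mul1r eq_sym.
    by rewrite subrr normr0 ltW.
  by split; [apply/cvg_ex; exists (j == i)%:R|exact/cvg_lim].
have dR := is_deriveM dc f1; have dI := is_deriveM dc f2.
have edR y : ((fun y : Rd => y 0 i) * (fun y => Re (f y))) y = (fun y => Re (coord_mul i f y)) y.
  by rewrite /coord_mul cReM /= mul0r subr0.
have edI y : ((fun y : Rd => y 0 i) * (fun y => Im (f y))) y = (fun y => Im (coord_mul i f y)) y.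
  by rewrite /coord_mul cImM /= mul0r addr0.
have {}dR := is_derive_ext dR edR; have {}dI := is_derive_ext dI edI.
split; first by split; [case: dR|case: dI].
have nR : Re ((j == i)%:R : R[i]) = (j == i)%:R by case: eqP.
have nI : Im ((j == i)%:R : R[i]) = 0 by case: eqP.
apply: complex_ext.
  rewrite cReD !cReM nR nI /= !mul0r !subr0; have [_ ->] := dR.
  by rewrite addrC [_ *: (_ : R)]mulrC.
rewrite cImD !cImM nR nI /= !mul0r !addr0; have [_ ->] := dI.
by rewrite addrC [_ *: (_ : R)]mulrC.
Unshelve. all: by end_near. Qed.

Lemma ccontinuous_coord_mul i f : ccontinuous f -> ccontinuous (coord_mul i f).
Proof.
move=> [f1 f2]; have cc : continuous (fun y : Rd => y 0 i) by exact: coord_continuous.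
split => y; rewrite /coord_mul.
  under eq_fun do rewrite cReM /= mul0r subr0.
  by apply: continuousM; [exact: cc|exact: f1].
under eq_fun do rewrite cImM /= mul0r addr0.
by apply: continuousM; [exact: cc|exact: f2].
Qed.

(** Leibniz rule for a linear factor: at most one derivative falls on x_i, and since derivatives
    commute each of the [count_mem i s] choices leaves the same list [rem i s]. *)
Lemma diffs_coord_mul s i f : smooth f ->
  diffs s (coord_mul i f) =
  (fun x => (count_mem i s)%:R * diffs (rem i s) f x + coord_mul i (diffs s f) x).
Proof.
move=> sf; have /smoothP ssf := sf; elim: s => [|j s IH] /=.
  by apply/funext => x; rewrite mul0r add0r.
rewrite IH; apply/funext => x.
have [d1 e1] := partial_coord_mul i ((ssf s).2 x j).
have [_ ->] := partial_lin (count_mem i s)%:R ((ssf (rem i s)).2 x j) d1.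
rewrite e1 /coord_mul; have [->|ji] /= := eqVneq j i; last by rewrite mul0r add0r add0n.
rewrite mul1r addrA; congr (_ + _); rewrite natrD mulrDl mul1r addrC; congr (_ + _).
have [is_|is_] := boolP (i \in s); last by rewrite (count_memPn is_) !mul0r.
congr (_ * _); have /(perm_diffs sf) := perm_to_rem is_.
by move=> /(congr1 (@^~ x)) /= ->.
Qed.

Lemma smooth_coord_mul i f : smooth f -> smooth (coord_mul i f).
Proof.
move=> sf; have /smoothP ssf := sf; apply/smoothP => s; rewrite diffs_coord_mul//.
have [f1 f2] := ssf s; have [g1 g2] := ssf (rem i s); split.
  by apply: ccontinuous_lin => //; exact: ccontinuous_coord_mul.
move=> x j; have [d1 _] := partial_coord_mul i (f2 x j).
by have [] := partial_lin (count_mem i s)%:R (g2 x j) d1.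
Qed.

Lemma test_coord_mul i f : test_function f -> test_function (coord_mul i f).
Proof.
move=> [sf [K cK fK]]; split; first exact: smooth_coord_mul.
by exists K => // x /fK; rewrite /coord_mul => ->; rewrite mulr0.
Qed.

End smooth_operations.

(** * Smoothness of parametric integrals *)

Section parametric_integral.
Context dT (T : measurableType dT) (R : realType) (d : nat).
Variable nu : {measure set T -> \bar R}.
Local Notation Rd := 'rV[R]_d.
Local Notation "'e_ i" := (@delta_mx R 1 d 0 i) (at level 8, i at level 2).
Implicit Types (k : T -> R[i]) (phi : Rd -> R[i]) (s : seq 'I_d).

Variables (al be : T -> 'I_d -> R) (A : R).
Hypotheses (mal : forall i, measurable_fun setT (fun t => al t i))
  (mbe : forall i, measurable_fun setT (fun t => be t i)) (A0 : 0 < A).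

(** A superposition of coordinatewise affine images of [phi]. With suitable measure, weight and
    coefficients it becomes a composition with a fixed affine map, a convolution, or the
    interpolation between [phi] and its dilation. *)
Definition pint k phi : Rd -> R[i] := fun x =>
  cint nu (fun t => k t * phi (diag_affine (al t) (be t) x)).

(** The coefficients are bounded only where the weight is nonzero because in the interpolation one
    of them is [t] itself, which is bounded only on the interval of integration. *)
Definition weight_ok k :=
  cintegrable nu k /\ forall t i, k t != 0 -> `|al t i| <= A.

Lemma cmeasurable_diag_affine phi x : ccontinuous phi ->
  cmeasurable (fun t => phi (diag_affine (al t) (be t) x)).
Proof.
move=> /ccontinuous_cmeasurable [p1 p2].
have m : measurable_fun setT (fun t => diag_affine (al t) (be t) x).
  apply: measurable_fun_rVP => i; under eq_fun do rewrite mxE.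
  by apply: measurable_funD => //; apply: measurable_funM.
by split; [exact: (measurableT_comp p1 m)|exact: (measurableT_comp p2 m)].
Qed.

Lemma pint_integrable k phi x : weight_ok k -> test_function phi ->
  cintegrable nu (fun t => k t * phi (diag_affine (al t) (be t) x)).
Proof.
move=> [ki _] tp; have [M M0 hM] := test_bound tp.
apply: (@cintegrableM_bounded _ _ _ _ _ _ M) => //.
by apply: cmeasurable_diag_affine; exact: test_ccontinuous.
Qed.

Lemma weight_ok_mul k i : weight_ok k -> weight_ok (fun t => k t * (al t i)%:C%C).
Proof.
move=> [ki kA]; split.
  apply: (@cintegrableM_bounded _ _ _ _ _ _ A) => //.
    exact: cmeasurable_real.
  by move=> t kt; rewrite cn_real; exact: kA.
move=> t j kt; apply: kA; apply: contra kt => /eqP ->.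
by rewrite mul0r.
Qed.

Let S k := (\int[nu]_t cn (k t))%R.

Let S_ge0 k : 0 <= S k.
Proof. by apply: Rintegral_ge0 => t _; exact: cn_ge0. Qed.

Lemma cint_mul_bound k (h : T -> R[i]) (e : R) : cintegrable nu k ->
  cintegrable nu (fun t => k t * h t) ->
  (forall t, k t != 0 -> cn (h t) <= e) ->
  cn (cint nu (fun t => k t * h t)) <= e * S k.
Proof.
move=> [mk ki] [mkh _] he.
apply: le_trans (le_cn_cint_bound (h := fun t => e * cn (k t)) mkh _ _) _.
- exact: (@integrableZl _ _ _ nu _ measurableT e _ ki).
- move=> t; rewrite cnM mulrC; have [->|kt] := eqVneq (k t) 0.
    by rewrite cn0 !mulr0.
  by rewrite ler_wpM2r ?cn_ge0// he.
- by rewrite RintegralZl.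
Qed.

Lemma diag_affine_add (a b : 'I_d -> R) (x y : Rd) :
  diag_affine a b (x + y) = diag_affine a b x + \row_i (a i * y 0 i).
Proof. by apply/rowP => i; rewrite !mxE mulrDr addrAC. Qed.

Lemma pint_ccontinuous k phi : weight_ok k -> test_function phi ->
  ccontinuous (pint k phi).
Proof.
move=> wk tp; have [ki kA] := wk.
apply: ccontinuous_eps => x e e0.
(* The total mass [S k] may vanish, hence the added 1. Below, [r / A] appears because the affine
   maps stretch [y] by at most [A]. *)
have S1 : 0 < S k + 1 by rewrite ltr_wpDl.
have [r r0 hr] := test_uniform_continuous tp (divr_gt0 e0 S1).
exists (r / A); first by rewrite divr_gt0.
move=> y yr.
have i1 := pint_integrable (x + y) wk tp; have i2 := pint_integrable x wk tp.
rewrite /pint -cintB//; under eq_fun do rewrite -mulrBr.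
apply: (@le_trans _ _ (e / (S k + 1) * S k)).
  apply: cint_mul_bound => //.
    have := cintegrableB i1 i2.
    by under [in X in X -> _]eq_fun do rewrite -mulrBr.
  move=> t kt; rewrite diag_affine_add; apply: hr.
  apply: (@le_lt_trans _ _ (A * `|y|)); last by rewrite mulrC -ltr_pdivlMr.
  apply: rV_norm_le => [|i]; first by rewrite mulr_ge0// ltW.
  by rewrite mxE normrM ler_pM// ?kA// coord_le_norm.
by rewrite mulrAC ler_pdivrMr// ler_pM2l// lerDl.
Qed.

(** An increment [h] in direction [i] moves the argument of [phi] by [h * al t i], at most [A * |h|]
    where [k] is nonzero; the uniform derivative of [phi] bounds the resulting error under the
    integral. *)
Lemma pint_partial k phi x i : weight_ok k -> test_function phi ->
  cderivable (pint k phi) x i /\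
  partial i (pint k phi) x = pint (fun t => k t * (al t i)%:C%C) (partial i phi) x.
Proof.
move=> wk tp; have [ki kA] := wk.
suff [] : [/\ derivable (fun y => Re (pint k phi y)) x 'e_i,
    derivable (fun y => Im (pint k phi y)) x 'e_i &
    partial i (pint k phi) x = pint (fun t => k t * (al t i)%:C%C) (partial i phi) x].
  by move=> d1 d2 e; exact: (conj (conj d1 d2) e).
apply: partial_eps => e e0.
have S1 : 0 < S k + 1 by rewrite ltr_wpDl.
have AS : 0 < A * (S k + 1) by rewrite mulr_gt0.
have [r r0 hr] := test_uniform_derivative i tp (divr_gt0 e0 AS).
exists (r / A); first by rewrite divr_gt0.
move=> h hrA.
have i1 := pint_integrable (x + h *: 'e_i) wk tp; have i2 := pint_integrable x wk tp.
have i3 := cintegrableZ h%:C%C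
  (pint_integrable x (weight_ok_mul i wk) (test_function_partial i tp)).
have i4 := cintegrableB (cintegrableB i1 i2) i3.
rewrite /pint -cintZ; last first.
  exact: pint_integrable (weight_ok_mul i wk) (test_function_partial i tp).
rewrite -cintB// -cintB//; last exact: cintegrableB.
set F := fun t => _ - _ in i4 *.
pose G t := phi (diag_affine (al t) (be t) x + (h * al t i) *: 'e_i) -
  phi (diag_affine (al t) (be t) x) -
  (h * al t i)%:C%C * partial i phi (diag_affine (al t) (be t) x).
have FG : F = fun t => k t * G t.
  apply/funext => t; rewrite /F /G !mulrBr diag_affine_add; congr (_ - _ - _).
    congr (_ * phi (_ + _)); apply/rowP => j; rewrite !mxE eqxx /=.
    by have [->|_] := eqVneq j i; rewrite ?mulr1 ?mulr0// mulrC.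
  by rewrite (rmorphM (real_complex R)); ring.
rewrite FG in i4 *.
apply: (@le_trans _ _ (e / (A * (S k + 1)) * (A * `|h|) * S k)).
  apply: cint_mul_bound => // t kt.
  have ha : `|h * al t i| <= A * `|h| by rewrite normrM mulrC ler_wpM2r// kA.
  apply: le_trans (hr _ _ _) _; last by rewrite ler_pM2l// divr_gt0.
  by apply: le_lt_trans ha _; rewrite mulrC -ltr_pdivlMr.
have -> : e / (A * (S k + 1)) * (A * `|h|) * S k = e * `|h| * (S k / (S k + 1)).
  by field; rewrite !gt_eqF.
rewrite ler_piMr ?mulr_ge0// ?ltW// ltr_pdivrMr// mul1r.
by rewrite ltrDl.
Qed.

(** The chain rule: each derivative in direction [i] contributes a factor [al t i] to the weight. *)
Definition diff_weight k s t := k t * (\prod_(i <- s) al t i)%:C%C.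

Lemma weight_ok_diff k s : weight_ok k -> weight_ok (diff_weight k s).
Proof.
move=> wk; elim: s => [|i s IH].
  rewrite (_ : diff_weight k [::] = k)//; apply/funext => t.
  by rewrite /diff_weight big_nil (rmorph1 (real_complex R)) mulr1.
have := weight_ok_mul i IH; congr weight_ok; apply/funext => t.
by rewrite /diff_weight big_cons (rmorphM (real_complex R)); ring.
Qed.

Lemma diffs_pint k phi s : weight_ok k -> test_function phi ->
  diffs s (pint k phi) = pint (diff_weight k s) (diffs s phi).
Proof.
move=> wk tp; elim: s => [|i s IH] /=.
  rewrite (_ : diff_weight k [::] = k)//; apply/funext => t.
  by rewrite /diff_weight big_nil (rmorph1 (real_complex R)) mulr1.
rewrite IH; apply/funext => x.
have [_ ->] := pint_partial x i (weight_ok_diff s wk) (test_function_diffs s tp).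
congr (pint _ _ x); apply/funext => t.
by rewrite /diff_weight big_cons (rmorphM (real_complex R)); ring.
Qed.

Lemma pint_smooth k phi : weight_ok k -> test_function phi -> smooth (pint k phi).
Proof.
move=> wk tp; apply/smoothP => s; rewrite diffs_pint//.
have wks := weight_ok_diff s wk; have tps := test_function_diffs s tp.
split; first exact: pint_ccontinuous.
by move=> x i; have [] := pint_partial x i wks tps.
Qed.

End parametric_integral.

(** * Transposes of convolutions *)

Section correlations.
Variables (R : realType) (d : nat).
Local Notation Rd := 'rV[R]_d.
Local Notation mu := (lebesgue_rV R d).
Implicit Types (k f g chi psi : Rd -> R[i]) (s : seq 'I_d) (x y : Rd).

Lemma test_cintegrable f : test_function f -> cintegrable mu f.
Proof.
move=> tf; have [_ [K cK fK]] := tf; have [M M0 fM] := test_bound tf.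
apply: cintegrable_bounded_compact cK fK fM.
exact/ccontinuous_cmeasurable/test_ccontinuous.
Qed.

Lemma cintegrable_mul_test k f : cintegrable mu k -> test_function f ->
  cintegrable mu (fun x => k x * f x).
Proof.
move=> ik tf; have [M M0 fM] := test_bound tf.
apply: (@cintegrableM_bounded _ _ _ _ _ _ M) => //.
exact/ccontinuous_cmeasurable/test_ccontinuous.
Qed.

(* The composition with a fixed affine map is a parametric integral against a
   Dirac mass. *)
Lemma test_diag_affine (a b : 'I_d -> R) f : (forall i, a i != 0) -> test_function f ->
  test_function (fun x => f (diag_affine a b x)) /\
  forall s, diffs s (fun x => f (diag_affine a b x)) =
    (fun x => (\prod_(i <- s) a i)%:C%C * diffs s f (diag_affine a b x)).
Proof.
move=> a0 tf.
pose A := 1 + \sum_i `|a i|.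
have A0 : 0 < A by rewrite ltr_wpDr// sumr_ge0.
pose k (t : unit) : R[i] := 1.
pose nu : {measure set unit -> \bar R} := \d_tt.
have ce (h : unit -> R[i]) : cint nu h = h tt.
  by apply: complex_ext; rewrite /= /Rintegral integral_dirac// diracT mul1e.
have wk : weight_ok nu (fun=> a) A k.
  split; last first.
    by move=> t i _; rewrite /A (bigD1 i)//= addrCA lerDl addr_ge0// sumr_ge0.
  apply: cintegrableP; first exact: cmeasurable_cst.
  under eq_integral do rewrite Normc.normc1.
  by rewrite integral_dirac// diracT mul1e ltry.
have ma i : measurable_fun setT (fun t : unit => a i) by exact: measurable_cst.
have mb i : measurable_fun setT (fun t : unit => b i) by exact: measurable_cst.
have pE h : pint nu (fun=> a) (fun=> b) k h = fun x => h (diag_affine a b x).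
  by apply/funext => x; rewrite /pint ce mul1r.
have ds := diffs_pint ma mb A0 _ wk tf; have sm := pint_smooth ma mb A0 wk tf.
rewrite pE in sm; split; last first.
  move=> s; rewrite -(pE f) ds; apply/funext => x.
  by rewrite /pint ce /diff_weight mul1r.
have [r r0 fr] := test_radius tf.
(* Solving [y_i = a_i x_i + b_i] for [x_i] with [|y| <= r] bounds every coordinate of [x] by [B]. *)
pose B := (\sum_i `|a i|^-1) * (r + \sum_i `|b i|).
apply: (@test_of_radius _ _ _ B) => // x xB; apply: fr; rewrite ltNge; apply/negP => xr.
move: xB; apply/negP; rewrite -leNgt.
have sp (F : 'I_d -> R) (i : 'I_d) : (forall i, 0 <= F i) -> F i <= \sum_i F i.
  by move=> F0; rewrite (bigD1 i)//= lerDl sumr_ge0.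
apply: rV_norm_le => [|i].
  by rewrite mulr_ge0 ?addr_ge0 ?sumr_ge0 ?ltW// => i _; rewrite invr_ge0.
have -> : x 0 i = (a i)^-1 * (diag_affine a b x 0 i - b i).
  by rewrite mxE addrK mulKf.
rewrite normrM normfV; apply: ler_pM => //.
  by apply: (sp (fun i => `|a i|^-1)) => j; rewrite invr_ge0.
apply: le_trans (ler_normB _ _) _; apply: lerD.
  exact: le_trans (coord_le_norm _ _) xr.
exact: (sp (fun i => `|b i|)).
Qed.

Lemma test_reflect f x : test_function f ->
  test_function (fun y => f (x - y)) /\
  forall s, diffs s (fun y => f (x - y)) =
    (fun y => (-1) ^+ size s * diffs s f (x - y)).
Proof.
move=> tf.
have a0 (i : 'I_d) : (-1 : R) != 0 by rewrite oppr_eq0 oner_eq0.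
have [t1 t2] := test_diag_affine (fun i => x 0 i) a0 tf.
have e g : (fun y => g (diag_affine (fun=> -1) (fun i => x 0 i) y)) = fun y => g (x - y).
  by apply/funext => y; rewrite -subl_diag_affine.
rewrite e in t1; split => // s; have := t2 s; rewrite e => ->.
apply/funext => y; rewrite -subl_diag_affine; congr (_ * _).
rewrite big_const_seq count_predT iter_mulr_1.
by rewrite (rmorphXn (real_complex R)) (rmorphN1 (real_complex R)).
Qed.

Lemma test_dilation f j : test_function f ->
  test_function (dilation f j) /\
  forall i, partial i (dilation f j) = (fun x => (2 ^+ j)%:C%C * dilation (partial i f) j x).
Proof.
move=> tf.
have a0 (i : 'I_d) : (2 ^+ j : R) != 0 by rewrite expf_neq0// pnatr_eq0.
have [t1 t2] := test_diag_affine (fun=> 0) a0 tf.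
have e g : (fun y => g (diag_affine (fun=> 2 ^+ j) (fun=> 0) y)) = fun y => g (2 ^+ j *: y).
  by apply/funext => y; rewrite -scale_diag_affine.
rewrite e in t1; split; first exact: test_functionZ.
move=> i; have := t2 [:: i]; rewrite e => h.
have := diffsZ [:: i] (2 ^+ (j * d))%:C%C t1.1; rewrite h /= => ->.
apply/funext => y; rewrite -scale_diag_affine big_seq1 /dilation mulrCA.
by [].
Qed.

Lemma dilation_radius f (r : R) j : (forall x, r < `|x| -> f x = 0) -> 0 < r ->
  forall x, r / 2 ^+ j < `|x| -> dilation f j x = 0.
Proof.
move=> fr r0 x xr; rewrite /dilation fr ?mulr0//.
have j0 : 0 < 2 ^+ j :> R by rewrite exprn_gt0.
by rewrite normrZ gtr0_norm// mulrC -ltr_pdivrMr.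
Qed.

(** The transpose of convolution with [chi]: integrating [u * chi] against [k] amounts to applying
    [u] to this function. Derivatives fall on [chi], with a sign. *)
Definition rconv k chi : Rd -> R[i] := fun y => cint mu (fun x => k x * chi (x - y)).

(** The same transpose after the substitution [x = y + z]; in this form derivatives fall on [psi],
    without sign. *)
Definition corr k psi : Rd -> R[i] := fun y => cint mu (fun z => k z * psi (y + z)).

Lemma rconv_pint k chi :
  rconv k chi = pint mu (fun _ _ => -1) (fun x i => x 0 i) k chi.
Proof.
by apply/funext => y; congr cint; apply/funext => x; rewrite -subl_diag_affine.
Qed.

Lemma corr_pint k psi :
  corr k psi = pint mu (fun _ _ => 1) (fun x i => x 0 i) k psi.
Proof.
by apply/funext => y; congr cint; apply/funext => x; rewrite -addl_diag_affine addrC.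
Qed.

Lemma rconv_integrable k chi y : cintegrable mu k -> test_function chi ->
  cintegrable mu (fun x => k x * chi (x - y)).
Proof.
move=> ik tc; apply: cintegrable_mul_test => //.
have a0 (i : 'I_d) : (1 : R) != 0 by rewrite oner_eq0.
have [t1 _] := test_diag_affine (fun i => - y 0 i) a0 tc.
move: t1; congr test_function; apply/funext => x; congr chi.
by apply/rowP => i; rewrite !mxE mul1r.
Qed.

Lemma corr_integrable k psi y : cintegrable mu k -> test_function psi ->
  cintegrable mu (fun x => k x * psi (y + x)).
Proof.
move=> ik tc; have := rconv_integrable (- y) ik tc.
by under [X in cintegrable _ X -> _]eq_fun do rewrite opprK addrC.
Qed.

Lemma smooth_rconv k chi : cintegrable mu k -> test_function chi ->
  smooth (rconv k chi) /\
  forall s, diffs s (rconv k chi) = (fun y => (-1) ^+ size s * rconv k (diffs s chi) y).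
Proof.
move=> ik tc.
have wk : weight_ok mu (fun (_ : Rd) (_ : 'I_d) => -1) 1 k.
  by split => // t i _; rewrite normrN1.
have ma (i : 'I_d) : measurable_fun setT (fun t : Rd => -1 : R) by exact: measurable_cst.
have mb (i : 'I_d) : measurable_fun setT (fun t : Rd => t 0 i).
  exact: measurable_rV_coord.
split; first by rewrite rconv_pint; exact: (pint_smooth ma mb ltr01 wk tc).
move=> s; rewrite rconv_pint (diffs_pint ma mb ltr01 _ wk tc) -/(rconv _ _).
apply/funext => y; rewrite -cintZ; last exact/rconv_integrable/test_function_diffs.
congr cint; apply/funext => x; rewrite /diff_weight -subl_diag_affine mulrAC [RHS]mulrC.
congr (_ * _); rewrite big_const_seq count_predT iter_mulr_1.
by rewrite (rmorphXn (real_complex R)) (rmorphN1 (real_complex R)).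
Qed.

Lemma rconv_radius k chi (r1 r2 : R) : (forall x, r1 < `|x| -> k x = 0) ->
  (forall x, r2 < `|x| -> chi x = 0) ->
  forall y, r1 + r2 < `|y| -> rconv k chi y = 0.
Proof.
move=> kr cr y yr; rewrite -(cint0 mu); congr cint; apply/funext => x.
have [xr|xr] := leP `|x| r1; last by rewrite kr ?mul0r.
rewrite cr ?mulr0//; have := ler_normB x (x - y).
rewrite subKr => h; move: xr yr h; lra.
Qed.

Lemma test_rconv k chi (r1 : R) : cintegrable mu k -> (forall x, r1 < `|x| -> k x = 0) ->
  test_function chi -> test_function (rconv k chi).
Proof.
move=> ik kr tc; have [r2 _ cr] := test_radius tc.
apply: (test_of_radius (smooth_rconv ik tc).1 (r := r1 + r2)).
exact: rconv_radius.
Qed.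

Lemma rconv_corr psi chi : test_function psi -> test_function chi ->
  rconv psi chi = corr chi psi.
Proof.
move=> tp tc; apply/funext => y.
rewrite /rconv -(cint_add y (rconv_integrable y (test_cintegrable tp) tc)).
by congr cint; apply/funext => z; rewrite [y + z - y]addrC addKr mulrC.
Qed.

Lemma diffs_corr k psi s : cintegrable mu k -> test_function psi ->
  diffs s (corr k psi) = corr k (diffs s psi).
Proof.
move=> ik tc.
have wk : weight_ok mu (fun (_ : Rd) (_ : 'I_d) => 1) 1 k.
  by split => // t i _; rewrite normr1.
have ma (i : 'I_d) : measurable_fun setT (fun t : Rd => 1 : R) by exact: measurable_cst.
have mb (i : 'I_d) : measurable_fun setT (fun t : Rd => t 0 i).
  exact: measurable_rV_coord.
rewrite !corr_pint (diffs_pint ma mb ltr01 _ wk tc); congr pint.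
by apply/funext => x; rewrite /diff_weight big1// (rmorph1 (real_complex R)) mulr1.
Qed.

Lemma test_corr chi psi : test_function chi -> test_function psi ->
  test_function (corr chi psi).
Proof.
move=> tc tp; rewrite -rconv_corr//; have [r _ pr] := test_radius tp.
exact: test_rconv (test_cintegrable tp) pr tc.
Qed.

(** The substitution [z -> x + y - z] exchanges the two factors. This symmetry is behind F_k * phi_j
    = F_j * phi_k. *)
Lemma rconv_reflect chi1 chi2 x y : test_function chi1 -> test_function chi2 ->
  rconv (fun z => chi2 (x - z)) chi1 y = rconv (fun z => chi1 (x - z)) chi2 y.
Proof.
move=> t1 t2.
have t2' := (test_reflect x t2).1.
rewrite /rconv -(cint_sub (x + y) (rconv_integrable y (test_cintegrable t2') t1)).
congr cint; apply/funext => z; rewrite mulrC; congr (chi1 _ * chi2 _).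
  by rewrite addrAC addrK.
by apply/rowP => i; rewrite !mxE; ring.
Qed.

End correlations.

(** * Distributions *)

Section distributions.
Variables (R : realType) (d : nat).
Local Notation Rd := 'rV[R]_d.
Local Notation mu := (lebesgue_rV R d).
Implicit Types (k f g chi psi : Rd -> R[i]) (s : seq 'I_d) (x y : Rd) (u : functional R d).

Lemma norm_ball_cover (rho r : R) : 0 < r ->
  exists2 xs : seq Rd, (forall x0, x0 \in xs -> `|x0| <= rho) &
    forall x, `|x| <= rho -> exists2 x0, x0 \in xs & `|x0 - x| < r.
Proof.
move=> r0; have := @compact_norm_le R d rho; rewrite compact_cover.
move=> /(_ _ [set x : Rd | `|x| <= rho] (fun x => ball x r)).
case.
- by move=> x _; exact: ball_open.
- by move=> x /= xr; exists x => //; exact: ballxx.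
- move=> D Dr cov; exists (finmap.enum_fset D).
    by move=> x0 /Dr /set_mem.
  move=> x /cov [x0 /= x0D /rV_ballE h]; exists x0 => //.
Qed.

(** Induction on the order. [diffs] applies the last direction of a list first, so the list is split
    at its end, and the smallest radius over the finitely many [partial i chi] is taken. *)
Lemma test_equicontinuous m chi (e : R) : test_function chi -> 0 < e ->
  exists2 r : R, 0 < r & forall s x y, (size s <= m)%N -> `|y| < r ->
    cn (diffs s chi (x + y) - diffs s chi x) <= e.
Proof.
elim: m chi => [|m IH] chi tc e0.
  have [r r0 hr] := test_uniform_continuous tc e0.
  by exists r => // -[|//] x y _; exact: hr.
have [r r0 hr] := test_uniform_continuous tc e0.
have /choice[q hq] : forall i, exists q : R, 0 < q /\ forall s x y, (size s <= m)%N -> `|y| < q ->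
    cn (diffs s (partial i chi) (x + y) - diffs s (partial i chi) x) <= e.
  by move=> i; have [q q0 h] := IH _ (test_function_partial i tc) e0; exists q.
exists (\big[Num.min/r]_i q i).
  by apply: lt_bigmin => // i _; have [] := hq i.
move=> s x y; case/lastP: s => [_ yr|s i].
  by apply: hr; apply: lt_le_trans yr _; exact: bigmin_le_id.
rewrite size_rcons ltnS => sm yr; rewrite -cats1 diffs_cat.
by apply: (hq i).2 => //; apply: lt_le_trans yr _; exact: bigmin_le_cond.
Qed.

Section fixed_distribution.
Variable u : functional R d.
Hypothesis du : is_distribution u.

Lemma dist0 : u (fun=> 0) = 0.
Proof.
have t0 := test_function0 R d.
have := distribution_linear du 1 t0 t0.
rewrite (_ : (fun x => _) = (fun=> 0 : R[i])); last first.
  by apply/funext => x; rewrite mul1r addr0.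
by rewrite mul1r => /eqP; rewrite -subr_eq subrr eq_sym => /eqP.
Qed.

Lemma distZ (c : R[i]) f : test_function f -> u (fun x => c * f x) = c * u f.
Proof.
move=> tf; have := distribution_linear du c tf (test_function0 R d).
by under eq_fun do rewrite addr0; rewrite dist0 addr0.
Qed.

Lemma distD f g : test_function f -> test_function g ->
  u (fun x => f x + g x) = u f + u g.
Proof.
move=> tf tg; have := distribution_linear du 1 tf tg.
by under eq_fun do rewrite mul1r; rewrite mul1r.
Qed.

Lemma distN f : test_function f -> u (fun x => - f x) = - u f.
Proof.
by move=> tf; rewrite -mulN1r -distZ//; congr u; apply/funext => x; rewrite mulN1r.
Qed.

Lemma distB f g : test_function f -> test_function g ->
  u (fun x => f x - g x) = u f - u g.
Proof.
move=> tf tg; rewrite distD//; first by rewrite distN.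
by have := test_functionZ (-1) tg; under eq_fun do rewrite mulN1r.
Qed.

Lemma dist_sum (I : Type) (r : seq I) (F : I -> Rd -> R[i]) :
  (forall i, test_function (F i)) ->
  test_function (fun x => \sum_(i <- r) F i x) /\
  u (fun x => \sum_(i <- r) F i x) = \sum_(i <- r) u (F i).
Proof.
move=> tF; elim: r => [|i r [IH1 IH2]].
  under eq_fun do rewrite big_nil; rewrite big_nil dist0; split => //.
  exact: test_function0.
under eq_fun do rewrite big_cons; rewrite big_cons; split.
  exact: test_functionD.
by rewrite distD// IH2.
Qed.

(** The order is counted on lists of directions, and [c] is made positive so that later estimates
    can divide by it. *)
Lemma dist_bound (rho : R) : exists (c : R) (m : nat), 0 < c /\
  forall f (M : R), test_function f -> (forall x, rho < `|x| -> f x = 0) ->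
    (forall s x, (size s <= m)%N -> cn (diffs s f x) <= M) ->
    cn (u f) <= c * M.
Proof.
have [c [m h]] := distribution_continuous du (@compact_norm_le R d rho).
exists (`|c| + 1), m; split=> [|f M tf fr fM]; first by rewrite ltr_wpDl.
have M0 : 0 <= M by apply: le_trans (cn_ge0 _) (fM [::] 0 _).
apply: (@le_trans _ _ (c * M)).
  apply: h => //; first by move=> x /= /negP; rewrite -ltNge; exact: fr.
  by move=> a x am; rewrite /modulus partialsE; apply: fM; rewrite size_mi_seq.
by rewrite ler_wpM2r// (le_trans (ler_norm _))// lerDl.
Qed.

Lemma dderiv_distribution a : is_distribution (dderiv a u).
Proof.
split => [c f g tf tg|K cK].
  rewrite /dderiv !partialsE diffs_lin; [|by case: tf|by case: tg].
  have t1 := test_function_diffs (mi_seq a) tf.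
  have t2 := test_function_diffs (mi_seq a) tg.
  by rewrite (distribution_linear du c t1 t2) mulrDr mulrCA.
have [c [m h]] := distribution_continuous du cK.
exists c, (m + mi_order a)%N => f M tf fK fM.
rewrite /dderiv cnM cn_sign mul1r; apply: h.
- exact: test_function_partials.
- by rewrite partialsE; exact: diffs_vanishes.
- move=> b x bm; rewrite partials_add; last by case: tf.
  by apply: fM; rewrite mi_order_add leq_add2r.
Qed.

Local Notation dconv := (@dist_convolution R d).

Lemma reflect_diffs chi x0 x s y : test_function chi ->
  diffs s (fun y => chi (x - y) - chi (x0 - y)) y =
  (-1) ^+ size s * (diffs s chi (x - y) - diffs s chi (x0 - y)).
Proof.
move=> tc; have [t1 e1] := test_reflect x tc; have [t0 e0] := test_reflect x0 tc.
by rewrite diffsB ?e1 ?e0 ?mulrBr//; [case: t1|case: t0].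
Qed.

(** [c] and [m] precede [e] and [r], since a radius of equicontinuity can be chosen only once the
    order [m] is known. The second estimate says that a weight concentrated near [x0] acts almost
    like its total mass placed at [x0]. *)
Lemma dconv_modulus_of_continuity chi (rho : R) : test_function chi ->
  exists (c : R) (m : nat), 0 < c /\
  forall (e r : R), 0 < e ->
    (forall s x y, (size s <= m)%N -> `|y| < r ->
      cn (diffs s chi (x + y) - diffs s chi x) <= e) ->
    (forall x x0, `|x| <= rho -> `|x0| <= rho -> `|x0 - x| < r ->
      cn (dconv u chi x - dconv u chi x0) <= c * e) /\
    (forall k x0, cintegrable mu k -> `|x0| <= rho ->
      (forall x, k x != 0 -> `|x| <= rho /\ `|x0 - x| < r) ->
      cn (u (rconv k chi) - cint mu k * dconv u chi x0) <=
      c * (e * (\int[mu]_x cn (k x))%R)).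
Proof.
move=> tc; have [r1 r10 cr] := test_radius tc.
have [c [m [c0 h]]] := dist_bound (rho + r1).
have out x y : `|x| <= rho -> rho + r1 < `|y| -> chi (x - y) = 0.
  move=> xr yr; apply: cr; have := ler_normB x (x - y).
  by rewrite subKr => h'; move: xr yr h'; lra.
exists c, m; split => // e r e0 he; split.
  move=> x x0 xr x0r xx0; have [t1 _] := test_reflect x tc; have [t0 _] := test_reflect x0 tc.
  rewrite /dist_convolution -distB//; apply: h; first exact: test_functionB.
    by move=> y yr; rewrite !out// subrr.
  move=> s y sm; rewrite reflect_diffs// cnM cn_sign mul1r.
  rewrite (_ : x - y = (x0 - y) + (x - x0)); first by apply: he => //; rewrite distrC.
  by apply/rowP => i; rewrite !mxE; ring.
move=> k x0 ik x0r kr; have [t0 e0'] := test_reflect x0 tc.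
have tk : test_function (rconv k chi).
  apply: (@test_rconv _ _ _ _ rho) => // x xr; apply/eqP/negPn/negP => /kr[].
  by rewrite leNgt xr.
rewrite /dist_convolution -distZ// -distB//; last exact: test_functionZ.
have tz := test_functionZ (cint mu k) t0.
apply: h; first exact: test_functionB.
  move=> y yr; rewrite out// mulr0 subr0.
  apply: (rconv_radius (r1 := rho) (r2 := r1)) yr => // x xr.
  by apply/eqP/negPn/negP => /kr[]; rewrite leNgt xr.
move=> s y sm; rewrite diffsB; [|by case: tk|by case: tz].
rewrite (smooth_rconv ik tc).2 diffsZ; last by case: t0.
rewrite e0' mulrCA -mulrBr cnM cn_sign mul1r.
have tsc := test_function_diffs s tc.
have i1 := rconv_integrable y ik tsc.
have E : rconv k (diffs s chi) y - cint mu k * diffs s chi (x0 - y) =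
    cint mu (fun x => k x * (diffs s chi (x - y) - diffs s chi (x0 - y))).
  rewrite [cint mu k * _]mulrC -cintZ// -cintB//; last exact: cintegrableZ.
  by congr cint; apply/funext => x; ring.
rewrite E; apply: cint_mul_bound => //.
  have := cintegrableB i1 (cintegrableZ (diffs s chi (x0 - y)) ik).
  congr cintegrable; apply/funext => x; ring.
move=> x /kr[_ xx0]; rewrite (_ : x - y = (x0 - y) + (x - x0)).
  by apply: he => //; rewrite distrC.
by apply/rowP => i; rewrite !mxE; ring.
Qed.

Lemma dconv_ccontinuous chi : test_function chi -> ccontinuous (dconv u chi).
Proof.
move=> tc; apply: ccontinuous_eps => x e e0.
have [c [m [c0 h]]] := dconv_modulus_of_continuity (`|x| + 1) tc.
have ec : 0 < e / c by rewrite divr_gt0.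
have [r r0 hr] := test_equicontinuous m tc ec.
have [h1 _] := h _ _ ec hr.
exists (Num.min r 1); first by rewrite lt_min r0 ltr01.
move=> y; rewrite lt_min => /andP[yr y1].
rewrite -[leRHS](mulfVK (_ : c != 0)) ?gt_eqF// mulrC; apply: h1.
- by apply: le_trans (ler_normD _ _) _; rewrite lerD2l ltW.
- by rewrite lerDl.
- by rewrite opprD addNKr normrN.
Qed.

(* Fubini for distributions: the support of psi is cut into small pieces, on
   each of which x |-> chi (x - _) is nearly constant in the topology of test
   functions. *)
Theorem dist_of_dconv chi psi : test_function chi -> test_function psi ->
  dist_of (dconv u chi) psi = u (rconv psi chi).
Proof.
move=> tc tp; have [rho rho0 pr] := test_radius tp.
have ip := test_cintegrable tp.
have [c [m [c0 h]]] := dconv_modulus_of_continuity rho tc.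
have cd := dconv_ccontinuous tc.
have [MD MD0 hMD] := continuous_compact_bound (@compact_norm_le R d rho) cd.
pose S := (\int[mu]_x cn (psi x))%R.
have S0 : 0 <= S by apply: Rintegral_ge0 => x _; exact: cn_ge0.
suff key (e : R) : 0 < e -> cn (cint mu (fun x => psi x * dconv u chi x) - u (rconv psi chi))
    <= c * (e * S) + c * (e * S).
  apply/eqP; rewrite -subr_eq0; apply/eqP/cn_le_all => e e0.
  have cS : 0 < c * S + c * S + 1 by rewrite ltr_wpDl// addr_ge0 ?mulr_ge0// ltW.
  have := key _ (divr_gt0 e0 cS).
  rewrite /dist_of (_ : (fun x => _) = (fun x => psi x * dconv u chi x)); last first.
    by apply/funext => x; rewrite mulrC.
  move/le_trans; apply.
  rewrite (_ : _ + _ = e * ((c * S + c * S) / (c * S + c * S + 1))); last first.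
    by field; rewrite gt_eqF.
  by rewrite ler_piMr ?ltW// ltr_pdivrMr// mul1r ltrDl.
move=> e0; have [r r0 hr] := test_equicontinuous m tc e0.
have [h1 h2] := h _ _ e0 hr.
have [xs xsr xcov] := norm_ball_cover rho r0.
pose k (A : set Rd) x : R[i] := (\1_A x)%:C%C * psi x.
have kin A x : A x -> k A x = psi x.
  by move=> Ax; rewrite /k indicE mem_set// mul1r.
have kout A x : ~ A x -> k A x = 0.
  by move=> Ax; rewrite /k indicE memNset// mul0r.
have ik A : measurable A -> cintegrable mu (k A).
  move=> mA; apply: (@cintegrable_le _ _ _ _ _ (fun x => cn (psi x))).
  - apply: cmeasurableM; last by case: ip.
    by apply: cmeasurable_real; exact: measurable_indic.
  - by case: ip.
  - move=> x; have [/kin ->//|/kout ->] := pselect (A x).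
    by rewrite cn0 cn_ge0.
have ikd A : measurable A -> cintegrable mu (fun x => k A x * dconv u chi x).
  move=> mA; apply: (@cintegrableM_bounded _ _ _ _ _ _ MD).
  - exact: ik.
  - exact: ccontinuous_cmeasurable.
  - move=> x kx; apply: hMD => /=; rewrite leNgt; apply/negP => /pr px.
    by move: kx; rewrite /k px mulr0 eqxx.
have kr A x : rho < `|x| -> k A x = 0 by move=> /pr px; rewrite /k px mulr0.
(* Induction on the centres not yet used; each step splits off the part of [A] in the ball about
   [x0]. The bound is proportional to the mass of [psi] on [A], hence additive over the pieces, and
   does not grow with their number. *)
suff claim (ys : seq Rd) (A : set Rd) : measurable A -> {subset ys <= xs} ->
    (forall x, A x -> `|x| <= rho -> exists2 x0, x0 \in ys & `|x0 - x| < r) ->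
    cn (cint mu (fun x => k A x * dconv u chi x) - u (rconv (k A) chi)) <=
    c * (e * (\int[mu]_x cn (k A x))%R) + c * (e * (\int[mu]_x cn (k A x))%R).
  have kT : k setT = psi by apply/funext => x; rewrite kin.
  by have := claim xs setT measurableT (fun=> id) (fun x _ => xcov x); rewrite kT.
elim: ys A => [|x0 ys IH] A mA ysxs Ay.
  have k0 : k A = fun=> 0.
    apply/funext => x; have [xr|/kr//] := leP `|x| rho.
    by apply: kout => Ax; have [] := Ay x Ax xr.
  rewrite k0 /rconv; under eq_fun do rewrite mul0r.
  under [X in u X]eq_fun do under eq_fun do rewrite mul0r.
  under [X in u X]eq_fun do rewrite cint0.
  rewrite dist0 cint0 subrr cn0.
  by apply: addr_ge0; (do 2 (apply: mulr_ge0; first exact: ltW));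
    apply: Rintegral_ge0 => x _.
pose B := A `&` ball x0 r; pose A' := A `\` ball x0 r.
have mb : measurable (ball x0 r) by apply: open_rV_measurable; exact: ball_open.
have mB : measurable B by exact: measurableI.
have mA' : measurable A' by exact: measurableD.
have kE x : k A x = k B x + k A' x.
  have [Ax|nAx] := pselect (A x); last first.
    by rewrite !kout ?addr0// => -[].
  have [bx|nbx] := pselect (ball x0 r x).
    by rewrite [k A' x]kout ?addr0 ?kin// => -[].
  by rewrite [k B x]kout ?add0r ?kin// => -[].
have cnE x : cn (k A x) = cn (k B x) + cn (k A' x).
  rewrite kE; have [[Ax bx]|nB] := pselect (B x).
    by rewrite [k A' x]kout ?addr0 ?cn0 ?addr0// => -[].
  by rewrite [k B x]kout// !add0r cn0 add0r.
have SE : (\int[mu]_x cn (k A x))%R =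
    (\int[mu]_x cn (k B x))%R + (\int[mu]_x cn (k A' x))%R.
  rewrite -RintegralD//; first by apply: eq_Rintegral => x _; exact: cnE.
  - by case: (ik _ mB).
  - by case: (ik _ mA').
have x0xs : x0 \in xs by apply: ysxs; rewrite mem_head.
have IH' : cn (cint mu (fun x => k A' x * dconv u chi x) - u (rconv (k A') chi)) <=
    c * (e * (\int[mu]_x cn (k A' x))%R) + c * (e * (\int[mu]_x cn (k A' x))%R).
  apply: IH => //; first by move=> x xys; apply: ysxs; rewrite inE xys orbT.
  move=> x [Ax nbx] xr; have [x1] := Ay x Ax xr.
  rewrite inE => /predU1P[->|x1ys] xx1; last by exists x1.
  by exfalso; apply: nbx; apply/rV_ballE.
have kB x : k B x != 0 -> `|x| <= rho /\ `|x0 - x| < r.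
  move=> kx; split.
    by rewrite leNgt; apply/negP => /kr kx0; move: kx; rewrite kx0 eqxx.
  apply: contrapT => nx; move/eqP: kx; apply; apply: kout => -[_ /rV_ballE].
  exact: nx.
have bB := h2 (k B) x0 (ik _ mB) (xsr _ x0xs) kB.
have bB' : cn (cint mu (fun x => k B x * dconv u chi x) - cint mu (k B) * dconv u chi x0) <=
    c * (e * (\int[mu]_x cn (k B x))%R).
  have ikB := ik _ mB; have ikdB := ikd _ mB.
  rewrite [cint mu (k B) * _]mulrC -cintZ// -cintB//; last exact: cintegrableZ.
  have E : (fun x => k B x * dconv u chi x - dconv u chi x0 * k B x) =
      (fun x => k B x * (dconv u chi x - dconv u chi x0)).
    by apply/funext => x; rewrite mulrBr [X in _ - X]mulrC.
  have iE := cintegrableB ikdB (cintegrableZ (dconv u chi x0) ikB).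
  rewrite E in iE *; rewrite mulrA; apply: cint_mul_bound => //.
  by move=> x /kB [xr xx0]; apply: h1 => //; exact: xsr.
have rE : rconv (k A) chi = fun y => rconv (k B) chi y + rconv (k A') chi y.
  apply/funext => y; rewrite /rconv -cintD.
  - by congr cint; apply/funext => x; rewrite kE mulrDl.
  - exact: rconv_integrable (ik _ mB) tc.
  - exact: rconv_integrable (ik _ mA') tc.
rewrite rE distD; last 2 first.
- exact: test_rconv (ik _ mB) (kr B) tc.
- exact: test_rconv (ik _ mA') (kr A') tc.
have -> : cint mu (fun x => k A x * dconv u chi x) =
    cint mu (fun x => k B x * dconv u chi x) + cint mu (fun x => k A' x * dconv u chi x).
  rewrite -cintD; [|exact: ikd|exact: ikd].
  by congr cint; apply/funext => x; rewrite kE mulrDl.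
rewrite SE !mulrDr.
set a1 := cint mu _ in bB' *; set a2 := cint mu (fun x => k A' x * _) in IH' *.
set a3 := u _ in bB *; set a4 := u _ in IH' *; set b := _ * dconv u chi x0 in bB bB'.
(* Both terms of the piece are compared with [b], its mass times the value at the centre; this
   accounts for the two equal summands in the bound. *)
have -> : a1 + a2 - (a3 + a4) = (a1 - b) + (b - a3) + (a2 - a4) by ring.
apply: le_trans (cnD _ _) _; apply: le_trans (lerD (cnD _ _) IH') _.
rewrite [cn (b - a3)]cnC; move: bB bB'; lra.
Qed.

End fixed_distribution.

End distributions.

(** * Uniqueness of densities *)

Section vanishing_integrals.
Variables (R : realType) (d : nat).
Local Notation Rd := 'rV[R]_d.
Local Notation mu := (lebesgue_rV R d).

(** Dominated convergence for sequences that are, at each point, eventually equal to their limit. *)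
Lemma Rintegral_eventually0 (F : nat -> Rd -> R) (G h : Rd -> R) :
  (forall n, measurable_fun setT (F n)) -> measurable_fun setT G ->
  mu.-integrable setT (EFin \o h) -> (forall n x, `|F n x| <= h x) ->
  (forall x, exists N, forall n, (N <= n)%N -> F n x = G x) ->
  (forall n, (\int[mu]_x F n x)%R = 0) -> (\int[mu]_x G x)%R = 0.
Proof.
move=> mF mG ih Fh FG F0.
have iF n : mu.-integrable setT (EFin \o F n).
  apply: le_integrable ih => //; first exact/measurable_EFinP.
  by move=> x _; rewrite lee_fin; exact: le_trans (Fh n x) (ler_norm _).
have := @dominated_cvg _ _ R mu setT measurableT (fun n => EFin \o F n) (EFin \o G)
  (EFin \o h) (fun n => (measurable_EFinP _ _).2 (mF n)).
have z n : (\int[mu]_x (EFin \o F n) x)%E = 0%E.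
  by rewrite -(fineK (integrable_fin_num measurableT (iF n))); congr EFin; exact: F0.
under eq_fun do rewrite z.
move=> dc; rewrite /Rintegral.
suff -> : (\int[mu]_x (EFin \o G) x)%E = 0%E by [].
apply/esym; apply: (@cvg_unique _ (@ereal_hausdorff R) ((fun=> 0%E) @ \oo)); last first.
  apply: dc => // [x _|n x _]; last by rewrite lee_fin.
  have [N hN] := FG x; apply: cvg_near_cst.
  by exists N => // n /= Nn; rewrite hN.
exact: cvg_cst.
Qed.

Lemma cint_eventually0 (F : nat -> Rd -> R[i]) (G : Rd -> R[i]) (h : Rd -> R) :
  (forall n, cmeasurable (F n)) -> cmeasurable G ->
  mu.-integrable setT (EFin \o h) -> (forall n x, cn (F n x) <= h x) ->
  (forall x, exists N, forall n, (N <= n)%N -> F n x = G x) ->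
  (forall n, cint mu (F n) = 0) -> cint mu G = 0.
Proof.
move=> mF [mG1 mG2] ih Fh FG F0; apply: complex_ext => /=.
  apply: (@Rintegral_eventually0 (fun n x => Re (F n x)) _ h) => //.
  - by move=> n; case: (mF n).
  - by move=> n x; apply: le_trans (cn_Re _) (Fh n x).
  - by move=> x; have [N hN] := FG x; exists N => n /hN ->.
  - by move=> n; rewrite -Re_cint F0.
apply: (@Rintegral_eventually0 (fun n x => Im (F n x)) _ h) => //.
- by move=> n; case: (mF n).
- by move=> n x; apply: le_trans (cn_Im _) (Fh n x).
- by move=> x; have [N hN] := FG x; exists N => n /hN ->.
- by move=> n; rewrite -Im_cint F0.
Qed.

(** The Borel sets over which [h] has integral zero form a lambda-system, complements being covered
    because the whole space is open; Dynkin's lemma extends the hypothesis from open sets to all of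
    them. *)
Lemma ae_eq0_open (h : Rd -> R) : mu.-integrable setT (EFin \o h) ->
  (forall A : set Rd, open A -> (\int[mu]_(x in A) (h x)%:E = 0)%E) ->
  {ae mu, forall x, h x = 0}.
Proof.
move=> ih hA.
have iS A : measurable A -> mu.-integrable A (EFin \o h).
  by move=> mA; exact: integrableS ih.
suff key A : measurable A -> (\int[mu]_(x in A) (EFin \o h) x = 0)%E.
  have := @integral_ae_eq _ _ R mu setT measurableT (cst 0%E) (EFin \o h) ih
    (measurable_cst _) _.
  move=> /(_ (fun E _ mE => etrans (key E mE) (esym (integral0 _ _)))).
  by apply: filterS => x /(_ I) [].
rewrite measurable_rV_open.
apply: (@dynkin_induction _ _ _ (fun B => (\int[mu]_(x in B) (EFin \o h) x = 0)%E)
  (measurable_rV_open R d)) => /=.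
- by move=> B C oB oC; exact: openI.
- by apply: hA; exact: openT.
- by move=> B oB; exact: hA.
- move=> S mS S0; have mh : measurable_fun (S `|` ~` S) h.
    by rewrite setUv; apply/measurable_EFinP; exact: measurable_int ih.
  have dS : [disjoint S & ~` S] by apply/disj_set2P; rewrite setICr.
  have := integral_setU_EFin mu mS (measurableC mS) mh dS.
  rewrite setUv => h'; have : (\int[mu]_x (h x)%:E = 0)%E by apply: hA; exact: openT.
  by rewrite h' [X in (X + _)%E]S0 add0e.
- move=> F mF tF F0; rewrite integral_bigcup//; last first.
    by apply: iS; exact: bigcupT_measurable.
  by rewrite eseries0// => i _ _; exact: F0.
Qed.

End vanishing_integrals.

(** * Regular distributions and derivatives of convolutions *)

Section regular_distributions.
Variables (R : realType) (d : nat).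
Local Notation Rd := 'rV[R]_d.
Local Notation mu := (lebesgue_rV R d).
Local Notation dconv := (@dist_convolution R d).
Implicit Types (f g chi psi phi : Rd -> R[i]) (s : seq 'I_d) (x y : Rd) (u : functional R d).

Lemma ccontinuous_L1loc g : ccontinuous g -> L1loc g.
Proof.
move=> cg K cK; split.
  exact: cmeasurable_clebesgue (ccontinuous_cmeasurable cg) (aeW _ (fun=> erefl)).
have [M M0 gM] := continuous_compact_bound cK cg.
apply: (@le_lt_trans _ _ (\int[mu]_(x in K) (cst M%:E) x)%E).
  have mK := compact_rV_measurable cK.
  apply: ge0_le_integral => //.
  - by move=> x _; rewrite lee_fin cn_ge0.
  - apply: measurable_funS (_ : measurable_fun setT _) => //.
    exact/measurable_EFinP/cmeasurable_cn/ccontinuous_cmeasurable.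
rewrite integral_cst; last exact: compact_rV_measurable.
by rewrite lte_mul_pinfty ?lee_fin ?ltW//; exact: compact_rV_finite.
Qed.

Lemma dist_of_ae f g : ae_equal f g -> dist_of f = dist_of g.
Proof.
by move=> fg; apply/funext => psi; apply: ae_eq_cint; apply: filterS fg => x ->.
Qed.

Lemma cintegrable_L1loc_test g psi : cmeasurable g -> L1loc g -> test_function psi ->
  cintegrable mu (fun x => g x * psi x).
Proof.
move=> mg gl tp; have [_ [K cK pK]] := tp; have [M M0 pM] := test_bound tp.
apply: cintegrable_mul_L1loc cK pK pM => //.
exact/ccontinuous_cmeasurable/test_ccontinuous.
Qed.

Lemma dist_of_distribution g : L1loc g -> is_distribution (dist_of g).
Proof.
move=> /L1loc_borel [g0 [mg /dist_of_ae -> gl]]; split => [c f h tf th|K cK].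
  have i1 := cintegrable_L1loc_test mg gl tf; have i2 := cintegrable_L1loc_test mg gl th.
  rewrite -[RHS]/(c * cint mu _ + cint mu _) -cintZ// -cintD//; last exact: cintegrableZ.
  by congr cint; apply/funext => x; ring.
pose k x : R[i] := (\1_K x)%:C%C * g0 x.
have ik : cintegrable mu k := integrable_on_cmeasurable mg cK (gl K cK).
(* Order 0 suffices, with the L1 norm of the function on [K] as constant. *)
exists (\int[mu]_x cn (k x))%R, 0%N => f M tf fK fM.
have fM' x : cn (f x) <= M.
  have := fM (fun=> 0%N) x; rewrite /modulus partialsE.
  have -> : mi_seq (fun=> 0%N) = [::] :> seq 'I_d.
    by apply/nilP; rewrite /nilp size_mi_seq /mi_order big1.
  by apply; rewrite /mi_order big1.
have -> : dist_of g0 f = cint mu (fun x => k x * f x).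
  congr cint; apply/funext => x; rewrite /k.
  have [Kx|/fK ->] := pselect (K x); last by rewrite !mulr0.
  by rewrite indicE mem_set// mul1r.
rewrite mulrC; apply: cint_mul_bound => //.
exact: cintegrable_mul_test.
Qed.

Lemma dderiv_add (a b : multi_index d) u psi : test_function psi ->
  dderiv b (dderiv a u) psi = dderiv (mi_add a b) u psi.
Proof.
move=> tp; rewrite /dderiv partials_add; last by case: tp.
by rewrite mulrA -exprD mi_order_add addnC.
Qed.

Lemma dderiv_unit i u psi : test_function psi ->
  dderiv (mi_unit i) u psi = - u (partial i psi).
Proof.
move=> tp; rewrite /dderiv mi_order_unit partials_unit; last by case: tp.
by rewrite expr1 mulN1r.
Qed.

Lemma eq_dconv u v chi : test_function chi ->
  (forall psi, test_function psi -> u psi = v psi) -> dconv u chi = dconv v chi.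
Proof.
move=> tc uv; apply/funext => x; apply: uv.
by case: (test_reflect x tc).
Qed.

Lemma dist_of_dconv_distribution u chi : is_distribution u -> test_function chi ->
  is_distribution (dist_of (dconv u chi)).
Proof.
by move=> du tc; apply/dist_of_distribution/ccontinuous_L1loc; exact: dconv_ccontinuous.
Qed.

Lemma dist_of_dconv_corr u chi psi : is_distribution u -> test_function chi ->
  test_function psi -> dist_of (dconv u chi) psi = u (corr chi psi).
Proof. by move=> du tc tp; rewrite dist_of_dconv// rconv_corr. Qed.

(** Both sides move the derivative onto the test function with the same sign, and correlation with
    [chi] commutes with derivatives. *)
Lemma dderiv_dconv (a : multi_index d) u chi : is_distribution u -> test_function chi ->
  represents (dconv (dderiv a u) chi) (dderiv a (dist_of (dconv u chi))).
Proof.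
move=> du tc; have dd := dderiv_distribution du a; split.
  exact/ccontinuous_L1loc/dconv_ccontinuous.
move=> psi tp; rewrite dist_of_dconv_corr// /dderiv dist_of_dconv_corr//; last first.
  exact: test_function_partials.
by rewrite !partialsE diffs_corr//; exact: test_cintegrable.
Qed.

Lemma dconv_comm u chi1 chi2 : is_distribution u -> test_function chi1 ->
  test_function chi2 ->
  dconv (dist_of (dconv u chi1)) chi2 = dconv (dist_of (dconv u chi2)) chi1.
Proof.
move=> du t1 t2; apply/funext => x; rewrite {1 3}/dist_convolution.
have [r1 _] := test_reflect x t1; have [r2 _] := test_reflect x t2.
rewrite !dist_of_dconv//; congr u; apply/funext => y; exact: rconv_reflect.
Qed.

(** The derivative passes from the kernel to the distribution; the sign from reflecting [eta]
    cancels the one in [dderiv]. This is how a derivative of a kernel is traded for a derivative of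
    [u]. *)
Lemma dconv_partial u chi eta i : is_distribution u -> test_function chi ->
  test_function eta ->
  dconv (dist_of (dconv u chi)) (partial i eta) =
  dconv (dist_of (dconv (dderiv (mi_unit i) u) chi)) eta.
Proof.
move=> du tc te; apply/funext => x; rewrite {1 3}/dist_convolution.
have dd := dderiv_distribution du (mi_unit i).
have [r1 e1] := test_reflect x te.
rewrite [RHS]dist_of_dconv_corr// dderiv_unit; last exact: test_corr.
have := e1 [:: i]; rewrite /= expr1 => e2.
have -> : (fun y => partial i eta (x - y)) = (fun y => - partial i (fun y => eta (x - y)) y).
  by rewrite e2; apply/funext => y; rewrite mulN1r opprK.
rewrite (distN (dist_of_dconv_distribution du tc)); last exact: test_function_partial.
rewrite dist_of_dconv_corr//; last exact: test_function_partial.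
by have /= -> := diffs_corr [:: i] (test_cintegrable tc) r1.
Qed.

End regular_distributions.

(** * Mollification *)

Section mollification.
Variables (R : realType) (d : nat).
Local Notation Rd := 'rV[R]_d.
Local Notation mu := (lebesgue_rV R d).
Local Notation dconv := (@dist_convolution R d).
Variable phi : Rd -> R[i].
Hypothesis tphi : test_function phi.

Let P := (\int[mu]_x cn (phi x))%R.
Let c := cint mu phi.

Let P_ge0 : 0 <= P.
Proof. by apply: Rintegral_ge0 => x _; exact: cn_ge0. Qed.

Lemma Rintegral_cn_dilation j : (\int[mu]_x cn (dilation phi j x))%R = P.
Proof. exact: L1norm_dilation (test_cintegrable tphi). Qed.

Lemma dilation_eventually_small (r : R) : 0 < r ->
  exists j0, forall j, (j0 <= j)%N -> forall x, r <= `|x| -> dilation phi j x = 0.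
Proof.
move=> r0; have [q q0 hq] := test_radius tphi.
(* [2 ^ j0 > j0 > q / r] brings the support radius [q / 2 ^ j] below [r] for all later [j]. *)
pose j0 := (Num.truncn (q / r)).+1.
exists j0 => j jj x rx; apply: (dilation_radius hq q0).
apply: lt_le_trans rx; rewrite ltr_pdivrMr ?exprn_gt0// mulrC -ltr_pdivrMr//.
apply: (lt_trans (truncnS_gt _)); rewrite -/j0.
apply: (@lt_le_trans _ _ (2 ^+ j0)); last by rewrite ler_weXn2l// ler1n.
by rewrite -natrX ltr_nat ltn_expl.
Qed.

Lemma corr_bound k (h : Rd -> R[i]) (M : R) : cintegrable mu k -> test_function h ->
  (forall x, cn (h x) <= M) -> forall y, cn (corr k h y) <= M * (\int[mu]_x cn (k x))%R.
Proof. by move=> ik th hM y; apply: cint_mul_bound => //; exact: corr_integrable. Qed.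

(** Dilation preserves the integral, so [c * h y] is the integral of [phi_j] times the constant
    [h y]; only the oscillation of [h] on the small support of [phi_j] remains. *)
Lemma corr_dilation_close (h : Rd -> R[i]) (e r : R) j : test_function h ->
  (forall x y, `|y| < r -> cn (h (x + y) - h x) <= e) ->
  (forall x, r <= `|x| -> dilation phi j x = 0) ->
  forall y, cn (corr (dilation phi j) h y - c * h y) <= e * P.
Proof.
move=> th he hj y; have td := (test_dilation j tphi).1; have id := test_cintegrable td.
rewrite /c -(cint_dilation j (test_cintegrable tphi)) [_ * h y]mulrC -cintZ// -cintB; last 2 first.
- exact: corr_integrable.
- exact: cintegrableZ.
have E : (fun x => dilation phi j x * h (y + x) - h y * dilation phi j x) =
    (fun x => dilation phi j x * (h (y + x) - h y)).
  by apply/funext => x; rewrite mulrBr [h y * _]mulrC.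
have iE := cintegrableB (corr_integrable y id th) (cintegrableZ (h y) id).
rewrite E in iE *; rewrite -(Rintegral_cn_dilation j).
apply: cint_mul_bound => // x dx; apply: he; rewrite ltNge; apply/negP => /hj x0.
by move: dx; rewrite x0 eqxx.
Qed.

(** After transposing twice, [u] is applied to two successive correlations of [psi] with [phi_j].
    These tend to [c ^ 2 * psi] together with the derivatives up to the order of [u], with supports
    in a fixed ball. *)
Lemma double_mollification_cvg u psi : is_distribution u -> test_function psi ->
  forall e : R, 0 < e -> exists j0, forall j, (j0 <= j)%N ->
  cn (dist_of (dconv (dist_of (dconv u (dilation phi j))) (dilation phi j)) psi -
      c ^+ 2 * u psi) <= e.
Proof.
move=> du tp e e0.
have [q q0 hq] := test_radius tphi; have [rho rho0 pr] := test_radius tp.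
have [C [m [C0 hC]]] := dist_bound du (q + (q + rho)).
(* Each correlation has error proportional to [P]. The inner error passes through the outer
   correlation, giving [P * P]; the outer one is multiplied by [c]. The 1 makes [B] positive. *)
pose B := C * (P * P + cn c * P) + 1.
have B0 : 0 < B.
  rewrite ltr_wpDl//; apply: mulr_ge0; first exact: ltW.
  by apply: addr_ge0; apply: mulr_ge0 => //; exact: cn_ge0.
have [r r0 hr] := test_equicontinuous m tp (divr_gt0 e0 B0).
have [j0 hj0] := dilation_eventually_small r0.
exists j0 => j jj; pose phij := dilation phi j.
have tj : test_function phij := (test_dilation j tphi).1.
have ij := test_cintegrable tj.
have t1 := test_corr tj tp; have t2 := test_corr tj t1.
have tz := test_functionZ (c ^+ 2) tp.
rewrite dist_of_dconv_corr//; last exact: dist_of_dconv_distribution.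
rewrite dist_of_dconv_corr// -distZ// -distB//.
have qj x : q < `|x| -> phij x = 0.
  move=> qx; apply: (dilation_radius hq q0); apply: le_lt_trans qx.
  rewrite ler_pdivrMr ?exprn_gt0//; apply: ler_peMr; first exact: ltW.
  by apply: exprn_ege1; rewrite ler1n.
have cr k (M : R) : (forall x, M < `|x| -> k x = 0) -> test_function k ->
    forall x, q + M < `|x| -> corr phij k x = 0.
  move=> kM tk x xM; rewrite -rconv_corr//.
  by apply: (rconv_radius kM qj); rewrite addrC.
apply: (@le_trans _ _ (C * (e / B * (P * P + cn c * P)))); last first.
  have -> : C * (e / B * (P * P + cn c * P)) = e * ((B - 1) / B).
    by rewrite /B addrK; field; rewrite gt_eqF.
  by rewrite ler_piMr ?ltW// ltr_pdivrMr// mul1r gtrBl.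
apply: hC; first exact: test_functionB.
  move=> x xr; rewrite (cr _ (q + rho))// ?pr ?mulr0 ?subrr//.
    by move: q0 xr; lra.
  exact: cr.
move=> s x sm; have tps := test_function_diffs s tp.
have t1s := test_corr tj tps.
rewrite diffsB; [|by case: t2|by case: tz].
rewrite diffsZ; last by case: tp.
rewrite diffs_corr// diffs_corr//.
set h := diffs s psi in tps t1s *.
have close := corr_dilation_close tps (fun x y => hr s x y sm) (hj0 j jj).
have E : corr phij (corr phij h) x - c ^+ 2 * h x =
   corr phij (fun y => corr phij h y - c * h y) x + c * (corr phij h x - c * h x).
  have tch := test_functionZ c tps.
  have -> : corr phij (fun y => corr phij h y - c * h y) x =
      corr phij (corr phij h) x - c * corr phij h x.
    have i1 := corr_integrable x ij tps; have i2 := corr_integrable x ij t1s.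
    rewrite [in RHS]/corr -(cintZ c i1) -(cintB i2 (cintegrableZ c i1)).
    by congr cint; apply/funext => z; rewrite /corr; ring.
  by ring.
rewrite E; apply: le_trans (cnD _ _) _; rewrite [leRHS]mulrDr; apply: lerD.
  rewrite mulrA -(Rintegral_cn_dilation j).
  apply: corr_bound => //; first exact: test_functionB (test_functionZ c tps).
  by rewrite Rintegral_cn_dilation.
by rewrite cnM mulrCA ler_wpM2l// cn_ge0.
Qed.

End mollification.

(** * The lemma of du Bois-Reymond *)

Section du_bois_reymond.
Variables (R : realType) (d : nat).
Local Notation Rd := 'rV[R]_d.
Local Notation mu := (lebesgue_rV R d).
Variable phi : Rd -> R[i].
Hypotheses (tphi : test_function phi) (phi_neq0 : cint mu phi <> 0).

Let P := (\int[mu]_x cn (phi x))%R.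
Let c := cint mu phi.

Lemma rconv_shift k chi y : cintegrable mu k -> test_function chi ->
  rconv k chi y = cint mu (fun z => chi z * k (y + z)).
Proof.
move=> ik tc; rewrite /rconv -(cint_add y (rconv_integrable y ik tc)).
by congr cint; apply/funext => z; rewrite [y + z - y]addrC addKr mulrC.
Qed.

Lemma cintegrable_shift (k : Rd -> R[i]) y : cintegrable mu k ->
  cintegrable mu (fun z => k (y + z)).
Proof.
move=> ik; under eq_fun do rewrite addl_diag_affine.
by apply: cintegrable_diag_affine => // i; rewrite oner_eq0.
Qed.

(* Test functions in [A] approximating [\1_A]: mollifications of the indicator of
   the points of [A] at distance at least [r / 2 ^ j] from the complement. *)
Lemma cint_open_eq0 (g : Rd -> R[i]) (A : set Rd) (N : R) :
  cmeasurable g -> L1loc g -> (forall psi, test_function psi -> dist_of g psi = 0) ->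
  open A -> (forall x, A x -> `|x| <= N) -> cint mu (fun x => (\1_A x)%:C%C * g x) = 0.
Proof.
move=> mg gl g0 oA AN.
have mA := open_rV_measurable oA.
have [q q0 hq] := test_radius tphi.
(* Twice the support radius of [phi_j], so that [phi_j] vanishes also where [|z|] equals [r j]. *)
pose r (j : nat) := 2 * q / 2 ^+ j.
have r0 j : 0 < r j by rewrite divr_gt0 ?exprn_gt0// mulr_gt0.
have phij j z : r j <= `|z| -> dilation phi j z = 0.
  move=> rz; apply: (dilation_radius hq q0); apply: lt_le_trans rz.
  by rewrite /r ltr_pM2r ?invr_gt0 ?exprn_gt0// ltr_pMl// ltr1n.
pose B j := [set x | forall y, `|y| < r j -> A (x + y)].
have BA j x : B j x -> A x.
  by move=> /(_ 0); rewrite normr0 addr0; apply.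
have mB j : measurable (B j).
  apply: closed_rV_measurable; rewrite -[B j]setCK; apply: open_closedC.
  rewrite openE => x /= /existsNP[y /not_implyP[yr nA]].
  apply/nbhs_ballP; exists (r j - `|y|); first by rewrite /= subr_gt0.
  move=> x' /rV_ballE xx' hB; apply: nA.
  have -> : x + y = x' + (x - x' + y) by rewrite addrA subrKC.
  apply: hB; apply: le_lt_trans (ler_normD _ _) _.
  by rewrite -ltrBrDr.
pose k j x : R[i] := (\1_(B j) x)%:C%C.
have kle j x : cn (k j x) <= 1.
  by rewrite /k cn_real indicE; case: (x \in _); rewrite ?normr1 ?normr0.
have kout j x : ~ A x -> k j x = 0.
  by move=> nA; rewrite /k indicE memNset// => /BA.
have ik j : cintegrable mu (k j).
  apply: (@cintegrable_bounded_compact _ _ _ [set x | `|x| <= N] 1) => //.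
  - by apply: cmeasurable_real; exact: measurable_indic.
  - exact: compact_norm_le.
  - by move=> x /= xN; apply: kout => /AN.
have kN j x : N < `|x| -> k j x = 0.
  by move=> xN; apply: kout => /AN; rewrite leNgt xN.
pose h j := rconv (k j) (dilation phi j).
have td j := (test_dilation j tphi).1.
have th j : test_function (h j) by exact: test_rconv (ik j) (kN j) (td j).
have hE j y : h j y = cint mu (fun z => dilation phi j z * k j (y + z)).
  exact: rconv_shift.
have hP j y : cn (h j y) <= P.
  rewrite hE /P -(Rintegral_cn_dilation tphi j) -[leRHS]mul1r.
  have id := test_cintegrable (td j).
  apply: cint_mul_bound => //.
  apply: (@cintegrableM_bounded _ _ _ _ _ _ 1) => //.
  by have [] := cintegrable_shift y (ik j).
have hout j y : ~ A y -> h j y = 0.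
  move=> nA; rewrite hE -(cint0 mu); congr cint; apply/funext => z.
  have [zr|/phij ->] := ltP `|z| (r j); last by rewrite mul0r.
  rewrite /k indicE memNset ?mulr0// => /(_ (- z)); rewrite normrN => /(_ zr).
  by rewrite addrK.
have hin y : A y -> exists N0, forall j, (N0 <= j)%N -> h j y = c.
  move=> Ay; have /nbhs_ballP[e /= e0 yA] : nbhs y A by move: oA; rewrite openE; apply.
  pose N0 := (Num.truncn (4 * q / e)).+1.
  exists N0 => j Nj.
  (* For [h j y = c] every [y + z] with [|z| < r j] should lie in [B j]; it suffices that [A]
     contains the ball of radius [2 * r j] about [y]. *)
  have rj : r j + r j <= e.
    have -> : r j + r j = 4 * q / 2 ^+ j by rewrite /r; field; rewrite expf_neq0.
    rewrite ler_pdivrMr ?exprn_gt0// [leRHS]mulrC -ler_pdivrMr//.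
    apply/ltW/(lt_trans (truncnS_gt _)); rewrite -/N0.
    apply: (@lt_le_trans _ _ (2 ^+ N0 : R)); last by apply: ler_weXn2l => //; rewrite ler1n.
    by rewrite -natrX ltr_nat ltn_expl.
  rewrite hE /c -(cint_dilation j (test_cintegrable tphi)); congr cint; apply/funext => z.
  have [zr|/phij ->] := ltP `|z| (r j); last by rewrite mul0r.
  rewrite /k indicE mem_set ?mulr1// => y' yr'.
  apply: yA; apply/rV_ballE; rewrite -addrA opprD addNKr normrN.
  apply: le_lt_trans (ler_normD _ _) _; apply: lt_le_trans rj; exact: ltrD.
have cN := @compact_norm_le R d N.
pose G x := (\1_A x)%:C%C * g x.
have iG : cintegrable mu (fun x => (\1_[set x | `|x| <= N] x)%:C%C * g x).
  exact: integrable_on_cmeasurable mg cN (gl _ cN).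
(* The functions [h j] are eventually [c] at each point of [A] and vanish elsewhere; being bounded
   by [P], they give an integrable majorant on the ball of radius [N]. *)
have G0 : cint mu (fun x => c * G x) = 0.
  apply: (@cint_eventually0 _ _ (fun j x => g x * h j x) _
    (fun x => P * cn ((\1_[set x | `|x| <= N] x)%:C%C * g x))).
  - move=> j; apply: cmeasurableM => //.
    exact/ccontinuous_cmeasurable/test_ccontinuous.
  - apply: cmeasurableM; first exact: cmeasurable_cst.
    apply: cmeasurableM => //; apply: cmeasurable_real; exact: measurable_indic.
  - by case: iG => _ iG; exact: (@integrableZl _ _ _ mu _ measurableT P _ iG).
  - move=> j x; have [Ax|nA] := pselect (A x); last first.
      rewrite hout// mulr0 cn0 mulr_ge0 ?cn_ge0//.
      by apply: Rintegral_ge0 => y _; exact: cn_ge0.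
    rewrite indicE mem_set /=; last exact: AN.
    by rewrite mul1r cnM mulrC ler_wpM2r// cn_ge0.
  - move=> x; have [Ax|nA] := pselect (A x).
      have [N0 hN] := hin x Ax; exists N0 => j /hN ->.
      by rewrite /G indicE mem_set// mul1r mulrC.
    exists 0%N => j _; rewrite hout// mulr0 /G indicE memNset//.
    by rewrite mul0r mulr0.
  - by move=> j; exact: g0 (th j).
have iG' : cintegrable mu G.
  case: iG => [mG iG]; apply: cintegrable_le iG _.
    apply: cmeasurableM => //; apply: cmeasurable_real; exact: measurable_indic.
  move=> x; rewrite /G !cnM ler_wpM2r ?cn_ge0// !cn_real !indicE.
  have [/set_mem Ax|_] := boolP (x \in A); last by rewrite normr0.
  by rewrite mem_set//=; exact: AN.
move: G0; rewrite cintZ// => /eqP; rewrite mulf_eq0 => /orP[/eqP//|/eqP//].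
Qed.

(** Cutting off to the balls [O n] makes the function integrable. The integrals of the cut-off
    function over open sets vanish because [A] intersected with [O n] is open and bounded, and
    [ae_eq0_open] applies to its real and imaginary parts. *)
Lemma du_bois_reymond (g : Rd -> R[i]) : L1loc g ->
  (forall psi, test_function psi -> dist_of g psi = 0) -> ae_equal g (fun=> 0).
Proof.
move=> /L1loc_borel[g0 [mg gg0 gl]] hg.
suff : ae_equal g0 (fun=> 0) by exact: ae_equal_trans.
have {}hg psi : test_function psi -> dist_of g0 psi = 0.
  by move=> /hg; rewrite (dist_of_ae gg0).
pose O (n : nat) : set Rd := ball 0 n.+1%:R.
have oO n : open (O n) by exact: ball_open.
have On n x : O n x -> `|x| <= n.+1%:R.
  by move=> /rV_ballE; rewrite sub0r normrN => /ltW.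
pose H n x : R[i] := (\1_(O n) x)%:C%C * g0 x.
have iH n : cintegrable mu (H n).
  have cN := @compact_norm_le R d n.+1%:R.
  have [_ iG] := integrable_on_cmeasurable mg cN (gl _ cN).
  apply: cintegrable_le iG _.
    apply: cmeasurableM => //; apply: cmeasurable_real; apply: measurable_indic.
    exact: open_rV_measurable.
  move=> x; rewrite /H !cnM ler_wpM2r ?cn_ge0// !cn_real !indicE.
  have [/set_mem Ax|_] := boolP (x \in O n); last by rewrite normr0.
  by rewrite mem_set//=; exact: On.
have H0 n A : open A -> cint mu (fun x => (\1_A x)%:C%C * H n x) = 0.
  move=> oA; rewrite -(cint_open_eq0 mg gl hg (openI oA (oO n)) (N := n.+1%:R)).
    by congr cint; apply/funext => x; rewrite /H mulrA -(rmorphM (real_complex R))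
      (@indicI _ R A (O n)).
  by move=> x [_]; exact: On.
have ae0 n (p : R[i] -> R) : (forall (a : R) z, p (a%:C%C * z) = a * p z) ->
    (forall f, cintegrable mu f -> mu.-integrable setT (EFin \o (fun x => p (f x)))) ->
    (forall f, cintegrable mu f -> cint mu f = 0 -> (\int[mu]_x p (f x))%R = 0) ->
    {ae mu, forall x, p (H n x) = 0}.
  move=> pM ip p0; apply: ae_eq0_open; first exact: ip (iH n).
  move=> A oA; have mA := open_rV_measurable oA.
  have iA : cintegrable mu (fun x => (\1_A x)%:C%C * H n x).
    have [mH iH'] := iH n; apply: cintegrable_le iH' _.
      by apply: cmeasurableM => //; apply: cmeasurable_real; exact: measurable_indic.
    move=> x; rewrite cnM cn_real indicE.
    by case: (x \in A); rewrite ?normr1 ?mul1r// normr0 mul0r cn_ge0.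
  have := p0 _ iA (H0 n A oA); rewrite /Rintegral => e.
  rewrite integral_mkcond.
  transitivity (\int[mu]_x (p ((\1_A x)%:C%C * H n x))%:E)%E; last first.
    by rewrite -(fineK (integrable_fin_num measurableT (ip _ iA))) e.
  apply: eq_integral => x _; rewrite /patch [in RHS]pM [in RHS]indicE.
  by case: (x \in A) => /=; rewrite ?mul1r ?mul0r.
have aeRe n : {ae mu, forall x, Re (H n x) = 0}.
  apply: ae0.
  - by move=> a z; rewrite cReM /= mul0r subr0.
  - by move=> f; exact: cintegrable_Re.
  - by move=> f _ f0; rewrite -Re_cint f0.
have aeIm n : {ae mu, forall x, Im (H n x) = 0}.
  apply: ae0.
  - by move=> a z; rewrite cImM /= mul0r addr0.
  - by move=> f; exact: cintegrable_Im.
  - by move=> f _ f0; rewrite -Im_cint f0.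
apply: filterS2 (ae_foralln aeRe) (ae_foralln aeIm) => x h1 h2.
pose n := Num.truncn `|x|.
have Hx : H n x = g0 x.
  rewrite /H indicE mem_set ?mul1r//; apply/rV_ballE.
  by rewrite sub0r normrN; exact: truncnS_gt.
by rewrite -Hx; apply: complex_ext.
Qed.

Lemma represents_ae_unique (g1 g2 : Rd -> R[i]) (u : functional R d) :
  represents g1 u -> represents g2 u -> ae_equal g1 g2.
Proof.
move=> [l1 r1] [l2 r2].
have [h1 [m1 e1 k1]] := L1loc_borel l1; have [h2 [m2 e2 k2]] := L1loc_borel l2.
suff h12 : ae_equal (fun x => h1 x - h2 x) (fun=> 0).
  apply: ae_equal_trans e1 _; apply: ae_equal_trans (ae_equal_sym e2).
  by apply: filterS h12 => x /eqP; rewrite subr_eq0 => /eqP.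
apply: du_bois_reymond.
  move=> K cK; split.
    exact: cmeasurable_clebesgue (cmeasurableB m1 m2) (aeW _ (fun=> erefl)).
  have [_ i1] := integrable_on_cmeasurable m1 cK (k1 K cK).
  have [_ i2] := integrable_on_cmeasurable m2 cK (k2 K cK).
  have := integrable_lty measurableT (integrableD measurableT i1 i2).
  apply: le_lt_trans; rewrite [leLHS]integral_mkcond; apply: ge0_ae_le_integral_nomeas.
  - by move=> x; rewrite /patch; case: ifP => // _; rewrite lee_fin cn_ge0.
  - by move=> x; rewrite adde_ge0// lee_fin cn_ge0.
  - apply: aeW => x; rewrite /patch /= !cnM !cn_real !indicE.
    case: (x \in K) => /=; first by rewrite normr1 !mul1r -EFinD lee_fin; exact: cnB.
    by rewrite normr0 !mul0r adde0.
move=> psi tp; have i1 := cintegrable_L1loc_test m1 k1 tp.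
have i2 := cintegrable_L1loc_test m2 k2 tp.
transitivity (dist_of h1 psi - dist_of h2 psi).
  by rewrite -[RHS](cintB i1 i2); congr cint; apply/funext => x; rewrite mulrBl.
by rewrite -(dist_of_ae e1) -(dist_of_ae e2) -r1// -r2// subrr.
Qed.

(** [density] is an arbitrary choice among representing functions; this allows an explicit one to
    take its place in [En]. *)
Lemma density_ae (g : Rd -> R[i]) (u : functional R d) :
  represents g u -> ae_equal (density u) g.
Proof.
move=> gu; have h : exists g0, [set g0 | represents g0 u] g0 by exists g.
exact: represents_ae_unique (xgetPex (fun=> 0) h) gu.
Qed.

End du_bois_reymond.

(** * Zero mean functions as divergences *)

Section zero_mean.
Variables (R : realType) (d : nat).
Local Notation Rd := 'rV[R]_d.
Local Notation "'e_ i" := (@delta_mx R 1 d 0 i) (at level 8, i at level 2).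

Lemma is_derive_scale (H H' : R -> R) (a t : R) :
  (forall s : R, is_derive s 1 H (H' s)) ->
  is_derive t 1 (fun s => H (s * a)) (a * H' (t * a)).
Proof.
move=> dH; have df s : differentiable H s.
  by apply/derivable1_diffP; have [] := dH s.
have := @is_derive_line R R H 0 a t (diff_derivable (df _)).
rewrite deriveE// -[a in 'd H _ a]mulr1 linearZ /= -deriveE//.
rewrite !add0r; have [_ ->] := dH (t *: a).
by under [X in is_derive _ _ X]eq_fun do rewrite add0r.
Qed.

(** The integrand is the derivative of [t * g (y + (t * a) *: v)] in [t]. The same expression arises
    from the product rule for a coordinate times a function scaled in that coordinate. *)
Lemma FTC_scaled_line (g : Rd -> R) (y v : Rd) (a : R) : continuous g ->
  (forall x, derivable g x v) -> continuous ('D_v g) ->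
  (\int[@lebesgue_measure R]_(t in `[1, 2])
     (g (y + (t * a) *: v) + t * a * 'D_v g (y + (t * a) *: v)))%R =
  2 * g (y + (2 * a) *: v) - g (y + a *: v).
Proof.
move=> cg dg cdg.
pose L (h : Rd -> R) (t : R) := h (y + (t * a) *: v).
have cL h : continuous h -> continuous (L h).
  move=> ch t; apply: continuous_comp; last exact: ch.
  apply: cvgD; first exact: cvg_cst.
  by apply: cvgZr_tmp; apply: cvgM; [exact: cvg_id|exact: cvg_cst].
have dL (t : R) : is_derive t 1 (L g) (a * L ('D_v g) t).
  exact: (is_derive_scale a t (fun s => is_derive_line (dg (y + s *: v)))).
pose F (t : R) := t * L g t.
have dF (t : R) : is_derive t 1 F (L g t + t * a * L ('D_v g) t).
  have := is_deriveM (is_derive_id t 1) (dL t).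
  have -> : F = id * L g by [].
  move=> h; apply: (is_derive_eq h).
  by rewrite addrC [_%:A]mulr1 -[t *: _]/(t * _) mulrA.
have cF : continuous F.
  by move=> t; apply/differentiable_continuous/derivable1_diffP; have [] := dF t.
have cf : continuous (fun t => L g t + t * a * L ('D_v g) t).
  move=> t; apply: cvgD; first exact: cL.
  apply: cvgM; last exact: cL.
  by apply: cvgM; [exact: cvg_id|exact: cvg_cst].
have := @continuous_FTC2 R (fun t => L g t + t * a * L ('D_v g) t) F 1 2 _ _ _ _.
rewrite /Rintegral => ->.
- by rewrite /F /L !mul1r.
- by rewrite ltr1n.
- exact: continuous_subspaceT.
- split; first by move=> t _; have [] := dF t.
  + exact/cvg_at_right_filter/cF.
  + exact/cvg_at_left_filter/cF.
- by move=> t _; rewrite derive1E; have [_ ->] := dF t.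
Qed.

(* [phi - phi_1] telescopes over the functions obtained from phi by replacing
   [x_l] with [2 x_l] for [l < n], and each step is the integral over
   [1 <= t <= 2] of the t-derivative of [t * phi (.., t x_n, ..)], that is, of
   the n-th partial derivative of [x_n * phi (.., t x_n, ..)]. *)
Definition interpolated_scaling (n : nat) (t : R) (l : 'I_d) : R :=
  if (l < n)%N then 2 else if l == n :> nat then t else 1.

Variable phi : Rd -> R[i].
Hypothesis tphi : test_function phi.

Let I12 : set (measurableTypeR R) := [set` `[1 : R, 2 : R]].
Let k (t : measurableTypeR R) : R[i] := (\1_I12 t)%:C%C.
Let nu : {measure set (measurableTypeR R) -> \bar R} := @lebesgue_measure R.
Let be (t : measurableTypeR R) (l : 'I_d) : R := 0.
Let al n (t : measurableTypeR R) := interpolated_scaling n t.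

(** The integral over 1 <= t <= 2 of phi (2 x_0, .., 2 x_(n-1), t x_n, x_(n+1), ..), with the
    indicator of the interval as weight. *)
Let Psi n := pint nu (al n) be k phi.

Let mal n (l : 'I_d) : measurable_fun setT (fun t => al n t l).
Proof.
rewrite /al /interpolated_scaling; case: (l < n)%N => //.
by case: (_ == _).
Qed.

Let mbe (l : 'I_d) : measurable_fun setT (fun t => be t l).
Proof. exact: measurable_cst. Qed.

Let k_in t : k t != 0 -> 1 <= t <= 2.
Proof.
rewrite /k indicE; have [|_] := boolP (t \in _); last by rewrite eqxx.
by move/set_mem; rewrite /I12 /= in_itv.
Qed.

Let wk n : weight_ok nu (al n) 2 k.
Proof.
split.
  have mI : measurable I12 by exact: measurable_itv.
  apply: cintegrableP; first exact/cmeasurable_real/measurable_indic.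
  under eq_integral do rewrite cn_real ger0_norm ?indicE ?ler0n// -indicE.
  rewrite integral_indic// setIT.
  have -> : nu I12 = _ := lebesgue_measure_itv `[1 : R, 2 : R].
  by case: ifP => _; rewrite -?EFinB ltry.
move=> t l /k_in /andP[t1 t2]; rewrite /al /interpolated_scaling.
case: ifP => _; first by rewrite ger0_norm.
case: ifP => _; first by rewrite ger0_norm// (le_trans _ t1).
by rewrite normr1 ler1n.
Qed.

(** The telescoping sequence: [step 0] is [phi] and [step d] is [dilation phi 1]. *)
Let step (n : nat) (x : Rd) : R[i] :=
  (2 ^+ n)%:C%C * phi (diag_affine (interpolated_scaling n 1) (fun=> 0) x).

(** The factor [2 ^ i] is the normalisation of [step i], where [i] coordinates are already doubled;
    the sign makes the divergence telescope to [step 0 - step d]. *)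
Let chi (i : 'I_d) : Rd -> R[i] :=
  fun x => - (2 ^+ i)%:C%C * coord_mul i (Psi i) x.

(** For [t] in [1, 2] all coefficients are at least 1, so scaling cannot bring a point from outside
    the ball of radius [q] into it. *)
Let test_Psi n : test_function (Psi n).
Proof.
have [q q0 hq] := test_radius tphi.
apply: (@test_of_radius _ _ _ q).
  exact: (pint_smooth (mal n) mbe (ltr0Sn R 1) (wk n) tphi).
move=> x qx; rewrite -(cint0 nu); congr cint; apply/funext => t.
have [->|/k_in /andP[t1 t2]] := eqVneq (k t) 0; first by rewrite mul0r.
rewrite hq ?mulr0//; apply: lt_le_trans qx _.
apply: rV_norm_le => // l; apply: le_trans (coord_le_norm _ l).
rewrite mxE addr0 normrM ler_peMl// /al /interpolated_scaling.
case: ifP => _; first by rewrite ger0_norm// ler1n.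
by case: ifP => _; rewrite ?normr1// ger0_norm// (le_trans _ t1).
Qed.

Let partial_chi i x : partial i (chi i) x = step i x - step i.+1 x.
Proof.
have sP := (test_Psi i).1; have /smoothP/(_ [::])[_ dP] := sP.
have := diffsZ [:: i] (- (2 ^+ i)%:C%C) (smooth_coord_mul i sP).
rewrite /chi /= => ->; have [_ ->] := partial_coord_mul i (dP x i).
rewrite eqxx mul1r.
have [_ ->] := pint_partial (mal i) mbe (ltr0Sn R 1) x i (wk i) tphi.
have alE t : al i t i = t by rewrite /al /interpolated_scaling ltnn eqxx.
(* [x] with coordinate [i] set to 0 and the earlier ones doubled: the scaled points then run along
   the line through [y] in direction [i]. *)
pose y : Rd := \row_l (if l == i then 0 else al i 1 l * x 0 l).
have dE t : diag_affine (al i t) (be t) x = y + (t * x 0 i) *: 'e_i.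
  apply/rowP => l; rewrite !mxE addr0; have [->|li] := eqVneq l i.
    by rewrite alE mulr1 add0r.
  rewrite mulr0 addr0 /al /interpolated_scaling; case: ifP => // _.
  by have -> : (l == i :> nat) = false by apply/negP => /eqP/ord_inj/eqP; rewrite (negbTE li).
have i1 := pint_integrable (mal i) mbe x (wk i) tphi.
have i2 := pint_integrable (mal i) mbe x (weight_ok_mul (mal i) i (wk i))
  (test_function_partial i tphi).
rewrite /Psi /pint -cintZ// -cintD//; last exact: cintegrableZ.
have [_ _ dphi] := tphi.1 [::]; have [c1 c2 _] := tphi.1 [::].
have [c3 c4 _] := tphi.1 [:: i].
(* [p] stands for the real or the imaginary part, to which the fundamental theorem for real
   functions applies. *)
have key (p : R[i] -> R) : (forall (a : R) z, p (a%:C%C * z) = a * p z) ->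
    (forall z w, p (z + w) = p z + p w) ->
    continuous (fun z => p (phi z)) -> (forall z, derivable (fun z => p (phi z)) z 'e_i) ->
    continuous (fun z => p (partial i phi z)) ->
    (forall z, p (partial i phi z) = 'D_('e_i) (fun z => p (phi z)) z) ->
    (\int[nu]_t p (k t * phi (diag_affine (al i t) (be t) x) +
      (x 0 i)%:C%C * (k t * (al i t i)%:C%C * partial i phi (diag_affine (al i t) (be t) x))))%R =
    2 * p (phi (y + (2 * x 0 i) *: 'e_i)) - p (phi (y + x 0 i *: 'e_i)).
  move=> pM pD cp dp cdp pE.
  have DE : 'D_('e_i) (fun z => p (phi z)) = fun z => p (partial i phi z).
    by apply/funext => z; rewrite pE.
  have cD : continuous ('D_('e_i) (fun z => p (phi z))) by rewrite DE.
  rewrite -(@FTC_scaled_line (fun z => p (phi z)) y 'e_i (x 0 i) cp dp cD).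
  rewrite [RHS]Rintegral_mkcond; apply: eq_Rintegral => t _.
  rewrite /patch dE alE pD /k -(rmorphM (real_complex R)) !pM indicE -/I12 -pE.
  case: (t \in _) => /=; first by ring.
  by rewrite !mul0r mulr0 addr0.
have cRR (a : R) z : Re (a%:C%C * z) = a * Re z by rewrite cReM /= mul0r subr0.
have cIR (a : R) z : Im (a%:C%C * z) = a * Im z by rewrite cImM /= mul0r addr0.
have kR := key (@complex.Re R) cRR (@cReD R) c1 (fun z => (dphi z i).1) c3 (fun=> erefl).
have kI := key (@complex.Im R) cIR (@cImD R) c2 (fun z => (dphi z i).2) c4 (fun=> erefl).
have -> : cint nu (fun t => k t * phi (diag_affine (al i t) (be t) x) +
    (x 0 i)%:C%C * (k t * (al i t i)%:C%C * partial i phi (diag_affine (al i t) (be t) x))) =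
    2 * phi (y + (2 * x 0 i) *: 'e_i) - phi (y + x 0 i *: 'e_i).
  have two : (2 : R[i]) = (2 : R)%:C%C by rewrite (rmorph_nat (real_complex R)).
  apply: complex_ext; first by rewrite cReD cReN two cRR -kR.
  by rewrite cImD cImN two cIR -kI.
have yE n t : n = i :> nat -> diag_affine (interpolated_scaling n t) (fun=> 0) x =
    y + (t * x 0 i) *: 'e_i by move=> ->; exact: dE.
have S1 : diag_affine (interpolated_scaling i 1) (fun=> 0) x = y + x 0 i *: 'e_i.
  by rewrite yE// mul1r.
have S2 : diag_affine (interpolated_scaling i.+1 1) (fun=> 0) x = y + (2 * x 0 i) *: 'e_i.
  rewrite -(yE i)//; apply/rowP => l; rewrite !mxE /interpolated_scaling ltnS leq_eqVlt.
  by case: ltngtP => //= _; case: ifP.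
rewrite /step S1 S2 exprS (rmorphM (real_complex R)).
rewrite (rmorph_nat (real_complex R)); ring.
Qed.

Lemma zero_mean_decomposition : exists2 eta : 'I_d -> Rd -> R[i],
  (forall i, test_function (eta i)) &
  forall x, phi x - dilation phi 1 x = \sum_i partial i (eta i) x.
Proof.
exists chi.
  by move=> i; apply: test_functionZ; apply: test_coord_mul; exact: test_Psi.
move=> x; under eq_bigr do rewrite partial_chi.
rewrite -(big_mkord xpredT (fun i => step i x - step i.+1 x)).
have := telescope_sumr (fun i => step i x) (leq0n d).
under [in X in X -> _]eq_bigr do rewrite -opprB; rewrite sumrN => /eqP.
rewrite eqr_oppLR opprB => /eqP ->; rewrite /step; congr (_ - _).
  rewrite expr0 (rmorph1 (real_complex R)) mul1r; congr phi.
  by apply/rowP => l; rewrite mxE /interpolated_scaling ltn0 addr0; case: ifP; rewrite mul1r.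
rewrite /dilation mul1n expr1; congr (_ * phi _).
by apply/rowP => l; rewrite !mxE /interpolated_scaling ltn_ord addr0.
Qed.

End zero_mean.

(** * Weighted spaces *)

Section weights.
Variables (R : realType) (d : nat).
Local Notation Rd := 'rV[R]_d.
Local Notation mu := (lebesgue_rV R d).
Variable w : nat -> Rd -> R.
Hypotheses (hw : weight_function_system w) (hwM : wM w).

Lemma enormZ (a : R) (y : Rd) : enorm (a *: y) = `|a| * enorm y.
Proof.
rewrite /enorm -sqrtr_sqr -sqrtrM ?sqr_ge0// mulr_sumr; congr Num.sqrt.
by apply: eq_bigr => i _; rewrite mxE exprMn.
Qed.

Lemma enorm_le_nat (r : R) : exists L : nat, forall y : Rd, `|y| <= r -> enorm y <= L%:R.
Proof.
(* [L] bounds the square of the Euclidean norm, and [L <= L ^ 2] because [L] is at least 1. An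
   integer is taken so that (wM) can be iterated. *)
pose L := (Num.truncn (d%:R * r ^+ 2)).+1; exists L => y yr.
have L1 : 1 <= L%:R :> R by rewrite ler1n.
rewrite /enorm -[leRHS]ger0_norm// -sqrtr_sqr ler_wsqrtr//.
apply: (@le_trans _ _ (\sum_(i < d) r ^+ 2)).
  apply: ler_sum => i _; rewrite -[leLHS]real_normK ?num_real// lerXn2r ?nnegrE//.
    by rewrite (le_trans _ yr).
  exact: le_trans (coord_le_norm _ _) yr.
rewrite sumr_const card_ord -[leLHS]mulr_natl; apply: (@le_trans _ _ L%:R).
  exact/ltW/truncnS_gt.
by rewrite expr2 ler_peMr.
Qed.

Lemma weight_monotone n m x : (n <= m)%N -> w n x <= w m x.
Proof.
move=> /subnK <-; elim: (m - n)%N => [//|k IH].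
by rewrite addSn (le_trans IH)//; exact: hw.2.
Qed.

(** Induction on [L]: a vector of norm at most [L + 1] is the sum of its multiple by [1 / (L + 1)],
    of norm at most 1, and the rest, of norm at most [L]. *)
Lemma wM_iter (L n : nat) : exists (m : nat) (C : R), [/\ (n <= m)%N, 0 < C &
  forall x y, enorm y <= L%:R -> w n (x + y) <= C * w m x].
Proof.
elim: L => [|L [m1 [C1 [nm1 C10 h1]]]].
  have [m [C [nm C0 h]]] := hwM n; exists m, C; split => // x y y0.
  by apply: h; apply: le_trans y0 _.
have [m2 [C2 [m12 C20 h2]]] := hwM m1.
exists m2, (C1 * C2); split; [exact: leq_trans m12|exact: mulr_gt0|].
move=> x y yL; have S0 : 0 < L.+1%:R :> R by rewrite ltr0n.
have -> : x + y = x + L.+1%:R^-1 *: y + (L%:R / L.+1%:R) *: y.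
  rewrite -addrA -scalerDl.
  have -> : L.+1%:R^-1 + L%:R / L.+1%:R = 1 :> R; last by rewrite scale1r.
  by rewrite -natr1; field; rewrite natr1 pnatr_eq0.
apply: le_trans (h1 _ _ _) _.
  rewrite enormZ ger0_norm ?divr_ge0// mulrAC ler_pdivrMr//.
  by rewrite ler_wpM2l.
rewrite -mulrA ler_pM2l//; apply: h2.
by rewrite enormZ ger0_norm ?invr_ge0// mulrC ler_pdivrMr// mul1r.
Qed.

Lemma wM_ball n (r : R) : exists (m : nat) (C : R), [/\ (n < m)%N, 0 < C &
  forall x y, `|y| <= r -> w n x <= C * w m (x - y)].
Proof.
have [L hL] := enorm_le_nat r; have [m [C [nm C0 h]]] := wM_iter L n.
(* The successor makes [n < m] strict, which later leaves room for one more derivative. *)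
exists m.+1, C; split => // x y yr.
rewrite -[in leLHS](subrK y x); apply: le_trans (h _ _ (hL _ yr)) _.
by rewrite ler_pM2l//; exact: weight_monotone.
Qed.

Lemma weight_ge1 n x : 1 <= w n x.
Proof. by have [_ h _] := hw.1 n. Qed.

(** Solidity speaks of locally integrable functions; this supplies that condition for weighted
    convolutions. *)
Lemma weighted_L1loc n (q : Rd -> R[i]) : ccontinuous q -> L1loc (weighted q (w n)).
Proof.
move=> cq K cK; have [[w0 mw0 ww0] w1 wb] := hw.1 n; split.
  apply: (@cmeasurable_clebesgue _ _ _ (fun x => q x * (w0 x)%:C%C)).
    apply: cmeasurableM; first exact: ccontinuous_cmeasurable.
    exact: cmeasurable_real.
  by apply: filterS ww0 => x; rewrite /weighted => ->.
have [M M0 qM] := continuous_compact_bound cK cq; have [W wW] := wb K cK.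
have mK := compact_rV_measurable cK.
apply: (@le_lt_trans _ _ (\int[mu]_(x in K) (cst (M * `|W|)%:E) x)%E); last first.
  rewrite integral_cst//; apply: lte_mul_pinfty => //.
    by rewrite lee_fin mulr_ge0// ltW.
  exact: compact_rV_finite.
rewrite [leLHS]integral_mkcond [leRHS]integral_mkcond.
apply: ge0_ae_le_integral_nomeas.
- by move=> x; rewrite /patch; case: ifP => // _; rewrite lee_fin cn_ge0.
- by move=> x; rewrite /patch; case: ifP => // _; rewrite lee_fin mulr_ge0// ltW.
- apply: aeW => x; rewrite /patch; case: ifPn => // /set_mem Kx.
  rewrite lee_fin /modulus /weighted cnM cn_real; apply: ler_pM => //.
  + exact: cn_ge0.
  + exact: qM.
  + rewrite !ger0_norm//; first exact: wW.
      by apply: le_trans (wW x Kx); apply: le_trans (w1 x).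
    by apply: le_trans (w1 x).
Qed.

Lemma divw_L1loc n (g : Rd -> R[i]) : L1loc g ->
  L1loc (fun x => g x * ((w n x)^-1)%:C%C).
Proof.
move=> gl K cK; have [[w0 mw0 ww0] w1 _] := hw.1 n.
have [/clebesgue_measurableP[g0 mg0 gg0] gK] := gl K cK; split.
  (* A Borel function that equals the inverse of the weight wherever [w0] agrees with it. *)
  pose v0 x : R := w0 x `^ (-1).
  apply: (@cmeasurable_clebesgue _ _ _ (fun x => g0 x * (v0 x)%:C%C)).
    apply: cmeasurableM => //; apply: cmeasurable_real.
    exact: (measurableT_comp (measurable_powR (-1)) mw0).
  apply: filterS2 ww0 gg0 => x e1 e2; rewrite /v0 -e1 -e2 powR_inv1//.
  by apply: le_trans (w1 x).
apply: le_lt_trans gK; rewrite [leLHS]integral_mkcond [leRHS]integral_mkcond.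
apply: ge0_ae_le_integral_nomeas.
- by move=> x; rewrite /patch; case: ifP => // _; rewrite lee_fin cn_ge0.
- by move=> x; rewrite /patch; case: ifP => // _; rewrite lee_fin cn_ge0.
- apply: aeW => x; rewrite /patch; case: ifP => // _.
  rewrite lee_fin /modulus cnM cn_real ler_piMr ?cn_ge0//.
  by rewrite ger0_norm ?invr_ge0 ?(le_trans _ (w1 x))// invf_le1// (lt_le_trans _ (w1 x)).
Qed.

End weights.

(** * Convolution estimates and the direct implication *)

Section function_space.
Variables (R : realType) (d : nat).
Local Notation Rd := 'rV[R]_d.
Local Notation mu := (lebesgue_rV R d).
Local Notation dconv := (@dist_convolution R d).
Variables (E : set (Rd -> R[i])) (N : (Rd -> R[i]) -> R).
Hypotheses (hE : TIBF_bounded_type E N) (hsolid : solid E N).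
Variable w : nat -> Rd -> R.
Hypotheses (hw : weight_function_system w) (hwM : wM w).

Let bE := tibf_banach hE.

Lemma space_ae f g : E f -> ae_equal f g -> E g /\ N g = N f.
Proof. exact: (bfs_ae bE). Qed.

Lemma space_sub f g : E f -> E g -> E (fun x => f x - g x).
Proof.
move=> Ef /(bfs_scale bE (-1)) [Eg _]; have [] := bfs_add bE Ef Eg.
by under eq_fun do rewrite mulN1r.
Qed.

Lemma norm_symm f g : E f -> E g -> N (fun x => f x - g x) = N (fun x => g x - f x).
Proof.
move=> Ef Eg; have [_] := bfs_scale bE (-1) (space_sub Eg Ef).
rewrite cnN Normc.normc1 mul1r => <-; congr N; apply/funext => x.
by rewrite mulN1r opprB.
Qed.

Lemma norm_zero : N (fun=> 0) = 0.
Proof.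
have [_] := bfs_scale bE 0 (bfs_zero bE); rewrite cn0 [RHS]mul0r => <-.
by congr N; apply/funext => x; rewrite mul0r.
Qed.

Lemma norm_ge0 f : E f -> 0 <= N f.
Proof.
move=> Ef; have [Ef' e] := bfs_scale bE (-1) Ef.
have [_] := bfs_add bE Ef Ef'; rewrite e cnN Normc.normc1 mul1r.
rewrite (_ : (fun x => _) = fun=> 0) ?norm_zero; first by lra.
by apply/funext => x; rewrite mulN1r subrr.
Qed.

Lemma norm_triangle f g h : E f -> E g -> E h ->
  N (fun x => f x - h x) <= N (fun x => f x - g x) + N (fun x => g x - h x).
Proof.
move=> Ef Eg Eh; have [_] := bfs_add bE (space_sub Ef Eg) (space_sub Eg Eh).
by congr (N _ <= _); apply/funext => x; rewrite subrKA.
Qed.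

Lemma space_sum (I : Type) (r : seq I) (F : I -> Rd -> R[i]) (M : I -> R) :
  (forall i, E (F i)) -> (forall i, N (F i) <= M i) ->
  E (fun x => \sum_(i <- r) F i x) /\
  N (fun x => \sum_(i <- r) F i x) <= \sum_(i <- r) M i.
Proof.
move=> EF NM; elim: r => [|i r [IH1 IH2]].
  under eq_fun do rewrite big_nil; rewrite big_nil.
  by split; [exact: (bfs_zero bE)|rewrite norm_zero].
under eq_fun do rewrite big_cons; rewrite big_cons.
have [E1 N1] := bfs_add bE (EF i) IH1; split => //.
by apply: le_trans N1 _; exact: lerD.
Qed.

(* With [|y| <= r] on the support of [chi] one has
   [w n x * |p (x - y)| <= C * |p (x - y)| * w m (x - y)], so the weighted
   convolution is dominated by a convolution in the L1-module E. *)
Lemma weighted_convolution n (r : R) : exists (m : nat) (C : R), [/\ (n < m)%N, 0 < C &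
  forall p chi, L1loc p -> E (weighted p (w m)) -> test_function chi ->
    (forall x, r < `|x| -> chi x = 0) ->
    E (weighted (dconv (dist_of p) chi) (w n)) /\
    N (weighted (dconv (dist_of p) chi) (w n)) <=
      C * (N (weighted p (w m)) * L1norm_on setT chi)].
Proof.
have [m [C [nm C0 hC]]] := wM_ball hw hwM n r; exists m, C; split => // p chi pl Ep tc cr.
have [p0 [mp0 pp0 p0l]] := L1loc_borel pl.
have [[w0 mw0 ww0] w1 _] := hw.1 m.
(* A Borel version of |p| times the weight; the absolute value is there because [w0] agrees with the
   weight only almost everywhere. *)
pose h x := cn (p0 x) * `|w0 x|; pose H x : R[i] := (h x)%:C%C.
have h0 x : 0 <= h x by rewrite mulr_ge0 ?cn_ge0.
have mh : measurable_fun setT h.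
  apply: measurable_funM; first exact: cmeasurable_cn.
  exact: (measurableT_comp (@normr_measurable R setT)).
have mH : cmeasurable H by exact: cmeasurable_real.
have cnH x : cn (H x) = h x by rewrite cn_real ger0_norm.
have Hae : {ae mu, forall x, modulus H x = modulus (weighted p (w m)) x}.
  apply: filterS2 pp0 ww0 => x e1 e2.
  by rewrite /modulus cnH /weighted cnM cn_real e1 e2.
have Hl : L1loc H.
  move=> K cK; split; first exact: cmeasurable_clebesgue mH (aeW _ (fun=> erefl)).
  have [_] := bfs_L1loc bE Ep cK; congr (_ < _)%E.
  by apply: ae_eq_integral_nomeas_on; apply: filterS Hae => x ->.
have [EH NH] : E H /\ N H <= N (weighted p (w m)).
  by apply: hsolid => //; apply: filterS Hae => x ->.
pose g y : R[i] := (cn (chi y))%:C%C.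
have mchi : cmeasurable chi by exact/ccontinuous_cmeasurable/test_ccontinuous.
have mg : cmeasurable g by exact/cmeasurable_real/cmeasurable_cn.
have cng y : cn (g y) = cn (chi y) by rewrite cn_real ger0_norm// cn_ge0.
have ichi := test_cintegrable tc.
have L1g : L1 g.
  split; first exact: cmeasurable_clebesgue mg (aeW _ (fun=> erefl)).
  rewrite /modulus; under eq_integral do rewrite cng.
  by case: ichi => _ ichi; exact: integrable_lty.
have [_ EHg NHg] := tibf_convolution hE EH L1g.
have L1norm_g : L1norm_on setT g = L1norm_on setT chi.
  by apply: eq_Rintegral => x _; rewrite /modulus cng.
have [K cK cK0] := tc.2; have [M M0 cM] := test_bound tc.
have intx (q : Rd -> R[i]) (k : Rd -> R[i]) x : cmeasurable q -> L1loc q -> cmeasurable k ->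
    (forall y, cn (k y) = cn (chi y)) -> cintegrable mu (fun y => q (x - y) * k y).
  move=> mq ql mk kc.
  have i1 : cintegrable mu (fun y => q y * k (x - y)).
    have [tr _] := test_reflect x tc; have [K' cK' trK'] := tr.2.
    apply: (@cintegrable_mul_L1loc _ _ _ _ K' M) => //.
    - exact: cmeasurable_sub.
    - by move=> y /trK' e; apply: cn_eq0; rewrite kc e cn0.
    - by move=> y; rewrite kc.
  have := cintegrable_sub x i1; congr cintegrable; apply/funext => y.
  by rewrite subKr.
pose q := dconv (dist_of p) chi.
have cq : ccontinuous q by apply: dconv_ccontinuous => //; exact: dist_of_distribution.
have qE x : q x = cint mu (fun y => p0 (x - y) * chi y).
  rewrite /q /dist_convolution (dist_of_ae pp0).
  have [tr _] := test_reflect x tc.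
  have i1 : cintegrable mu (fun y => p0 y * chi (x - y)) by exact: cintegrable_L1loc_test.
  rewrite -[LHS](cint_sub x i1); congr cint; apply/funext => y.
  by rewrite subKr.
(* [H] and [g] are nonnegative, so the modulus of their convolution is the integral of the moduli,
   and the comparison of weights can be made under the integral sign. *)
have key x : modulus (weighted q (w n)) x <= C * modulus (convolution H g) x.
  have wn0 : 0 <= w n x by apply: le_trans (weight_ge1 hw n x).
  have i0 := intx p0 chi x mp0 p0l mchi (fun=> erefl).
  have i1 := intx H g x mH Hl mg cng.
  have i0' : mu.-integrable setT (EFin \o (fun y => w n x * cn (p0 (x - y) * chi y))).
    by case: i0 => _ i0; exact: (@integrableZl _ _ _ mu _ measurableT (w n x) _ i0).
  have i1' : mu.-integrable setT (EFin \o (fun y => C * cn (H (x - y) * g y))).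
    by case: i1 => _ i1; exact: (@integrableZl _ _ _ mu _ measurableT C _ i1).
  have -> : modulus (convolution H g) x = (\int[mu]_y cn (H (x - y) * g y))%R.
    rewrite /modulus /convolution.
    have e y : H (x - y) * g y = (cn (H (x - y) * g y))%:C%C.
      by rewrite cnM cnH cng (rmorphM (real_complex R)).
    have -> : cintegral (fun y => H (x - y) * g y) =
        (\int[mu]_y cn (H (x - y) * g y))%R%:C%C.
      rewrite -[LHS]/(cint mu _); apply: complex_ext; rewrite ?Re_cint ?Im_cint.
        by apply: eq_Rintegral => y _; rewrite {1}e.
      rewrite /Rintegral (eq_integral (cst 0%E)) ?integral0// => y _.
      by rewrite e.
    by rewrite cn_real ger0_norm//; apply: Rintegral_ge0 => y _; exact: cn_ge0.
  rewrite /modulus /weighted cnM cn_real ger0_norm// mulrC.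
  apply: (@le_trans _ _ (\int[mu]_y (w n x * cn (p0 (x - y) * chi y)))%R).
    rewrite RintegralZl//; last by case: i0.
    by rewrite ler_wpM2l// qE; exact: le_cn_cint.
  rewrite -RintegralZl//; last by case: i1.
  rewrite /Rintegral fine_le ?integrable_fin_num//.
  apply: ge0_ae_le_integral_nomeas.
  - by move=> y; rewrite lee_fin mulr_ge0// cn_ge0.
  - by move=> y; rewrite lee_fin mulr_ge0 ?cn_ge0// ltW.
  - apply: filterS (ae_sub x ww0) => y e; rewrite lee_fin !cnM cnH cng /h -e.
    have [yr|/cr ->] := leP `|y| r; last by rewrite cn0 !mulr0.
    rewrite !mulrA ler_wpM2r ?cn_ge0// mulrC [C * _]mulrC -mulrA.
    rewrite ler_wpM2l ?cn_ge0// (le_trans (hC x y yr))// ler_wpM2l ?(ltW C0)//.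
    exact: ler_norm.
have [EC NC] := bfs_scale bE C%:C%C EHg.
have [Eq Nq] : E (weighted q (w n)) /\
    N (weighted q (w n)) <= N (fun x => C%:C%C * convolution H g x).
  apply: hsolid => //; first exact: weighted_L1loc.
  apply: aeW => x; apply: le_trans (key x) _.
  by rewrite /modulus cnM cn_real gtr0_norm.
split => //; apply: le_trans Nq _; rewrite NC cn_real gtr0_norm// ler_wpM2l ?(ltW C0)//.
apply: le_trans NHg _; rewrite L1norm_g ler_wpM2r//.
by apply: Rintegral_ge0 => y _; exact: cn_ge0.
Qed.

Variable phi : Rd -> R[i].
Hypotheses (tphi : test_function phi) (phi_neq0 : cint mu phi <> 0).

Lemma En_norm_ge n (u : functional R d) (a : multi_index d) : (mi_order a <= n)%N ->
  N (weighted (density (dderiv a u)) (w n)) <= En_norm N n (w n) u.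
Proof.
(* Each [a i] is at most [mi_order a <= n], so [inord] preserves its value. *)
move=> an; pose a' : {ffun 'I_d -> 'I_n.+1} := [ffun i => inord (a i)].
have e : a = (fun i => a' i : nat).
  apply/funext => i; rewrite ffunE inordK// ltnS (leq_trans _ an)//.
  by rewrite /mi_order (bigD1 i)//= leq_addr.
rewrite /En_norm {1}e.
apply: (@le_bigmax_cond _ _ _ _ a' _
  (fun b : {ffun 'I_d -> 'I_n.+1} => N (weighted (density (dderiv (fun i => b i) u)) (w n)))).
by rewrite -e.
Qed.

(** All [phi_j] are supported in the ball of radius [q] and have the same L1 norm, so one constant
    of [weighted_convolution] serves every [j]. It is applied to the densities of the derivatives of
    [f]. *)
Lemma EW_mollified_bounded (f : functional R d) : is_distribution f -> EW E w f ->
  EW_bounded E N w [set dist_of (dconv f (dilation phi j)) | j in [set: nat]].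
Proof.
move=> df Ef; have [q q0 hq] := test_radius tphi.
have td j := (test_dilation j tphi).1.
have qj j x : q < `|x| -> dilation phi j x = 0.
  move=> qx; apply: (dilation_radius hq q0); apply: le_lt_trans qx.
  rewrite ler_pdivrMr ?exprn_gt0//; apply: ler_peMr; first exact: ltW.
  by apply: exprn_ege1; rewrite ler1n.
have key n : exists m C, 0 < C /\ forall j (a : multi_index d), (mi_order a <= n)%N ->
    let v := dist_of (dconv f (dilation phi j)) in
    [/\ represents (dconv (dderiv a f) (dilation phi j)) (dderiv a v),
      E (weighted (density (dderiv a v)) (w n)) &
      N (weighted (density (dderiv a v)) (w n)) <=
      C * (N (weighted (density (dderiv a f)) (w m)) * L1norm_on setT phi)].
  have [m [C [nm C0 hC]]] := weighted_convolution n q.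
  exists m, C; split => // j a an v.
  have rv := dderiv_dconv a df (td j).
  have [_ /(_ a (leq_trans an (ltnW nm)))[[p rp] Ep]] := Ef m.
  have rp' : represents (density (dderiv a f)) (dderiv a f).
    have h : exists p0, [set p0 | represents p0 (dderiv a f)] p0 by exists p.
    exact: (xgetPex (fun=> 0) h).
  have [E1 N1] := hC _ _ rp'.1 Ep (td j) (qj j).
  have eq : dconv (dist_of (density (dderiv a f))) (dilation phi j) =
      dconv (dderiv a f) (dilation phi j).
    by apply: eq_dconv => // psi tp; rewrite rp'.2.
  rewrite eq (L1norm_dilation j (test_cintegrable tphi)) in E1 N1.
  have ae1 : ae_equal (weighted (dconv (dderiv a f) (dilation phi j)) (w n))
      (weighted (density (dderiv a v)) (w n)).
    by apply: filterS (density_ae tphi phi_neq0 rv) => x; rewrite /weighted => ->.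
  by have [E2 N2] := space_ae E1 ae1; split => //; rewrite N2.
split.
  move=> _ [j _ <-] n; split; first exact: dist_of_dconv_distribution.
  move=> a an; have [m [C [_ /(_ j a an)[r1 E1 _]]]] := key n.
  by split => //; eexists; exact: r1.
move=> n; have [m [C [C0 h]]] := key n.
pose B (a : {ffun 'I_d -> 'I_n.+1}) :=
  C * (N (weighted (density (dderiv (fun i => a i) f)) (w m)) * L1norm_on setT phi).
exists (\big[Num.max/0]_(a : {ffun 'I_d -> 'I_n.+1} |
  (mi_order (fun i => a i) <= n)%N) B a).
move=> _ [j _ <-]; apply/bigmax_leP; split.
  by apply: bigmax_ge_id.
move=> a an; have [_ _ N1] := h j _ an; apply: le_trans N1 _.
exact: (@le_bigmax_cond _ _ _ _ a _ B).
Qed.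

End function_space.

(** * The converse implication *)

Section converse.
Variables (R : realType) (d : nat).
Local Notation Rd := 'rV[R]_d.
Local Notation mu := (lebesgue_rV R d).
Local Notation dconv := (@dist_convolution R d).

Lemma dist_of_lin (a : R[i]) (f g psi : Rd -> R[i]) : L1loc f -> L1loc g ->
  test_function psi ->
  dist_of (fun x => a * f x - g x) psi = a * dist_of f psi - dist_of g psi.
Proof.
move=> /L1loc_borel[f0 [mf ff0 fl]] /L1loc_borel[g0 [mg gg0 gl]] tp.
rewrite (dist_of_ae ff0) (dist_of_ae gg0).
rewrite (@dist_of_ae _ _ _ (fun x => a * f0 x - g0 x)); last first.
  by apply: filterS2 ff0 gg0 => x -> ->.
have i1 := cintegrable_L1loc_test mf fl tp; have i2 := cintegrable_L1loc_test mg gl tp.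
rewrite -[RHS]/(a * cint mu _ - cint mu _) -(cintZ a i1) -(cintB (cintegrableZ a i1) i2).
by congr cint; apply/funext => x; ring.
Qed.

Lemma dist_of_bound (h psi : Rd -> R[i]) (K : set Rd) (M : R) : L1loc h ->
  test_function psi -> compact K -> vanishes_off K psi -> (forall x, cn (psi x) <= M) ->
  cn (dist_of h psi) <= M * L1norm_on K h.
Proof.
move=> /L1loc_borel[h0 [mh hh0 hl]] tp cK pK pM; rewrite (dist_of_ae hh0).
have ik := integrable_on_cmeasurable mh cK (hl K cK).
have -> : L1norm_on K h = (\int[mu]_x cn ((\1_K x)%:C%C * h0 x))%R.
  rewrite /L1norm_on Rintegral_mkcond /Rintegral; congr fine.
  apply: ae_eq_integral_nomeas; apply: filterS hh0 => x e.
  rewrite /patch cnM cn_real indicE /modulus e.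
  by case: (x \in K); rewrite ?normr1 ?mul1r// normr0 mul0r.
have -> : dist_of h0 psi = cint mu (fun x => (\1_K x)%:C%C * h0 x * psi x).
  congr cint; apply/funext => x.
  have [Kx|/pK ->] := pselect (K x); last by rewrite !mulr0.
  by rewrite indicE mem_set// mul1r.
apply: cint_mul_bound => //; exact: cintegrable_mul_test.
Qed.

Variables (E : set (Rd -> R[i])) (N : (Rd -> R[i]) -> R).
Hypotheses (hE : TIBF_bounded_type E N) (hsolid : solid E N).
Variable w : nat -> Rd -> R.
Hypotheses (hw : weight_function_system w) (hwM : wM w).
Variable phi : Rd -> R[i].
Hypotheses (tphi : test_function phi) (phi_neq0 : cint mu phi <> 0).

Let bE := tibf_banach hE.

Let td j : test_function (dilation phi j) := (test_dilation j tphi).1.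

(** [phi_j - phi_(j+1)] is the dilation of [phi - phi_1], and each partial derivative of a dilation
    carries a factor [2 ^ j], which [2 ^- j] compensates. *)
Lemma dilation_difference : exists2 eta : 'I_d -> Rd -> R[i],
  (forall i, test_function (eta i)) &
  forall j x, dilation phi j x - dilation phi j.+1 x =
    \sum_i (2 ^- j)%:C%C * partial i (dilation (eta i) j) x.
Proof.
have [eta te he] := zero_mean_decomposition tphi; exists eta => // j x.
have j0 : (2 ^+ j)%:C%C != 0 :> R[i].
  by rewrite fmorph_eq0 expf_neq0// pnatr_eq0.
have -> : dilation phi j.+1 x = dilation (dilation phi 1) j x.
  rewrite /dilation mulrA -(rmorphM (real_complex R)) -exprD -mulnDl addn1.
  by rewrite scalerA expr1 exprS.
rewrite [dilation phi j x]/dilation [dilation _ j x]/dilation -mulrBr he mulr_sumr.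
apply: eq_bigr => i _; have [_ ->] := test_dilation j (te i).
by rewrite mulrA -(rmorphM (real_complex R)) mulVf ?(rmorph1 (real_complex R)) ?mul1r.
Qed.

(** The indices [l] and [j] are independent because the difference of kernels at level [j] is needed
    against both F_j and F_(j+1). *)
Lemma dconv_dilation_difference u (eta : 'I_d -> Rd -> R[i]) j l :
  is_distribution u -> (forall i, test_function (eta i)) ->
  (forall j x, dilation phi j x - dilation phi j.+1 x =
    \sum_i (2 ^- j)%:C%C * partial i (dilation (eta i) j) x) ->
  forall x, dconv (dist_of (dconv u (dilation phi l))) (dilation phi j) x -
    dconv (dist_of (dconv u (dilation phi l))) (dilation phi j.+1) x =
  \sum_i (2 ^- j)%:C%C * dconv (dist_of (dconv (dderiv (mi_unit i) u) (dilation phi l)))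
     (dilation (eta i) j) x.
Proof.
move=> du te he x; pose v := dist_of (dconv u (dilation phi l)).
have dv : is_distribution v by exact: dist_of_dconv_distribution.
have [r1 _] := test_reflect x (td j); have [r2 _] := test_reflect x (td j.+1).
rewrite -[LHS]/(v _ - v _) -(distB dv r1 r2).
have tde i : test_function (dilation (eta i) j) := (test_dilation j (te i)).1.
have tp i : test_function (fun y => partial i (dilation (eta i) j) (x - y)).
  by have [] := test_reflect x (test_function_partial i (tde i)).
have -> : (fun y => dilation phi j (x - y) - dilation phi j.+1 (x - y)) =
    (fun y => \sum_i (2 ^- j)%:C%C * partial i (dilation (eta i) j) (x - y)).
  by apply/funext => y; rewrite he.
have [_ ->] := dist_sum dv (index_enum 'I_d) (fun i => test_functionZ (2 ^- j)%:C%C (tp i)).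
apply: eq_bigr => i _; rewrite (distZ dv _ (tp i)); congr (_ * _).
by rewrite -(dconv_partial i du (td l) (tde i)).
Qed.

Lemma EW_of_mollified_bounded (f : functional R d) : is_distribution f ->
  EW_bounded E N w [set dist_of (dconv f (dilation phi j)) | j in [set: nat]] ->
  EW E w f.
Proof.
move=> df [FE Fb] n; split=> // a an.
have [q q0 hq] := test_radius tphi.
have [eta te he] := dilation_difference.
have /choice[s hs] : forall i, exists s : R, 0 < s /\ forall x, s < `|x| -> eta i x = 0.
  by move=> i; have [s s0 h] := test_radius (te i); exists s.
(* One radius for the supports of [phi] and all [eta i], hence of all their dilations. *)
pose r := q + \sum_i s i.
have s0 i : 0 <= s i by have [/ltW] := hs i.
have dil_out (chi : Rd -> R[i]) (t : R) : 0 < t -> t <= r -> (forall x, t < `|x| -> chi x = 0) ->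
    forall j x, r < `|x| -> dilation chi j x = 0.
  move=> t0 tr ct j x rx; apply: (dilation_radius ct t0).
  apply: le_lt_trans rx; apply: le_trans tr.
  rewrite ler_pdivrMr ?exprn_gt0//; apply: ler_peMr; first exact: ltW.
  by apply: exprn_ege1; rewrite ler1n.
have qr : q <= r by rewrite lerDl sumr_ge0.
have phi_out := dil_out phi q q0 qr hq.
have eta_out i : forall j x, r < `|x| -> dilation (eta i) j x = 0.
  apply: (dil_out _ (s i)); [by have [] := hs i| |by have [] := hs i].
  rewrite /r (bigD1 i)//= addrCA lerDl; apply: addr_ge0; first exact: ltW.
  by apply: sumr_ge0.
have [m [C [nm C0 hC]]] := weighted_convolution hE hsolid hw hwM n r.
have [M hM] := Fb m.
pose u := dderiv a f; have du : is_distribution u by exact: dderiv_distribution.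
(* The hypothesis concerns chosen densities; these agree almost everywhere with the continuous
   functions obtained by convolving the derivatives of [f] with [phi_j]. *)
have derivE (b : multi_index d) j : (mi_order b <= m)%N ->
    E (weighted (dconv (dderiv b f) (dilation phi j)) (w m)) /\
    N (weighted (dconv (dderiv b f) (dilation phi j)) (w m)) <= M.
  move=> bm; pose v := dist_of (dconv f (dilation phi j)).
  have vB : [set dist_of (dconv f (dilation phi j)) | j in [set: nat]] v by exists j.
  have [_ /(_ b bm)[_ Ev]] := FE v vB m.
  have rv := dderiv_dconv b df (td j).
  have ae1 : ae_equal (weighted (density (dderiv b v)) (w m))
      (weighted (dconv (dderiv b f) (dilation phi j)) (w m)).
    by apply: filterS (density_ae tphi phi_neq0 rv) => x; rewrite /weighted => ->.
  have [E1 ->] := space_ae hE Ev ae1; split => //.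
  by apply: le_trans (hM v vB); exact: En_norm_ge.
have uE i : forall l, dconv (dderiv (mi_unit i) u) (dilation phi l) =
    dconv (dderiv (mi_add a (mi_unit i)) f) (dilation phi l).
  by move=> l; apply: eq_dconv => // psi tp; exact: dderiv_add.
have ddist b : is_distribution (dderiv b f) by exact: dderiv_distribution.
have dl b l : L1loc (dconv (dderiv b f) (dilation phi l)).
  exact/ccontinuous_L1loc/dconv_ccontinuous.
have am : (mi_order a <= m)%N by exact: leq_trans (ltnW nm).
(* Here the strict inequality [n < m] pays for the additional derivative. *)
have aim i : (mi_order (mi_add a (mi_unit i)) <= m)%N.
  by rewrite mi_order_add mi_order_unit addn1 (leq_ltn_trans an).
pose F l := dconv u (dilation phi l).
pose G j := dconv (dist_of (F j)) (dilation phi j).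
pose U j := weighted (G j) (w n).
have EU j : E (U j).
  have [E1 _] := derivE a j am.
  by have [] := hC _ _ (dl a j) E1 (td j) (phi_out j).
pose B := C * (\sum_i M * L1norm_on setT (eta i)).
have step l j : let D x := dconv (dist_of (F l)) (dilation phi j) x -
      dconv (dist_of (F l)) (dilation phi j.+1) x in
    E (weighted D (w n)) /\ N (weighted D (w n)) <= 2 ^- j * B.
  move=> D; pose T i := weighted (dconv (dist_of (dconv (dderiv (mi_unit i) u) (dilation phi l)))
     (dilation (eta i) j)) (w n).
  have ET i : E (T i) /\ N (T i) <= C * (M * L1norm_on setT (eta i)).
    have [E1 N1] := derivE _ l (aim i); rewrite -uE in E1 N1.
    have tj := (test_dilation j (te i)).1.
    have [|E2 N2] := hC _ _ _ E1 tj (eta_out i j); first by rewrite uE; exact: dl.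
    split => //; apply: le_trans N2 _; rewrite ler_wpM2l ?(ltW C0)//.
    rewrite (L1norm_dilation j (test_cintegrable (te i))) ler_wpM2r//.
    by apply: Rintegral_ge0 => y _; exact: cn_ge0.
  have [||E3 N3] := @space_sum _ _ _ _ hE _ (index_enum 'I_d)
    (fun i x => (2 ^- j)%:C%C * T i x) (fun i => 2 ^- j * (C * (M * L1norm_on setT (eta i)))).
  - by move=> i; have [] := bfs_scale bE (2 ^- j)%:C%C (ET i).1.
  - move=> i; have [_ ->] := bfs_scale bE (2 ^- j)%:C%C (ET i).1.
    have j0 : 0 <= 2 ^- j :> R by rewrite invr_ge0 exprn_ge0.
    by rewrite cn_real ger0_norm// ler_wpM2l//; exact: (ET i).2.
  have DE : weighted D (w n) = fun x => \sum_i (2 ^- j)%:C%C * T i x.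
    apply/funext => x; rewrite /weighted /D (dconv_dilation_difference j l du te he).
    by rewrite mulr_suml; apply: eq_bigr => i _; rewrite mulrA.
  by rewrite DE /B !mulr_sumr.
(* Two differences, with [l = j] and [l = j + 1], joined by the symmetry of the double convolution.
   The second has a bound of the order of half the first, which is estimated by the same value by
   means of [step]. *)
have GG j : N (fun x => U j x - U j.+1 x) <= 2 ^- j * (2 * B).
  have [E1 N1] := step j j; have [E2 N2] := step j.+1 j.
  have [_ N3] := bfs_add bE E1 E2.
  have -> : (fun x => U j x - U j.+1 x) = (fun x =>
    weighted (fun x => dconv (dist_of (F j)) (dilation phi j) x -
      dconv (dist_of (F j)) (dilation phi j.+1) x) (w n) x +
    weighted (fun x => dconv (dist_of (F j.+1)) (dilation phi j) x -
      dconv (dist_of (F j.+1)) (dilation phi j.+1) x) (w n) x).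
    apply/funext => x; rewrite /U /weighted /G.
    have -> : dconv (dist_of (F j.+1)) (dilation phi j) x =
        dconv (dist_of (F j)) (dilation phi j.+1) x.
      by rewrite /F (dconv_comm du (td j.+1) (td j)).
    by rewrite -mulrDl addrA subrK mulrBl.
  apply: le_trans N3 _; apply: le_trans (lerD N1 N2) _.
  by rewrite -mulrDr [2 * B]mulr_natl -mulr2n.
(* Summing [2 ^- (k + i) * (2 * B)] over [i < t] gives exactly this closed form, so after the
   triangle inequality the induction step is an identity. *)
have cauchy k t : N (fun x => U k x - U (k + t)%N x) <= 2 ^- k * (4 * B) * (1 - 2 ^- t).
  elim: t => [|t IH].
    rewrite addn0 expr0 invr1 subrr mulr0 (_ : (fun x => _) = fun=> 0) ?(norm_zero hE)//.
    by apply/funext => x; rewrite subrr.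
  rewrite addnS; apply: le_trans (norm_triangle hE (EU k) (EU (k + t)%N) (EU _)) _.
  apply: le_trans (lerD IH (GG _)) _; rewrite exprD exprS !invfM.
  rewrite le_eqVlt; apply/orP; left; apply/eqP; field.
  by apply/andP; split; apply: expf_neq0.
have B0 : 0 <= B.
  have := le_trans (norm_ge0 hE (step 0 0).1) (step 0 0).2.
  by rewrite expr0 invr1 mul1r.
have small (e : R) : 0 < e -> exists k0 : nat, forall k, (k0 <= k)%N -> 2 ^- k * (4 * B) < e.
  move=> e0; pose k0 := (Num.truncn (4 * B / e)).+1; exists k0 => k kk.
  rewrite mulrC ltr_pdivrMr ?exprn_gt0// [ltRHS]mulrC -ltr_pdivrMr//.
  apply: (lt_trans (truncnS_gt _)); rewrite -/k0.
  apply: (@lt_le_trans _ _ (2 ^+ k0 : R)); last by rewrite ler_weXn2l// ler1n.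
  by rewrite -natrX ltr_nat ltn_expl.
have Ucauchy k l : (k <= l)%N -> N (fun x => U k x - U l x) <= 2 ^- k * (4 * B).
  move=> /subnKC <-; apply: le_trans (cauchy _ _) _.
  have k0 : 0 <= 2 ^- k * (4 * B).
    by apply: mulr_ge0; [rewrite invr_ge0 exprn_ge0|exact: mulr_ge0].
  by rewrite ler_piMr// gerBl invr_ge0 exprn_ge0.
have [g Eg Ug] : exists2 g, E g & N (fun x => U k x - g x) @[k --> \oo] --> (0 : R).
  apply: (bfs_complete bE EU) => e e0; have [k0 hk0] := small e e0.
  exists k0 => k l kk ll; have [kl|/ltnW lk] := leqP k l.
    exact: le_lt_trans (Ucauchy _ _ kl) (hk0 _ kk).
  rewrite (norm_symm hE (EU k) (EU l)).
  exact: le_lt_trans (Ucauchy _ _ lk) (hk0 _ ll).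
pose c := cint mu phi; pose b := c ^- 2.
have c20 : c ^+ 2 != 0 by rewrite expf_neq0//; apply/eqP.
have [Ebg _] := bfs_scale bE b Eg.
(* The functions [G j] tend to [c ^ 2 * u] and their weighted versions [U j] to [g], so the density
   of [u] must be [g] divided by the weight and by [c ^ 2]. *)
pose z x := b * g x * ((w n x)^-1)%:C%C.
have wn0 x : (w n x)%:C%C != 0 :> R[i].
  by rewrite fmorph_eq0 gt_eqF// (lt_le_trans _ (weight_ge1 hw n x)).
have wV x : (w n x)%:C%C * ((w n x)^-1)%:C%C = 1 :> R[i].
  rewrite -(rmorphM (real_complex R)) divff ?(rmorph1 (real_complex R))//.
  by rewrite gt_eqF// (lt_le_trans _ (weight_ge1 hw n x)).
have zl : L1loc z by apply: divw_L1loc => //; exact: (bfs_L1loc bE Ebg).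
have Gl j : L1loc (G j).
  apply/ccontinuous_L1loc/dconv_ccontinuous => //.
  exact: dist_of_distribution (dl a j).
(* Both sides are compared with [b * dist_of (G j) psi]: on one side through the convergence of the
   double mollification, on the other through the continuous embedding of E into L1 on the support
   of [psi]. *)
have zu : represents z u.
  split => // psi tp; apply/eqP; rewrite -subr_eq0; apply/eqP/cn_le_all => e e0.
  have [K cK pK] := tp.2; have [P P0 pP] := test_bound tp.
  have [cK' hcK] := bfs_continuous bE cK.
  have e2 : 0 < e / 2 by rewrite divr_gt0.
  have b0 : 0 < cn b + 1 by rewrite ltr_wpDl// cn_ge0.
  have [j0 hj0] := double_mollification_cvg tphi du tp (divr_gt0 e2 b0).
  (* The constants leading from [N (U j - g)] to the pairing with [psi]: the bound of [psi], the
     embedding constant on [K] and |b|; the 1 makes [A] positive. *)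
  pose A := P * (`|cK'| * cn b) + 1.
  have A0 : 0 < A by rewrite ltr_wpDl// !mulr_ge0 ?cn_ge0// ltW.
  have /cvgrPdist_lt /(_ (e / 2 / A)) := Ug.
  move=> /(_ (divr_gt0 e2 A0)) [j1 _ hj1].
  pose j := maxn j0 j1.
  have h1 : cn (dist_of (G j) psi - c ^+ 2 * u psi) <= e / 2 / (cn b + 1).
    exact: hj0 (leq_maxl _ _).
  have h2 : N (fun x => U j x - g x) <= e / 2 / A.
    have := hj1 j (leq_maxr _ _); rewrite sub0r normrN => /ltW.
    by apply: le_trans; exact: ler_norm.
  pose y x := b * (U j x - g x).
  have [Ey Ny] := bfs_scale bE b (space_sub hE (EU j) Eg).
  have yl : L1loc y by exact: (bfs_L1loc bE Ey).
  have yE : (fun x => b * G j x - z x) = (fun x => y x * ((w n x)^-1)%:C%C).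
    apply/funext => x; rewrite /y /z /U /weighted -[b * G j x]mulr1 -(wV x); ring.
  have h3 : cn (b * dist_of (G j) psi - dist_of z psi) <= e / 2.
    rewrite -(dist_of_lin b (Gl j) zl tp) yE.
    apply: le_trans (dist_of_bound (divw_L1loc hw n yl) tp cK pK pP) _.
    apply: (@le_trans _ _ (P * (`|cK'| * (cn b * (e / 2 / A))))).
      rewrite ler_wpM2l ?(ltW P0)//.
      apply: (@le_trans _ _ (L1norm_on K y)).
        have [_ i1] := divw_L1loc hw n yl cK; have [_ i2] := yl K cK.
        rewrite /L1norm_on /Rintegral fine_le//.
        + by rewrite ge0_fin_numE//; apply: integral_ge0 => x _; rewrite lee_fin cn_ge0.
        + by rewrite ge0_fin_numE//; apply: integral_ge0 => x _; rewrite lee_fin cn_ge0.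
        rewrite [leLHS]integral_mkcond [leRHS]integral_mkcond.
        apply: ge0_ae_le_integral_nomeas.
        + by move=> x; rewrite /patch; case: ifP => // _; rewrite lee_fin cn_ge0.
        + by move=> x; rewrite /patch; case: ifP => // _; rewrite lee_fin cn_ge0.
        + apply: aeW => x; rewrite /patch; case: ifP => // _.
          have w1 := weight_ge1 hw n x.
          rewrite lee_fin /modulus cnM cn_real ler_piMr ?cn_ge0//.
          by rewrite ger0_norm ?invr_ge0 ?(le_trans _ w1)// invf_le1// (lt_le_trans _ w1).
      apply: le_trans (hcK y Ey) _; apply: (@le_trans _ _ (`|cK'| * N y)).
        by rewrite ler_wpM2r ?(norm_ge0 hE)// ler_norm.
      by rewrite Ny !ler_wpM2l// cn_ge0.
    have -> : P * (`|cK'| * (cn b * (e / 2 / A))) = e / 2 * ((A - 1) / A).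
      by rewrite /A addrK; field; rewrite gt_eqF.
    by apply: ler_piMr; [exact: ltW|rewrite ler_pdivrMr// mul1r gerBl].
  have -> : u psi - dist_of z psi = - (b * (dist_of (G j) psi - c ^+ 2 * u psi)) +
      (b * dist_of (G j) psi - dist_of z psi).
    by rewrite mulrBr [b * (_ * u psi)]mulrA mulVf// mul1r; ring.
  rewrite (splitr e); apply: le_trans (cnD _ _) _; apply: lerD h3.
  rewrite cnN cnM; apply: le_trans (ler_wpM2l (cn_ge0 _) h1) _.
  rewrite mulrCA; apply: ler_piMr; first exact: ltW.
  by rewrite ler_pdivrMr// mul1r lerDl.
split; first by exists z.
apply: (space_ae hE Ebg _).1.
apply: filterS (density_ae tphi phi_neq0 zu) => x; rewrite /weighted /u => ->.
by rewrite /z -[LHS]mulr1 -(wV x); ring.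
Qed.

End converse.

Theorem proposition6p1 (R : realType) (d : nat)
    (E : set ('rV[R]_d -> R[i])) (N : ('rV[R]_d -> R[i]) -> R)
    (hE : TIBF_bounded_type E N) (hsolid : solid E N)
    (w : nat -> 'rV[R]_d -> R) (hw : weight_function_system w) (hwM : wM w)
    (phi : 'rV[R]_d -> R[i]) (hphi : test_function phi)
    (hint : cintegral phi <> 0)
    (hclosed : closed_subspace_of_mc E N)
    (f : functional R d) (hf : is_distribution f) :
  EW E w f <->
  EW_bounded E N w
    [set dist_of (dist_convolution f (dilation phi j)) | j in [set: nat]].
Proof.
split; first exact: EW_mollified_bounded.
exact: EW_of_mollified_bounded.
Qed.
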